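(* Assume that $T$ is $\omega$-stable. Let $F$ be a $\kappa$-PAC substructure in $\mathfrak{C}$, where $\kappa\geqslant|T|^+$. Suppose that $A\subseteq F$ is such that $|A|^+\leqslant\kappa$. Then $\operatorname{acl}_F(A)=\operatorname{acl}(A)\cap F$, where $\operatorname{acl}_F(A)$ is the model-theoretic algebraic closure of $A$ computed in the $\mathcal{L}$-structure $F$ and $\operatorname{acl}(A)$ is computed in $\mathfrak{C}$.
   Context: $T$ is a complete, possibly many-sorted, $\mathcal{L}$-theory with quantifier elimination and elimination of imaginaries; $\mathfrak{C}\models T$ is a monster model. A (small) substructure $F$ of $\mathfrak{C}$ is regarded as an $\mathcal{L}$-structure in its own right. For $\kappa\geqslant|T|^+$, a substructure $F\subseteq\mathfrak{C}$ is $\kappa$-PAC if whenever $A\subseteq F$ has cardinality $<\kappa$ and $p(\bar x)$ (with $|\bar x|<\kappa$) is a complete stationary type over $A$ in the sense of $\mathfrak{C}$, then $p$ is realized in $F$. *)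

(* Defs.v *)
From mathcomp Require Import all_boot.
From mathcomp Require Import boolp classical_sets functions cardinality.

Set Implicit Arguments.
Unset Strict Implicit.
Unset Printing Implicit Defensive.

Local Open Scope classical_set_scope.
Local Open Scope card_scope.

(* A cardinal kappa is given by a type K having kappa elements.  Hence
   "kappa >= |X|^+" is stated as |X| < kappa. *)
Definition card_lt T U (A : set T) (B : set U) : Prop :=
  A #<= B /\ ~ (B #<= A).

Record language := Language {
  sorts : Type;
  fsym : Type;
  farity : fsym -> nat;
  fdom : forall f : fsym, 'I_(farity f) -> sorts;
  fcod : fsym -> sorts;
  rsym : Type;
  rarity : rsym -> nat;
  rdom : forall r : rsym, 'I_(rarity r) -> sorts }.

Arguments fdom {l} f _.
Arguments rdom {l} r _.

(* The free variables of each sort.  Parameters from a structure are also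
   treated as free variables, to be interpreted by themselves. *)
Definition ctx (L : language) := sorts L -> Type.

Section Syntax.
Variable L : language.

Definition ctx0 : ctx L := fun _ => void.

Definition ctx_sum (X Y : ctx L) : ctx L := fun s => (X s + Y s)%type.

Inductive ctx_ext (X : ctx L) (s : sorts L) : sorts L -> Type :=
| ext_new : ctx_ext X s s
| ext_old s' : X s' -> ctx_ext X s s'.

(* The variables of a tuple (x_i)_{i in I}, finite or not, x_i of sort sg i. *)
Inductive vars (I : Type) (sg : I -> sorts L) : sorts L -> Type :=
| var_at i : vars sg (sg i).

Definition var1 (s : sorts L) : ctx L := vars (fun _ : unit => s).

Inductive term (X : ctx L) : sorts L -> Type :=
| Tvar s : X s -> term X s
| Tapp (f : fsym L) : (forall i, term X (fdom f i)) -> term X (fcod f).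

(* The other connectives and the existential quantifier are the classical
   abbreviations. *)
Inductive formula (X : ctx L) : Type :=
| Fbot : formula X
| Feq s : term X s -> term X s -> formula X
| Frel (r : rsym L) : (forall i, term X (rdom r i)) -> formula X
| Fimp : formula X -> formula X -> formula X
| Fall s : formula (ctx_ext X s) -> formula X.

Definition Fnot (X : ctx L) (phi : formula X) : formula X :=
  Fimp phi (Fbot X).

Fixpoint quantifier_free (X : ctx L) (phi : formula X) : Prop :=
  match phi with
  | Fbot => True
  | Feq _ _ _ => True
  | Frel _ _ => True
  | Fimp a b => quantifier_free a /\ quantifier_free b
  | Fall _ _ => False
  end.

Definition ctx_map (X Y : ctx L) := forall s, X s -> Y s.

Definition ext_map (X Y : ctx L) (h : ctx_map X Y) (s : sorts L) :
    ctx_map (ctx_ext X s) (ctx_ext Y s) :=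
  fun s' z => match z in ctx_ext _ _ u return ctx_ext Y s u with
              | ext_new => ext_new Y s
              | ext_old _ x => ext_old s (h _ x)
              end.

Fixpoint rename_term (X Y : ctx L) (h : ctx_map X Y) s (t : term X s) :
    term Y s :=
  match t in term _ u return term Y u with
  | Tvar _ x => Tvar (h _ x)
  | Tapp f ts => Tapp (fun i => rename_term h (ts i))
  end.

Fixpoint rename (X Y : ctx L) (h : ctx_map X Y) (phi : formula X) :
    formula Y :=
  match phi with
  | Fbot => Fbot Y
  | Feq _ t u => Feq (rename_term h t) (rename_term h u)
  | Frel r ts => Frel (fun i => rename_term h (ts i))
  | Fimp a b => Fimp (rename h a) (rename h b)
  | Fall s a => Fall (rename (@ext_map _ _ h s) a)
  end.

(* Formulas in finitely many free variables; their number is |T|, that is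
   |L| + aleph_0, for any L-theory T. *)
Definition fin_formula : Type :=
  {n : nat & {sg : 'I_n -> sorts L & formula (vars sg)}}.

End Syntax.

Arguments ctx0 {L} _.

(* Sorts may be empty: a substructure of a structure can miss a sort. *)
Record structure (L : language) := Structure {
  carrier :> sorts L -> Type;
  fint : forall f : fsym L, (forall i, carrier (fdom f i)) -> carrier (fcod f);
  rint : forall r : rsym L, (forall i, carrier (rdom r i)) -> Prop }.

Section Semantics.
Variables (L : language) (M : structure L).

Definition elt : Type := {s : sorts L & M s}.

Definition mk_elt (s : sorts L) (x : M s) : elt := existT _ s x.

Definition valuation (X : ctx L) := forall s, X s -> M s.

Definition tuple_of (I : Type) (sg : I -> sorts L) := forall i, M (sg i).

Definition assign I (sg : I -> sorts L) (a : tuple_of sg) :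
    valuation (vars sg) :=
  fun s x => match x in vars _ u return M u with var_at i => a i end.

Definition assign1 (s : sorts L) (c : M s) : valuation (var1 s) :=
  assign (fun _ : unit => c).

Definition val0 : valuation ctx0 := fun s x => match x with end.

Definition val_sum (X Y : ctx L) (v : valuation X) (w : valuation Y) :
    valuation (ctx_sum X Y) :=
  fun s z => match z with inl x => v s x | inr y => w s y end.

Definition val_ext (X : ctx L) (v : valuation X) (s : sorts L) (c : M s) :
    valuation (ctx_ext X s) :=
  fun s' z => match z in ctx_ext _ _ u return M u with
              | ext_new => c
              | ext_old s'' x => v s'' x
              end.

Fixpoint eval (X : ctx L) (v : valuation X) s (t : term X s) : M s :=
  match t in term _ u return M u with
  | Tvar s' x => v s' x
  | Tapp f ts => fint (fun i => eval v (ts i))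
  end.

Fixpoint sat (X : ctx L) (phi : formula X) : valuation X -> Prop :=
  match phi with
  | Fbot => fun _ => False
  | Feq _ t u => fun v => eval v t = eval v u
  | Frel r ts => fun v => rint (fun i => eval v (ts i))
  | Fimp a b => fun v => sat a v -> sat b v
  | Fall s a => fun v => forall c : M s, sat a (val_ext v c)
  end.

Definition params (A : set elt) : ctx L := fun s => {a : M s | A (mk_elt a)}.

Definition params_val (A : set elt) : valuation (params A) :=
  fun s a => proj1_sig a.

(* L(A)-formulas in the variables X, and their satisfaction. *)
Definition pformula (A : set elt) (X : ctx L) := formula (ctx_sum X (params A)).

Definition psat (A : set elt) (X : ctx L) (v : valuation X)
    (phi : pformula A X) : Prop :=
  sat phi (val_sum v (@params_val A)).

Definition params_incl (A B : set elt) (AB : A `<=` B) (X : ctx L) :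
    ctx_map (ctx_sum X (params A)) (ctx_sum X (params B)) :=
  fun s z => match z with
             | inl x => inl x
             | inr a => inr (exist _ (proj1_sig a) (AB _ (proj2_sig a)))
             end.

(* Types need not be realized in M, and X may be infinite. *)
Definition complete_type (A : set elt) (X : ctx L) (p : set (pformula A X)) :
    Prop :=
  (forall q : set (pformula A X), finite_set q -> q `<=` p ->
     exists v : valuation X, forall phi, q phi -> psat v phi) /\
  (forall phi, p phi \/ p (Fnot phi)).

Definition realizes (A : set elt) (X : ctx L) (v : valuation X)
    (p : set (pformula A X)) : Prop :=
  forall phi, p phi -> psat v phi.

Definition same_type (A : set elt) (X : ctx L) (v w : valuation X) : Prop :=
  forall phi : pformula A X, psat v phi <-> psat w phi.

Definition acl (A : set elt) : set elt :=
  [set c : elt | exists phi : pformula A (var1 (projT1 c)),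
     psat (assign1 (projT2 c)) phi /\
     finite_set [set d : M (projT1 c) | psat (assign1 d) phi]].

(* A formula psi(x, b) with b a finite tuple of M. *)
Record instance (X : ctx L) := Instance {
  inst_arity : nat;
  inst_sort : 'I_inst_arity -> sorts L;
  inst_form : formula (ctx_sum X (vars inst_sort));
  inst_param : tuple_of inst_sort }.

Arguments inst_sort {X} th _ : rename.
Arguments inst_param {X} th _ : rename.

Definition inst_sat (X : ctx L) (th : instance X)
    (b : tuple_of (inst_sort th)) (v : valuation X) : Prop :=
  sat (inst_form th) (val_sum v (assign b)).

(* There are k and realizations b_0, b_1, ... of tp(b/A) such that the family
   psi(x, b_i) is k-inconsistent. *)
Definition divides (A : set elt) (X : ctx L) (th : instance X) : Prop :=
  exists (k : nat) (b : nat -> tuple_of (inst_sort th)),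
    (forall i, same_type A (assign (b i)) (assign (inst_param th))) /\
    (forall S : set nat, S #= `I_k ->
       ~ exists v : valuation X, forall i, S i -> inst_sat (b i) v).

(* Implication is tested on a finite part of q, so that it is implication
   modulo the elementary diagram of M for parameter sets B of any size. *)
Definition forks (A B : set elt) (X : ctx L) (q : set (pformula B X)) : Prop :=
  exists (q0 : set (pformula B X)) (d : nat) (th : 'I_d -> instance X),
    [/\ finite_set q0, q0 `<=` q,
        forall l, divides A (th l) &
        forall v : valuation X, (forall phi, q0 phi -> psat v phi) ->
          exists l, inst_sat (inst_param (th l)) v].

Definition extends_type (A B : set elt) (AB : A `<=` B) (X : ctx L)
    (p : set (pformula A X)) (q : set (pformula B X)) : Prop :=
  forall phi, p phi -> q (rename (params_incl AB (X := X)) phi).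

Definition stationary (A : set elt) (X : ctx L) (p : set (pformula A X)) :
    Prop :=
  forall (B : set elt) (AB : A `<=` B),
    exists! q : set (pformula B X),
      [/\ complete_type q, extends_type AB p q & ~ forks A q].

Definition saturated (K : Type) : Prop :=
  forall A : set elt, card_lt A [set: K] ->
  forall (s : sorts L) (p : set (pformula A (var1 s))),
    complete_type p -> exists c : M s, realizes (assign1 c) p.

Definition automorphism (g : forall s, M s -> M s) : Prop :=
  [/\ forall s, bijective (g s),
      forall (f : fsym L) (a : forall i, M (fdom f i)),
        g _ (fint a) = fint (fun i => g _ (a i)) &
      forall (r : rsym L) (a : forall i, M (rdom r i)),
        rint a <-> rint (fun i => g _ (a i))].

(* A partial elementary map is presented by enumerations a, b of its domain and
   of its image. *)
Definition strongly_homogeneous (K : Type) : Prop :=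
  forall (I : Type) (sg : I -> sorts L) (a b : tuple_of sg),
    card_lt [set: I] [set: K] ->
    (forall phi : formula (vars sg), sat phi (assign a) <-> sat phi (assign b)) ->
    exists g, automorphism g /\ forall i, g _ (a i) = b i.

Record substructure := Substructure {
  sub_set : set elt;
  sub_closed : forall (f : fsym L) (a : forall i, M (fdom f i)),
    (forall i, sub_set (mk_elt (a i))) -> sub_set (mk_elt (fint a)) }.

Definition induced (F : substructure) : structure L :=
  @Structure L (fun s => {x : M s | sub_set F (mk_elt x)})
    (fun f a => exist _ (fint (fun i => proj1_sig (a i)))
                  (sub_closed (fun i => proj2_sig (a i))))
    (fun r a => rint (fun i => proj1_sig (a i))).

Definition kappa_PAC (K : Type) (F : substructure) : Prop :=
  forall A : set elt, A `<=` sub_set F -> card_lt A [set: K] ->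
  forall (I : Type) (sg : I -> sorts L), card_lt [set: I] [set: K] ->
  forall p : set (pformula A (vars sg)), complete_type p -> stationary p ->
    exists c : tuple_of sg, (forall i, sub_set F (mk_elt (c i))) /\
      realizes (assign c) p.

End Semantics.

Definition sub_incl (L : language) (M : structure L) (F : substructure M)
    (c : elt (induced F)) : elt M :=
  mk_elt (proj1_sig (projT2 c)).

Definition theory (L : language) := set (formula (@ctx0 L)).

Section Theories.
Variables (L : language) (T : theory L).

Definition models (M : structure L) : Prop :=
  forall phi, T phi -> sat phi (@val0 L M).

Definition complete_theory : Prop :=
  (exists M : structure L, models M) /\
  (forall phi : formula (@ctx0 L),
     (forall M, models M -> sat phi (@val0 L M)) \/
     (forall M, models M -> sat (Fnot phi) (@val0 L M))).

Definition quantifier_elimination : Prop :=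
  forall (n : nat) (sg : 'I_n -> sorts L) (phi : formula (vars sg)),
  exists psi : formula (vars sg), quantifier_free psi /\
    forall M, models M -> forall v : valuation M (vars sg),
      sat phi v <-> sat psi v.

Definition def_rel (M : structure L) n (sg : 'I_n -> sorts L)
    (E : formula (ctx_sum (vars sg) (vars sg))) (x y : tuple_of M sg) : Prop :=
  sat E (val_sum (assign x) (assign y)).

Definition equivalence_on (X : Type) (R : X -> X -> Prop) : Prop :=
  [/\ forall x, R x x, forall x y, R x y -> R y x &
      forall x y z, R x y -> R y z -> R x z].

(* Each class of a 0-definable equivalence relation is phi(M, b) for some
   formula phi and a unique finite real tuple b. *)
Definition elimination_of_imaginaries : Prop :=
  forall M, models M ->
  forall (n : nat) (sg : 'I_n -> sorts L)
    (E : formula (ctx_sum (vars sg) (vars sg))),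
    equivalence_on (@def_rel M n sg E) ->
  forall a : tuple_of M sg,
  exists (m : nat) (tau : 'I_m -> sorts L)
    (phi : formula (ctx_sum (vars sg) (vars tau))),
  exists! b : tuple_of M tau,
    forall x : tuple_of M sg,
      def_rel E x a <-> sat phi (val_sum (assign x) (assign b)).

Definition omega_stable : Prop :=
  forall M, models M ->
  forall A : set (elt M), countable A ->
  forall (n : nat) (sg : 'I_n -> sorts L),
    countable [set p : set (pformula A (vars sg)) | complete_type p].

(* A set is small when it has fewer than |Kbar| elements. *)
Definition monster (Kbar : Type) (C : structure L) : Prop :=
  [/\ models C, card_lt [set: fin_formula L] [set: Kbar],
      saturated C Kbar & strongly_homogeneous C Kbar].

End Theories.

(* Main.v *)
Require Import Defs.
From Stdlib Require List.
From mathcomp Require Import all_boot.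
From mathcomp Require Import boolp classical_sets functions cardinality.
From mathcomp Require Import filter zify.

(* Let G = Aut(C/F).  For an automorphism t of C and a small subset A of F such
   that t commutes with G on acl(A), the restriction of t to A preserves all
   formulas of the structure F.  This is a back-and-forth argument, whose
   extension step is as follows.  Given c in F and a small subset Z of F, choose
   t1 extending t on acl(A) such that the type of E' = t1(acl(Ac)) over
   F0 = acl(Z) is the restriction of a t(acl(A))-invariant type, which is unique
   by stability.  Hence every g in G acts on F0 as itself and on E' as
   t1 g t1^-1 by a single automorphism of C.  Let D be the set of common fixed
   points of these automorphisms.  Elimination of imaginaries gives that E' is
   definable over D and F0, and that the type of D over F0 /\ F implies its type
   over F0, so that it is stationary.  A realization of it in F given by the PAC
   property moves t1 to an automorphism that commutes with G on acl(Ac), and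
   that sends c outside of acl(Z) when c is not in acl(A).

   Starting from the identity on A, this gives a point of F outside of any given
   finite set with the same type over A in F as c, so c is not in acl_F(A)
   when it is not in acl(A).  The other inclusion holds because algebraicity in C
   is witnessed by quantifier-free formulas. *)

Set Implicit Arguments.
Unset Strict Implicit.
Unset Printing Implicit Defensive.

Local Open Scope classical_set_scope.
Local Open Scope card_scope.

(** An automorphism of C need not map F to itself, so it says nothing directly about formulas of F
    with quantifiers: a map between subsets of F has to be extended to each further point of F. The
    obstacle is that the type of such a point over the image need not be stationary, so the PAC
    property does not apply to it directly. Equivariance under G on the whole algebraic closure is
    the condition that reproduces itself. The set D is a form of Galois descent: acting by g on F0
    and by t1 g t1^-1 on E' is a twisted action, D is its fixed structure, and once D is moved into
    F the twisted action becomes the genuine one. As D collects all the needed codes at once it may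
    be infinite, which calls for the PAC property for tuples of any length below kappa; since |T| <
    kappa, algebraic closures stay in that range. Omega-stability enters only through the absence of
    binary trees of definable sets; bounded local ranks, definability of types and the existence,
    symmetry and uniqueness of invariant extensions all derive from it. *)

Lemma sig_inj T (P : T -> Prop) : injective (@proj1_sig T P).
Proof. by move=> [x Px] [y Py] /= xy; apply/eq_exist. Qed.

Lemma mem_In (T : eqType) (l : seq T) x : List.In x l <-> x \in l.
Proof.
elim: l => //= a l IH; rewrite inE; split=> [[->|/IH ->]|/orP[/eqP->|/IH]].
- by rewrite eqxx.
- by rewrite orbT.
- by left.
- by right.
Qed.

Lemma finite_In T (A : set T) :
  finite_set A <-> exists l : seq T, forall x, A x <-> List.In x l.
Proof.
move: A; elim/Peq : T => T A; split=> [/finite_seqP[l ->]|[l H]].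
  by exists l => x; rewrite mem_In.
by apply/finite_seqP; exists l; apply/funext => x; apply/propext; rewrite H mem_In.
Qed.

(** * Cardinal arithmetic *)

(** Types are compared rather than sets, which suits sums, products and lists; [card_leE] goes back
    to [#<=]. *)
Definition lec (T U : Type) : Prop := exists f : T -> U, injective f.

Lemma lec_refl T : lec T T.
Proof. by exists id. Qed.

Lemma lec_trans T U V : lec T U -> lec U V -> lec T V.
Proof. by move=> [f fi] [g gi]; exists (g \o f); exact: inj_comp. Qed.

Lemma card_leE T U (A : set T) (B : set U) :
  A #<= B <-> lec {x | A x} {x | B x}.
Proof.
split=> [/card_leP[f]|[f fi]].
  exists (fun x => exist B (val (f (SigSub (mem_set (proj2_sig x)))))
                          (set_mem (valP (f (SigSub (mem_set (proj2_sig x))))))).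
  move=> x y [] /val_inj H.
  by have := @inj _ _ _ f _ _ (in_setT _) (in_setT _) H => -[] /sig_inj.
apply/card_leP.
have : $|{inj [set: A] >-> B}|.
  apply/injPex.
  exists (fun x => SigSub (mem_set (proj2_sig (f (exist A (val x) (set_mem (valP x))))))).
  move=> [x Ax] [y Ay] _ _ /= [] H.
  by have /fi[exy] := sig_inj H; apply/val_inj.
by case=> g; squash (totalfun g).
Qed.

Lemma lec_sig T (A B : set T) : A `<=` B -> lec {x | A x} {x | B x}.
Proof.
move=> AB; exists (fun x => exist B (proj1_sig x) (AB _ (proj2_sig x))).
by move=> x y [] /sig_inj.
Qed.

Lemma lec_setT T : lec {x : T | [set: T] x} T /\ lec T {x : T | [set: T] x}.
Proof.
split; last by exists (fun x => exist [set: T] x I) => x y [].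
by exists (@proj1_sig _ _); exact: sig_inj.
Qed.

Lemma lec_image T U (f : T -> U) (A : set T) : lec {y | (f @` A) y} {x | A x}.
Proof.
have h (y : {y | (f @` A) y}) : {x : {x | A x} | f (proj1_sig x) = proj1_sig y}.
  case: y => y /= /cid2[x Ax fx].
  by exists (exist A x Ax).
exists (fun y => proj1_sig (h y)) => y1 y2.
case: (h y1) => x1 e1; case: (h y2) => x2 e2 /= ex.
by apply/sig_inj; rewrite -e1 -e2 ex.
Qed.

Lemma lec_prod T T' U U' : lec T U -> lec T' U' -> lec (T * T') (U * U').
Proof.
move=> [f fi] [g gi]; exists (fun p => (f p.1, g p.2)).
by move=> [a b] [c d] [] /fi -> /gi ->.
Qed.

Lemma lec_sum T T' U U' : lec T U -> lec T' U' -> lec (T + T') (U + U').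
Proof.
move=> [f fi] [g gi].
exists (fun p => match p with inl x => inl (f x) | inr y => inr (g y) end).
by move=> [a|a] [b|b] // [] => [/fi|/gi] ->.
Qed.

(** Zorn's lemma gives a maximal graph of a partial injection; if it missed a point on each side,
    that pair could be added to it. *)
Lemma lec_total T U : lec T U \/ lec U T.
Proof.
pose P (H : set (T * U)) := forall p q, H p -> H q -> (p.1 = q.1) <-> (p.2 = q.2).
have [|H [PH Hmax]] := @Zorn_bigcup _ P.
  move=> F FP Ftot p q [X FX Xp] [Y FY Yq].
  by case: (Ftot _ _ FX FY) => [/(_ _ Xp)Yp|/(_ _ Yq)Xq];
    [apply: (FP _ FY)|apply: (FP _ FX)].
have [dT|/existsNP[x nx]] := pselect (forall x, exists y, H (x, y)).
  left; exists (fun x => projT1 (cid (dT x))) => x y.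
  case: (cid (dT x)) => u Hu; case: (cid (dT y)) => v Hv /= uv.
  by apply/(PH _ _ Hu Hv).
have [dU|/existsNP[y ny]] := pselect (forall y, exists x, H (x, y)).
  right; exists (fun x => projT1 (cid (dU x))) => u v.
  case: (cid (dU u)) => x1 Hu; case: (cid (dU v)) => x2 Hv /= uv.
  by apply/(PH _ _ Hu Hv).
exfalso; apply: (Hmax (H `|` [set (x, y)])).
  split; first by move=> p; left.
  by move=> /(_ (x, y) (or_intror erefl)) Hxy; apply: nx; exists y.
have aux p : H p -> p.1 <> x /\ p.2 <> y.
  case: p => a b Hab /=; split=> e; move: Hab; rewrite e => Hab.
    by apply: nx; exists b.
  by apply: ny; exists a.
move=> p q [Hp|->] [Hq|->] /=; first exact: PH.
- by have [] := aux _ Hp.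
- by have [n1 n2] := aux _ Hq; split=> /esym.
- by [].
Qed.

Lemma lec_sum2 T : lec nat T -> lec (T * T) T -> lec (T + T) T.
Proof.
move=> [i ii] TT; apply: lec_trans TT.
exists (fun z => match z with inl x => (i 0, x) | inr x => (i 1, x) end).
by move=> [a|a] [b|b] // [] // => [->|/ii|/ii|->].
Qed.

(** Zorn's lemma is applied to graphs [H] of injections [S * S -> S], with [S] the domain of [H],
    that extend a pairing on the copy of [nat]. For a maximal [H], either the complement of [S]
    embeds in [S], and [T] is no larger than [S], or [S] embeds in its complement, and [H] extends
    to the union of [S] and this image. *)
Lemma lec_square T : lec nat T -> lec (T * T) T.
Proof.
move=> [i ii].
pose dom (H : set (T * T * T)) x := exists z, H (x, x, z).
pose Good (H : set (T * T * T)) :=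
  [/\ forall x y z, H (x, y, z) -> [/\ dom H x, dom H y & dom H z],
      forall x y, dom H x -> dom H y -> exists z, H (x, y, z) &
      forall p q, H p -> H q -> (p.1 = q.1) <-> (p.2 = q.2)].
pose H0 : set (T * T * T) :=
  [set p | exists m n, p = (i m, i n, i (pickle (m, n)))].
(* [Zorn_bigcup] also covers the empty chain, whose union is [set0]; maximality excludes this case
   later because [H0] is larger. *)
pose P H := H = set0 \/ (Good H /\ H0 `<=` H).
have H0dom m : dom H0 (i m) by exists (i (pickle (m, m))), m, m.
have GH0 : Good H0.
  split.
  - by move=> x y z [m [n []]] -> -> ->.
  - move=> x y [_ [m [_ [-> _ _]]]] [_ [n [_ [-> _ _]]]].
    by exists (i (pickle (m, n))), m, n.
  - move=> _ _ [m [n ->]] [m' [n' ->]] /=; split.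
      by case=> /ii -> /ii ->.
    by move=> /ii /(pcan_inj pickleK) [] -> ->.
have [|H [PH Hmax]] := @Zorn_bigcup _ P.
  move=> F FP Ftot.
  have [[X [FX X0]]|nX] := pselect (exists X, F X /\ X <> set0); last first.
    left; rewrite -subset0 => p [X FX Xp]; apply: nX; exists X; split=> // X0.
    by rewrite X0 in Xp.
  right; split; last first.
    by have [//|[_ s]] := FP _ FX; move=> p /s Xp; exists X.
  have G Y : F Y -> Y <> set0 -> Good Y by move=> FY Y0; have [|[]] := FP _ FY.
  have ne (Y : set (T * T * T)) p : Y p -> Y <> set0 by move=> Yp Y0; rewrite Y0 in Yp.
  have domU Y x : F Y -> dom Y x -> dom (\bigcup_(X in F) X) x.
    by move=> FY [z Yz]; exists z, Y.
  split.
  - move=> x y z [Y FY Yp]; have [/(_ _ _ _ Yp) [a b c] _ _] := G _ FY (ne _ _ Yp).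
    by split; apply: (domU Y).
  - move=> x y [z [Y FY Yp]] [z' [Y' FY' Yp']].
    case: (Ftot _ _ FY FY') => [/(_ _ Yp)Yq|/(_ _ Yp')Yq].
      have [_ D _] := G _ FY' (ne _ _ Yp').
      have [|w Hw] := D x y _ (ex_intro _ z' Yp'); first by exists z.
      by exists w, Y'.
    have [_ D _] := G _ FY (ne _ _ Yp).
    have [|w Hw] := D x y (ex_intro _ z Yp); first by exists z'.
    by exists w, Y.
  - move=> p q [Y FY Yp] [Y' FY' Yq].
    case: (Ftot _ _ FY FY') => [/(_ _ Yp)Yp'|/(_ _ Yq)Yq'].
      by have [_ _ D] := G _ FY' (ne _ _ Yq); apply: D.
    by have [_ _ D] := G _ FY (ne _ _ Yp); apply: D.
have {PH} [[D1 D2 D3] H0H] : Good H /\ H0 `<=` H.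
  case: PH => // H_0; exfalso; apply: (Hmax H0); last by right; split.
  by rewrite H_0; split=> // /(_ (i 0, i 0, i (pickle (0, 0)))); apply; exists 0, 0.
pose S := {x | dom H x}.
have natS : lec nat S.
  exists (fun m => exist (dom H) (i m) (ex_intro _ _ (H0H _ (proj2_sig (cid (H0dom m)))))).
  by move=> m n [] /ii.
have SS : lec (S * S) S.
  pose f (p : S * S) := cid (D2 _ _ (proj2_sig p.1) (proj2_sig p.2)).
  have fd p : dom H (projT1 (f p)).
    by case: (f p) => z /= /D1 [].
  exists (fun p => exist (dom H) _ (fd p)) => p q [].
  case: (f p) => z Hz; case: (f q) => w Hw /= zw.
  have /(D3 _ _ Hz Hw)/= := zw.
  by case: p q {Hz Hw} => [a b] [c d] /= [] /sig_inj -> /sig_inj ->.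
have S2 := lec_sum2 natS SS.
have ST : lec S T by exists (@proj1_sig _ _); exact: sig_inj.
have [|TS] := lec_total {x | ~ dom H x} S => [TS|].
  have : lec T S.
    apply: lec_trans (lec_trans (lec_sum (lec_refl S) TS) S2).
    exists (fun x => match pselect (dom H x) with
                     | left d => inl (exist (dom H) x d)
                     | right d => inr (exist (fun x => ~ dom H x) x d) end).
    by move=> x y; case: (pselect _) => // dx; case: (pselect _) => // dy [].
  by move=> TS'; apply: lec_trans ST; apply: lec_trans SS; exact: lec_prod.
case: TS => g gi; exfalso.
have [k ki] : lec ((S + S) * (S + S)) S.
  by apply: lec_trans SS; apply: lec_prod.
pose e (u : S + S) : T :=
  match u with inl x => proj1_sig x | inr x => proj1_sig (g x) end.
have ei : injective e.
  move=> [[x dx]|x] [[y dy]|y] /=.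
  - by move=> xy; congr inl; apply/eq_exist.
  - by case: (g y) => z /= nz xz; rewrite -xz in nz.
  - by case: (g x) => z /= nz xz; rewrite xz in nz.
  - by move=> /sig_inj/gi ->.
(* A new pair is sent outside [S], through an injection [k] of all pairs into [S], so the values of
   [H1] never meet those of [H]. *)
pose H1 : set (T * T * T) := [set p | exists u v, [/\ p = (e u, e v, e (inr (k (u, v)))),
   ~ H p & ~ (exists x y, u = inl x /\ v = inl y)]].
apply: (Hmax (H `|` H1)).
  split; first by move=> p; left.
  pose s := proj1_sig (cid natS) 0.
  have ns x y : ~ H (e (inr x), e (inr y), e (inr (k (inr x, inr y)))).
    move=> /D1 [] /= d _ _; exact: (proj2_sig (g x)).
  move=> /(_ (e (inr s), e (inr s), e (inr (k (inr s, inr s))))) /(_ _)/ns; apply.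
  by right; exists (inr s), (inr s); split=> // -[? [? []]].
have domH x : dom H x -> exists u, x = e (inl u) by move=> d; exists (exist _ x d).
have dome u : dom (H `|` H1) (e u).
  case: u => [[x dx] /=|u]; first by case: dx => z Hz; exists z; left.
  exists (e (inr (k (inr u, inr u)))); right; exists (inr u), (inr u).
  split=> //; last by move=> -[? [? []]].
  by move=> /D1[] /= d _ _; exact: (proj2_sig (g u)).
have domE x : dom (H `|` H1) x -> exists u, x = e u.
  move=> [z [Hz|[u [v [[-> _ _] _ _]]]]]; last by exists u.
  by have [|u ->] := domH x; [exists z|exists (inl u)].
right; split; last by move=> p /H0H; left.
split.
- move=> x y z [/D1 [dx dy dz]|[u [v [[-> -> ->] _ _]]]].
    by move: dx dy dz => /domH[u ->] /domH[v ->] /domH[w ->]; split; exact: dome.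
  by split; [exact: dome|exact: dome|exact: (dome (inr _))].
- move=> _ _ /domE[u ->] /domE[v ->].
  have [[x [y [-> ->]]]|nuv] := pselect (exists x y, u = inl x /\ v = inl y).
    have [z Hz] := D2 _ _ (proj2_sig x) (proj2_sig y).
    by exists z; left.
  exists (e (inr (k (u, v)))); right; exists u, v; split=> // /D1[_ _] /=.
  exact: (proj2_sig (g (k (u, v)))).
- have aux p q : H p -> H1 q -> p.1 <> q.1 /\ p.2 <> q.2.
    case: p => -[x y] z /D1[/domH[u1 ->] /domH[v1 ->] /domH[w1 ->]].
    move=> [u [v [-> _ nuv]]]; split=> /=.
      move=> [] /(ei (inl _)) eu /(ei (inl _)) ev.
      by apply: nuv; exists u1, v1.
    by move=> /(ei (inl _) (inr _)).
  move=> p q [Hp|Hp] [Hq|Hq]; first exact: D3.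
  + by have [? ?] := aux _ _ Hp Hq.
  + by have [? ?] := aux _ _ Hq Hp; split=> /esym.
  case: Hp Hq => [u [v [-> _ _]]] [u' [v' [-> _ _]]] /=; split.
    by move=> [] /ei -> /ei ->.
  move=> h; have /= := @ei (inr _) (inr _) h.
  by case=> /ki [] -> ->.
Qed.

Lemma lec_seq T : lec nat T -> lec (seq T) T.
Proof.
move=> nT; have [f fi] := lec_square nT.
case: (nT) => i ii.
(* Iterated pairing alone may fail to be injective, as [i 0] can itself be the code of a pair;
   recording the length separates these cases. *)
pose code := foldr (fun x c => f (x, c)) (i 0).
apply: lec_trans (ex_intro _ f fi).
exists (fun s => (i (size s), code s)) => s t [] /ii.
elim: s t => [|x s IH] [|y t] //= [] st /fi [] -> /IH -> //.
Qed.

(* As any two cardinals are comparable, [~ lec K A] means |A| < |K|. *)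
Section Below.
Variables (N0 K : Type) (natN0 : lec nat N0) (N0K : ~ lec K N0).

Lemma common_bound A B : ~ lec K A -> ~ lec K B ->
  exists M, [/\ lec nat M, ~ lec K M, lec A M & lec B M].
Proof.
move=> KA KB.
have [M [nM KM AM]] : exists M, [/\ lec nat M, ~ lec K M & lec A M].
  have [AN|NA] := lec_total A N0; first by exists N0.
  by exists A; split=> //; [exact: lec_trans NA|exact: lec_refl].
have [BM|MB] := lec_total B M; first by exists M.
exists B; split=> //; [exact: lec_trans MB|exact: lec_trans MB|exact: lec_refl].
Qed.

Lemma sum_below A B : ~ lec K A -> ~ lec K B -> ~ lec K (A + B).
Proof.
move=> KA KB; have [M [nM KM AM BM]] := common_bound KA KB.
move=> KAB; apply: KM; apply: lec_trans KAB _.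
by apply: lec_trans (lec_sum2 nM (lec_square nM)); exact: lec_sum.
Qed.

Lemma prod_below A B : ~ lec K A -> ~ lec K B -> ~ lec K (A * B).
Proof.
move=> KA KB; have [M [nM KM AM BM]] := common_bound KA KB.
move=> KAB; apply: KM; apply: lec_trans KAB _.
by apply: lec_trans (lec_square nM); exact: lec_prod.
Qed.

Lemma seq_below A : ~ lec K A -> ~ lec K (seq A).
Proof.
move=> KA; have [M [nM KM [f fi] _]] := common_bound KA KA.
move=> KAB; apply: KM; apply: lec_trans KAB _.
by apply: lec_trans (lec_seq nM); exists (map f); exact: inj_map.
Qed.

End Below.

Lemma below_mono K A B : lec A B -> ~ lec K B -> ~ lec K A.
Proof. by move=> AB KB KA; apply: KB; exact: lec_trans AB. Qed.

Lemma card_lt_below T (A : set T) K :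
  card_lt A [set: K] <-> ~ lec K {x | A x}.
Proof.
have [h1 h2] := lec_setT K; split=> [[_ nle]|nle].
  by move=> h; apply: nle; apply/card_leE; exact: lec_trans h.
split; last by move/card_leE => h; apply: nle; exact: lec_trans h.
by apply/card_leE; have [//|/(lec_trans _) h] := lec_total {x | A x} {x | [set: K] x};
  case: nle; apply: h.
Qed.

(** * Ultrafilters *)

Lemma ultra_fip V (B : set (set V)) :
  (forall l : seq (set V), (forall P, List.In P l -> B P) ->
     exists v, forall P, List.In P l -> P v) ->
  exists U : set (set V), UltraFilter U /\ B `<=` U.
Proof.
move=> fip.
pose D := [set l : seq (set V) | forall P, List.In P l -> B P].
pose I (l : seq (set V)) := [set v : V | forall P, List.In P l -> P v].
have FF : Filter (filter_from D I).
  apply: filter_from_filter; first by exists [::].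
  move=> l1 l2 d1 d2; exists (l1 ++ l2).
    by move=> P /List.in_app_iff [/d1|/d2].
  by move=> v h; split=> P iP; apply: h; apply/List.in_app_iff; [left|right].
have PF : ProperFilter (filter_from D I).
  by apply: filter_from_proper => l Dl; exact: fip.
have [U [UU sU]] := ultraFilterLemma PF; exists U; split=> // P BP; apply: sU.
exists [:: P]; first by move=> Q [<-|[]].
by move=> v; apply; left.
Qed.

Section UltraTheory.
Variables (V : Type) (U : set (set V)) (UU : UltraFilter U).

Lemma ultraNE P : U (~` P) <-> ~ U P.
Proof.
split=> [nP UP|nP]; last by case: (in_ultra_setVsetC P UU).
by have /filter_ex[v []] : U (P `&` ~` P) by exact: filterI.
Qed.

Lemma ultra_ex P : U P -> exists v, P v.
Proof. exact: filter_ex. Qed.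

Lemma ultra_In (l : seq (set V)) : (forall P, List.In P l -> U P) ->
  U [set v | forall P, List.In P l -> P v].
Proof.
elim: l => [|P l IH] h; first by apply: filterS filterT => v _ P [].
apply: filterS (filterI (h P (or_introl erefl)) (IH _)) => [v [Pv lv] Q [<-|/lv]//|].
by move=> Q lQ; apply: h; right.
Qed.

Lemma ultra_ord n (P : 'I_n -> set V) : U [set v | exists i, P i v] ->
  exists i, U (P i).
Proof.
move=> h; apply: contrapT => /forallNP nP.
have : U [set v | forall Q, List.In Q [seq ~` P i | i <- enum 'I_n] -> Q v].
  by apply: ultra_In => Q /List.in_map_iff [i [<- _]]; apply/ultraNE.
move=> /(filterI h) /ultra_ex [v [[i Pi] /(_ (~` P i))]]; apply=> //.
apply/List.in_map_iff; exists i; split=> //.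
have : i \in enum 'I_n by rewrite mem_enum.
by elim: (enum 'I_n) => //= a l IH; rewrite inE => /orP[/eqP->|/IH]; [left|right].
Qed.

End UltraTheory.

Lemma ultra_pushforward V W (f : V -> W) (U : set (set V)) :
  UltraFilter U -> UltraFilter [set P | U (f @^-1` P)].
Proof.
move=> UU.
have PF : ProperFilter [set P | U (f @^-1` P)].
  apply: Build_ProperFilter_ex; first by move=> P /= /(@filter_ex _ U _) [v Pv]; exists (f v).
split=> // G PG sG; apply/seteqP; split=> // P GP /=.
have [//|/= nP] := in_ultra_setVsetC (f @^-1` P) UU.
have /(filterI GP) : G (~` P) by exact: sG.
by move=> /filter_ex[w []].
Qed.

(** * Finite supports *)

Lemma existT_inj T (P : T -> Type) x (a b : P x) :
  existT P x a = existT P x b -> a = b.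
Proof.
move=> e; have := projT2_eq e => /= <-.
by rewrite (Prop_irrelevance (projT1_eq e) erefl).
Qed.

Lemma In_flatten T (I : finType) (l : I -> seq T) i x :
  List.In x (l i) -> List.In x (flatten [seq l i | i <- enum I]).
Proof.
move=> h; have : i \in enum I by rewrite mem_enum.
elim: (enum I) => //= a r IH; rewrite inE => /orP[/eqP<-|/IH ?].
  by apply/List.in_app_iff; left.
by apply/List.in_app_iff; right.
Qed.

Lemma In_nth T (l : seq T) x : List.In x l -> exists i : 'I_(size l), tnth (in_tuple l) i = x.
Proof.
move=> lx.
suff [k [kl]] : exists k, k < size l /\ nth x l k = x.
  by exists (Ordinal kl); rewrite (tnth_nth x).
elim: l lx => //= a l IH [->|/IH [k [kl e]]]; first by exists 0.
by exists k.+1.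
Qed.

Lemma tnth_In T (l : seq T) i : List.In (tnth (in_tuple l) i) l.
Proof.
have [a] : exists a : T, True by exists (tnth (in_tuple l) i).
rewrite (tnth_nth a) /=; case: i => k /= kl.
move=> _; move: k kl.
by elim: l => //= b l IH [|k] kl; [left|right; exact: IH].
Qed.

Section Syntax.
Variable L : language.
Implicit Type X : ctx L.

Lemma valE (M : structure L) X (v w : valuation M X) :
  (forall s x, v s x = w s x) -> v = w.
Proof.
by move=> h; apply: functional_extensionality_dep => s; apply: funext.
Qed.

Definition vcomp (M : structure L) X Y (v : valuation M Y) (h : ctx_map X Y) :
  valuation M X := fun s x => v s (h s x).

Lemma eval_rename (M : structure L) X Y (h : ctx_map X Y) (v : valuation M Y) s (t : term X s) :
  eval v (rename_term h t) = eval (vcomp v h) t.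
Proof.
elim: t => //= f ts IH; congr fint; exact: functional_extensionality_dep.
Qed.

Lemma val_ext_map (M : structure L) X Y (h : ctx_map X Y) (v : valuation M Y) s (c : M s) :
  vcomp (val_ext v c) (@ext_map _ _ _ h s) = val_ext (vcomp v h) c.
Proof. by apply: valE => s' []. Qed.

Lemma sat_rename (M : structure L) X Y (h : ctx_map X Y) (phi : formula X) (v : valuation M Y) :
  sat (rename h phi) v <-> sat phi (vcomp v h).
Proof.
elim: phi Y h v => {X}[X|X s t u|X r ts|X a IHa b IHb|X s a IH] Y h v //=.
- by rewrite !eval_rename.
- suff -> : (fun i => eval v (rename_term h (ts i))) = fun i => eval (vcomp v h) (ts i) by [].
  by apply: functional_extensionality_dep => i; rewrite eval_rename.
- by split=> H /IHa /H /IHb.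
- by split=> H c; move: (H c); rewrite IH val_ext_map.
Qed.

Definition subc X (l : seq {s & X s}) : ctx L :=
  fun s => {x : X s | List.In (existT X s x) l}.

Definition subc_val X (l : seq {s & X s}) : ctx_map (subc l) X :=
  fun s x => proj1_sig x.

Definition subc_incl X (l l' : seq {s & X s})
    (ll : forall z, List.In z l -> List.In z l') : ctx_map (subc l) (subc l') :=
  fun s x => exist _ (proj1_sig x) (ll _ (proj2_sig x)).

Variable M : structure L.

Lemma term_support X s (t : term X s) :
  exists (l : seq {s & X s}) (t0 : term (subc l) s),
    forall v : valuation M X, eval v t = eval (vcomp v (@subc_val X l)) t0.
Proof.
elim: t => {s}[s x|f ts IH].
  exists [:: existT X s x], (Tvar (exist _ x (or_introl erefl))) => //.
pose li i := projT1 (cid (IH i)).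
have H i : {t0 : term (subc (li i)) (fdom f i) |
    forall v : valuation M X, eval v (ts i) = eval (vcomp v (@subc_val X (li i))) t0}.
  by apply: cid; rewrite /li; case: (cid (IH i)).
exists (flatten [seq li i | i <- enum 'I_(farity f)]).
exists (Tapp (fun i => rename_term
  (subc_incl (fun z => @In_flatten _ _ li i z)) (proj1_sig (H i)))).
move=> v /=; congr fint; apply: functional_extensionality_dep => i.
by rewrite eval_rename (proj2_sig (H i)).
Qed.

Lemma formula_support X (phi : formula X) :
  exists (l : seq {s & X s}) (phi0 : formula (subc l)),
    forall v : valuation M X, sat phi v <-> sat phi0 (vcomp v (@subc_val X l)).
Proof.
elim: phi => {X}[X|X s t u|X r ts|X a [la [a0 IHa]] b [lb [b0 IHb]]|X s a [la [a0 IH]]].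
- by exists [::], (Fbot _).
- have [lt [t0 Ht]] := term_support t; have [lu [u0 Hu]] := term_support u.
  have i1 z : List.In z lt -> List.In z (lt ++ lu) by move=> ?; apply/List.in_app_iff; left.
  have i2 z : List.In z lu -> List.In z (lt ++ lu) by move=> ?; apply/List.in_app_iff; right.
  exists (lt ++ lu), (Feq (rename_term (subc_incl i1) t0) (rename_term (subc_incl i2) u0)).
  by move=> v /=; rewrite !eval_rename Ht Hu.
- pose li i := projT1 (cid (term_support (ts i))).
  have H i : {t0 : term (subc (li i)) (rdom r i) |
      forall v : valuation M X, eval v (ts i) = eval (vcomp v (@subc_val X (li i))) t0}.
    by apply: cid; rewrite /li; case: (cid (term_support (ts i))).
  exists (flatten [seq li i | i <- enum 'I_(rarity r)]).
  exists (Frel (fun i => rename_term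
    (subc_incl (fun z => @In_flatten _ _ li i z)) (proj1_sig (H i)))).
  move=> v /=.
  suff -> : (fun i => eval v (ts i)) = (fun i => eval (vcomp v (@subc_val X _))
      (rename_term (subc_incl (fun z => @In_flatten _ _ li i z)) (proj1_sig (H i)))) by [].
  apply: functional_extensionality_dep => i.
  by rewrite eval_rename (proj2_sig (H i)).
- have i1 z : List.In z la -> List.In z (la ++ lb) by move=> ?; apply/List.in_app_iff; left.
  have i2 z : List.In z lb -> List.In z (la ++ lb) by move=> ?; apply/List.in_app_iff; right.
  exists (la ++ lb), (Fimp (rename (subc_incl i1) a0) (rename (subc_incl i2) b0)).
  by move=> v /=; rewrite !sat_rename IHa IHb.
(* The bound variable is dropped from the support of the body; what remains supports the quantified
   formula. *)
- pose old (z : {u & ctx_ext X s u}) : seq {u & X u} :=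
    match z with existT _ (ext_new) => [::] | existT _ (ext_old u x) => [:: existT X u x] end.
  pose l' := flatten (map old la).
  have r u (x : subc la u) : {y : ctx_ext (subc l') s u |
      @ext_map _ _ _ (@subc_val X l') s u y = proj1_sig x}.
    apply: cid; case: x => -[|u' x] /=; first by exists (ext_new _ s).
    move=> u'la.
    have xl : List.In (existT X _ x) l'.
      rewrite /l'; elim: (la) u'la => //= p r IHr [->|/IHr h] /=; first by left.
      by apply/List.in_app_iff; right.
    by exists (ext_old s (exist _ x xl : subc l' _)).
  exists l', (Fall (rename (fun u x => proj1_sig (r u x)) a0)) => v /=.
  have E c : sat a (val_ext v c) <->
     sat (rename (fun u x => proj1_sig (r u x)) a0) (val_ext (vcomp v (@subc_val X l')) c).
    rewrite sat_rename IH.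
    suff -> : vcomp (val_ext (vcomp v (@subc_val X l')) c) (fun u x => proj1_sig (r u x))
      = vcomp (val_ext v c) (@subc_val _ la) by [].
    apply: valE => u x; rewrite -val_ext_map /vcomp.
    by rewrite (proj2_sig (r u x)).
  by split=> H c; apply/E.
Qed.

(** [h] is only required to reach every variable of [l]: repetitions in [l] are harmless, and no
    equality test on variables is needed. *)
Lemma list_vars X (l : seq {s & X s}) :
  exists (n : nat) (sg : 'I_n -> sorts L) (h : ctx_map (vars sg) X),
    forall s (x : X s), List.In (existT X s x) l -> exists z, h s z = x.
Proof.
pose sg i := projT1 (tnth (in_tuple l) i).
pose h : ctx_map (vars sg) X := fun s z =>
  match z in vars _ u return X u with var_at i => projT2 (tnth (in_tuple l) i) end.
exists (size l), sg, h; move=> s x lx; have [i ei] := In_nth lx.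
have H p : tnth (in_tuple l) i = p -> exists z : vars sg (projT1 p), h _ z = projT2 p.
  by move=> <-; exists (var_at sg i).
exact: (H _ ei).
Qed.

Lemma vars_support X (phi : formula X) :
  exists (n : nat) (sg : 'I_n -> sorts L) (h : ctx_map (vars sg) X) (phi0 : formula (vars sg)),
    forall v : valuation M X, sat phi v <-> sat phi0 (vcomp v h).
Proof.
have [l [phi0 H]] := formula_support phi.
have [n [sg [h hl]]] := list_vars l.
have r s (x : subc l s) : {z : vars sg s | h s z = proj1_sig x}.
  by apply: cid; apply: hl; exact: (proj2_sig x).
exists n, sg, h, (rename (fun s x => proj1_sig (r s x)) phi0) => v.
rewrite H sat_rename.
suff -> : vcomp v (@subc_val X l) = vcomp (vcomp v h) (fun s x => proj1_sig (r s x)) by [].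
by apply: valE => s x; rewrite /vcomp (proj2_sig (r s x)).
Qed.

(** * Definable sets *)

Implicit Type Y : set (elt M).

(** Definable sets are handled semantically, as sets of valuations of an arbitrary, possibly
    infinite, context, so that substitution and quantification become operations on sets instead of
    on syntax. *)
Definition dfn (Y : set (elt M)) X (P : set (valuation M X)) : Prop :=
  exists phi : pformula Y X, forall v, P v <-> psat v phi.

Definition ran X (v : valuation M X) : set (elt M) :=
  [set e | exists s (x : X s), e = mk_elt (v s x)].

Lemma dfn_ext Y X (P Q : set (valuation M X)) :
  dfn Y P -> (forall v, P v <-> Q v) -> dfn Y Q.
Proof. by move=> [phi H] PQ; exists phi => v; rewrite -PQ. Qed.

Lemma dfn_psat Y X (phi : pformula Y X) : dfn Y (fun v => psat v phi).
Proof. by exists phi. Qed.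

Lemma dfn_imp Y X (P Q : set (valuation M X)) :
  dfn Y P -> dfn Y Q -> dfn Y (fun v => P v -> Q v).
Proof.
move=> [phi H] [psi H']; exists (Fimp phi psi) => v /=.
by rewrite H H'.
Qed.

Lemma dfn_bot Y X : dfn Y (fun _ : valuation M X => False).
Proof. by exists (Fbot _). Qed.

Lemma dfn_not Y X (P : set (valuation M X)) : dfn Y P -> dfn Y (~` P).
Proof. by move=> h; exact: dfn_imp h (dfn_bot _ _). Qed.

Lemma dfn_top Y X : dfn Y [set: valuation M X].
Proof. by apply: dfn_ext (dfn_not (dfn_bot Y X)) _ => v; split=> // _ []. Qed.

Lemma dfn_and Y X (P Q : set (valuation M X)) :
  dfn Y P -> dfn Y Q -> dfn Y (P `&` Q).
Proof.
move=> h1 h2; apply: dfn_ext (dfn_not (dfn_imp h1 (dfn_not h2))) _ => v.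
by split=> [/not_implyP[? /contrapT]//|[? ?]]; apply.
Qed.

Lemma dfn_or Y X (P Q : set (valuation M X)) :
  dfn Y P -> dfn Y Q -> dfn Y (P `|` Q).
Proof.
move=> h1 h2; apply: dfn_ext (dfn_imp (dfn_not h1) h2) _ => v.
split=> [h|[Pv nPv|//]]; last by exfalso; exact: (nPv Pv).
by have [|/h] := pselect (P v); [left|right].
Qed.

Lemma dfn_subst Y X X' (h : forall s, X' s -> (X s + params Y s)%type)
    (P : set (valuation M X')) :
  dfn Y P -> dfn Y (fun v : valuation M X => P (vcomp (val_sum v (@params_val _ M Y)) h)).
Proof.
move=> [phi H].
pose k : ctx_map (ctx_sum X' (params Y)) (ctx_sum X (params Y)) :=
  fun s z => match z with inl x => h s x | inr a => inr a end.
exists (rename k phi) => v; rewrite H /psat sat_rename.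
suff -> : vcomp (val_sum v (@params_val _ M Y)) k
  = val_sum (vcomp (val_sum v (@params_val _ M Y)) h) (@params_val _ M Y) by [].
by apply: valE => s [].
Qed.

Lemma dfn_comp Y X X' (h : ctx_map X' X) (P : set (valuation M X')) :
  dfn Y P -> dfn Y (fun v : valuation M X => P (vcomp v h)).
Proof.
by move=> /(dfn_subst (fun s x => inl (h s x))) H; apply: dfn_ext H _ => v.
Qed.

Lemma dfn_mono Y Y' X (P : set (valuation M X)) :
  Y `<=` Y' -> dfn Y P -> dfn Y' P.
Proof.
move=> YY' [phi H]; exists (rename (params_incl YY' (X := X)) phi) => v.
rewrite H /psat sat_rename.
suff -> : vcomp (val_sum v (@params_val _ M Y')) (params_incl YY' (X := X))
  = val_sum v (@params_val _ M Y) by [].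
by apply: valE => s [].
Qed.

Lemma dfn_all1 Y X s (P : set (valuation M (ctx_ext X s))) :
  dfn Y P -> dfn Y (fun v : valuation M X => forall c : M s, P (val_ext v c)).
Proof.
move=> [phi H].
pose k : ctx_map (ctx_sum (ctx_ext X s) (params Y)) (ctx_ext (ctx_sum X (params Y)) s) :=
  fun u z => match z with
    | inl x => @ext_map _ _ _ (fun s x => inl x) s u x
    | inr a => ext_old s (inr a) end.
exists (Fall (rename k phi)) => v /=; rewrite /psat /=.
suff E c : sat (rename k phi) (val_ext (val_sum v (@params_val _ M Y)) c) <-> P (val_ext v c).
  by split=> h c; apply/E.
rewrite H /psat sat_rename.
suff -> : vcomp (val_ext (val_sum v (@params_val _ M Y)) c) k
  = val_sum (val_ext v c) (@params_val _ M Y) by [].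
by apply: valE => u [[]|].
Qed.

Lemma dfn_ex1 Y X s (P : set (valuation M (ctx_ext X s))) :
  dfn Y P -> dfn Y (fun v : valuation M X => exists c : M s, P (val_ext v c)).
Proof.
move=> h; apply: dfn_ext (dfn_not (dfn_all1 (dfn_not h))) _ => v.
split=> [/existsNP[c /contrapT]|[c Pc] /(_ c)//]; by exists c.
Qed.

(** The entries have different sorts. Each one is specified by an equality of dependent pairs and
    then chosen, instead of being cast along an equality of indices. *)
Lemma tuple_cons n (tau : 'I_n.+1 -> sorts L) (c : M (tau ord0))
    (b' : Defs.tuple_of M (fun j => tau (lift ord0 j))) :
  exists b : Defs.tuple_of M tau, b ord0 = c /\ forall j, b (lift ord0 j) = b' j.
Proof.
pose T i := M (tau i).
have H i : exists y : T i, existT T i y = existT T ord0 c \/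
    exists j, existT T i y = existT T (lift ord0 j) (b' j).
  case: (unliftP ord0 i) => [j|] ->; [exists (b' j)|exists c]; last by left.
  by right; exists j.
exists (fun i => proj1_sig (cid (H i))); split=> [|j].
  have [|[j]] := proj2_sig (cid (H ord0)); first by move=> e; exact: (existT_inj e).
  by move=> /(congr1 (@projT1 _ _)).
have [|[k e]] := proj2_sig (cid (H (lift ord0 j))).
  by move=> /(congr1 (@projT1 _ _)).
have /= /lift_inj jk := congr1 (@projT1 _ _) e.
by subst k; exact: (existT_inj e).
Qed.

Lemma dfn_all Y X n (tau : 'I_n -> sorts L) (P : set (valuation M (ctx_sum X (vars tau)))) :
  dfn Y P ->
  dfn Y (fun v : valuation M X => forall b : Defs.tuple_of M tau, P (val_sum v (assign b))).
Proof.
elim: n X tau P => [|n IH] X tau P dP.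
  pose b0 : Defs.tuple_of M tau := fun i => match notF (ltn_ord i) with end.
  pose h : ctx_map (ctx_sum X (vars tau)) X := fun s z => match z with
     | inl x => x
     | inr y => match y with var_at i => match notF (ltn_ord i) with end end end.
  apply: dfn_ext (dfn_comp h dP) _ => v.
  have E b : vcomp v h = val_sum v (assign b) by apply: valE => s [x|[[]]].
  by split=> [H b|/(_ b0)]; rewrite -?E // (E b0).
pose tau' (j : 'I_n) := tau (lift ord0 j).
have k s (z : ctx_sum X (vars tau) s) : {w : ctx_sum (ctx_ext X (tau ord0)) (vars tau') s |
    forall v (b : Defs.tuple_of M tau),
      val_sum (val_ext v (b ord0)) (assign (fun j => b (lift ord0 j) : M (tau' j))) w
      = val_sum v (assign b) z}.
  apply: cid; case: z => [x|[i]]; first by exists (inl (ext_old _ x)).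
  case: (unliftP ord0 i) => [j|] ->.
    by exists (inr (var_at tau' j)).
  by exists (inl (ext_new _ _)).
apply: dfn_ext (dfn_all1 (IH _ _ _ (dfn_comp (fun s z => proj1_sig (k s z)) dP))) _ => v.
have E (b : Defs.tuple_of M tau) :
    vcomp (val_sum (val_ext v (b ord0)) (assign (fun j => b (lift ord0 j) : M (tau' j))))
    (fun s z => proj1_sig (k s z)) = val_sum v (assign b).
  by apply: valE => s z; exact: (proj2_sig (k s z)).
split=> [H b|H c b']; first by rewrite -E; exact: H.
have [b [b0 bs]] := tuple_cons c b'.
rewrite -b0 (_ : b' = fun j => b (lift ord0 j) : M (tau' j)) ?E //.
by apply: functional_extensionality_dep => j; rewrite bs.
Qed.

Lemma dfn_ex Y X n (tau : 'I_n -> sorts L) (P : set (valuation M (ctx_sum X (vars tau)))) :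
  dfn Y P ->
  dfn Y (fun v : valuation M X => exists b : Defs.tuple_of M tau, P (val_sum v (assign b))).
Proof.
move=> h; apply: dfn_ext (dfn_not (dfn_all (dfn_not h))) _ => v.
split=> [/existsNP[c /contrapT]|[c Pc] /(_ c)//]; by exists c.
Qed.

Lemma dfn_eq Y X s (x y : X s + params Y s) :
  dfn Y (fun v : valuation M X =>
    val_sum v (@params_val _ M Y) x = val_sum v (@params_val _ M Y) y).
Proof.
exists (Feq (Tvar (x : ctx_sum X (params Y) s)) (Tvar (y : ctx_sum X (params Y) s))) => v //.
Qed.

Lemma dfn_ordall Y X n (P : 'I_n -> set (valuation M X)) :
  (forall i, dfn Y (P i)) -> dfn Y (fun v => forall i, P i v).
Proof.
elim: n P => [|n IH] P dP.
  by apply: dfn_ext (dfn_top _ _) _ => v; split=> // _ [].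
apply: dfn_ext (dfn_and (dP ord0) (IH _ (fun j => dP (lift ord0 j)))) _ => v.
split=> [[h0 h] i|h]; last by split=> [|j]; apply: h.
by case: (unliftP ord0 i) => [j|] ->.
Qed.

(** This normal form [psi(x, b)], with finitely many variables, [psi] free of parameters and [b] a
    finite tuple, is what the arguments on codes, ranks and dividing start from. *)
Lemma dfn_support Y X (P : set (valuation M X)) : dfn Y P ->
  exists n (sg : 'I_n -> sorts L) (h : ctx_map (vars sg) X)
    m (tau : 'I_m -> sorts L) (b : Defs.tuple_of M tau)
    (psi : formula (ctx_sum (vars sg) (vars tau))),
  (forall i, Y (mk_elt (b i))) /\
  forall v, P v <-> sat psi (val_sum (vcomp v h) (assign b)).
Proof.
move=> [phi Hphi]; have [l [phi0 H]] := formula_support phi.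
pose lX : seq {s & X s} := flatten [seq (match z with
   | existT s (inl x) => [:: existT X s x] | _ => [::] end : seq {s & X s}) | z <- l].
pose lY : seq {s & params Y s} := flatten [seq (match z with
   | existT s (inr x) => [:: existT (params Y) s x] | _ => [::] end : seq {s & params Y s}) | z <- l].
have [n [sg [h hl]]] := list_vars lX.
have [m [tau [k kl]]] := list_vars lY.
have r s (x : subc l s) : {z : ctx_sum (vars sg) (vars tau) s |
   match z return ctx_sum X (params Y) s with inl a => inl (h s a) | inr b => inr (k s b) end
    = proj1_sig x}.
  apply: cid; case: x => -[x|x] /= xl.
    have [|z <-] := hl s x; last by exists (inl z).
    rewrite /lX; elim: (l) xl => //= p r IHr [->|/IHr h1] /=; first by left.
    by apply/List.in_app_iff; right.
  have [|z <-] := kl s x; last by exists (inr z).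
  rewrite /lY; elim: (l) xl => //= p r IHr [->|/IHr h1] /=; first by left.
  by apply/List.in_app_iff; right.
exists n, sg, h, m, tau, (fun i => proj1_sig (k _ (var_at tau i))).
exists (rename (fun s x => proj1_sig (r s x)) phi0); split=> [i|v].
  exact: (proj2_sig (k _ (var_at tau i))).
rewrite Hphi /psat H sat_rename.
set v1 := vcomp _ _; set v2 := vcomp _ _; suff -> : v1 = v2 by [].
apply: valE => s x; rewrite /v1 /v2 /vcomp /subc_val.
by case: (r s x) => z /= <- {x}; case: z => // -[i].
Qed.

Lemma dfn_instance X n (tau : 'I_n -> sorts L) (b : Defs.tuple_of M tau)
    (psi : formula (ctx_sum X (vars tau))) (Y : set (elt M)) :
  (forall i, Y (mk_elt (b i))) ->
  dfn Y (fun v : valuation M X => sat psi (val_sum v (assign b))).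
Proof.
move=> bY.
pose k : ctx_map (ctx_sum X (vars tau)) (ctx_sum X (params Y)) :=
  fun s z => match z with
    | inl x => inl x
    | inr y => match y in vars _ u return ctx_sum X (params Y) u with
                var_at i => inr (exist _ (b i) (bY i)) end end.
exists (rename k psi) => v; rewrite /psat sat_rename.
suff -> : vcomp (val_sum v (@params_val _ M Y)) k = val_sum v (assign b) by [].
by apply: valE => s [|[]].
Qed.

End Syntax.

(** * Automorphisms *)

Section Automorphisms.
Variables (L : language) (C : structure L).
Implicit Types (X : ctx L) (Y Z : set (elt C)).

(** The inverse and the preservation of all formulas are stored, so that inverses and composites
    need no induction on formulas; [automorphism_aut] performs that induction once. *)
Record aut := Aut {
  ap :> forall s, C s -> C s;
  ai : forall s, C s -> C s;
  apK : forall s, cancel (@ap s) (@ai s);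
  aiK : forall s, cancel (@ai s) (@ap s);
  aut_sat : forall X (phi : formula X) (v : valuation C X),
    sat phi (fun s x => ap (v s x)) <-> sat phi v }.

Definition vmap (g : forall s, C s -> C s) X (v : valuation C X) : valuation C X :=
  fun s x => g s (v s x).

Definition act (g : aut) (e : elt C) : elt C := existT _ (projT1 e) (g _ (projT2 e)).

Definition aut_id : aut :=
  @Aut (fun _ => id) (fun _ => id) (fun _ _ => erefl) (fun _ _ => erefl)
    (fun _ _ _ => iff_refl _).

Definition aut_inv (g : aut) : aut.
Proof.
apply: (@Aut (ai g) (ap g)) => [s|s|X phi v]; [exact: aiK|exact: apK|].
rewrite -(aut_sat g).
suff -> : (fun s x => g s (ai g (v s x))) = v by [].
by apply: valE => s x; rewrite aiK.
Defined.

Definition aut_comp (g h : aut) : aut.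
Proof.
apply: (@Aut (fun s => g s \o h s) (fun s => ai h (s := s) \o ai g (s := s))).
- by move=> s x /=; rewrite apK apK.
- by move=> s x /=; rewrite aiK aiK.
- by move=> X phi v /=; rewrite -[X in _ <-> X](aut_sat h) -[X in _ <-> X](aut_sat g).
Defined.

Lemma aut_invK (g : aut) s : cancel (g s) (aut_inv g s).
Proof. exact: apK. Qed.

Lemma aut_invKV (g : aut) s : cancel (aut_inv g s) (g s).
Proof. exact: aiK. Qed.

Lemma actK (g : aut) : cancel (act g) (act (aut_inv g)).
Proof. by move=> [s x]; rewrite /act /= apK. Qed.

Lemma actKV (g : aut) : cancel (act (aut_inv g)) (act g).
Proof. by move=> [s x]; rewrite /act /= aiK. Qed.

Definition fixes (g : aut) Y := forall s (x : C s), Y (mk_elt x) -> g s x = x.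

Lemma fixes_inv g Y : fixes g Y -> fixes (aut_inv g) Y.
Proof. by move=> f s x Yx; rewrite -{1}(f s x Yx) aut_invK. Qed.

Lemma fixes_comp g h Y : fixes g Y -> fixes h Y -> fixes (aut_comp g h) Y.
Proof. by move=> fg fh s x Yx /=; rewrite fh ?fg. Qed.

Lemma fixes_sub g Y Z : Y `<=` Z -> fixes g Z -> fixes g Y.
Proof. by move=> YZ f s x /YZ /f. Qed.

Lemma fixes_act g Y e : fixes g Y -> Y e -> act g e = e.
Proof. by case: e => s x f Yx; rewrite /act /= f. Qed.

Lemma dfn_vmap Y Y' X (P : set (valuation C X)) (g : aut) :
  dfn Y P -> (forall e, Y' e -> Y (act g e)) ->
  (forall e, Y e -> Y' (act (aut_inv g) e)) -> dfn Y' (fun v => P (vmap g v)).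
Proof.
move=> [phi H] _ YY'.
pose k : ctx_map (ctx_sum X (params Y)) (ctx_sum X (params Y')) := fun s z => match z with
  | inl x => inl x
  | inr a => inr (exist _ (aut_inv g s (proj1_sig a)) (YY' _ (proj2_sig a))) end.
exists (rename k phi) => v; rewrite H /psat sat_rename -[X in _ <-> X](aut_sat g).
set v1 := val_sum _ _; set v2 := (X in _ <-> sat phi X); suff -> : v1 = v2 by [].
by apply: valE => s [x|[a Ya]] //=; rewrite /v2 /vcomp /k /= aiK.
Qed.

Lemma dfn_fixes Y X (P : set (valuation C X)) (g : aut) (v : valuation C X) :
  dfn Y P -> fixes g Y -> P (vmap g v) <-> P v.
Proof.
move=> [phi H] f; rewrite !H /psat -[X in _ <-> X](aut_sat g).
set v1 := val_sum _ _; set v2 := (X in _ <-> sat phi X); suff -> : v1 = v2 by [].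
by apply: valE => s [x|[a Ya]] //=; rewrite /v2 /= f.
Qed.

Lemma automorphism_aut (g : forall s, C s -> C s) : automorphism g ->
  exists h : aut, forall s x, h s x = g s x.
Proof.
move=> [gb gf gr].
have [gi giK gKi] : exists2 gi : forall s, C s -> C s, forall s, cancel (g s) (gi s) &
    forall s, cancel (gi s) (g s).
  have H s : {gi : C s -> C s | cancel (g s) gi /\ cancel gi (g s)}.
    by apply: cid; have [gi] := gb s; exists gi.
  by exists (fun s => proj1_sig (H s)) => s; have [] := proj2_sig (H s).
have ev X (v : valuation C X) s (t : term X s) : g s (eval v t) = eval (vmap g v) t.
  elim: t => //= f ts IH; rewrite gf; congr fint.
  exact: functional_extensionality_dep.
suff st X (phi : formula X) (v : valuation C X) : sat phi (vmap g v) <-> sat phi v.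
  by exists (Aut giK gKi st).
elim: phi v => {X}[X|X s t u|X r ts|X a IHa b IHb|X s a IH] v //=.
- rewrite -!ev; split=> [/(congr1 (gi s))|->//]; by rewrite !giK.
- rewrite [X in _ <-> X]gr.
  suff -> : (fun i => g _ (eval v (ts i))) = fun i => eval (vmap g v) (ts i) by [].
  by apply: functional_extensionality_dep => i; rewrite ev.
- by rewrite IHa IHb.
- have E c : vmap g (val_ext v c) = val_ext (vmap g v) (g s c).
    by apply: valE => u [].
  split=> H c; first by rewrite -IH E.
  by rewrite -(gKi s c) -E IH.
Qed.

End Automorphisms.

Arguments fixes {L C} g Y.
Arguments act {L C} g e.

(** * Saturation and homogeneity *)

(** The iterated negations of falsity are told apart by their depth. Thus a cardinal above |T| is
    uncountable. *)
Lemma fin_formula_infinite (L : language) : lec nat (fin_formula L).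
Proof.
pose sg0 : 'I_0 -> sorts L := fun i => match notF (ltn_ord i) with end.
pose F n : formula (vars sg0) := iter n (fun phi => Fimp phi (Fbot _)) (Fbot _).
exists (fun n => existT _ 0 (existT _ sg0 (F n))).
pose depth := fix depth (X : ctx L) (phi : formula X) : nat :=
  match phi with Fimp a b => (depth _ a).+1 | _ => 0 end.
have dF n : depth _ (F n) = n by elim: n => //= n ->.
move=> m n /(congr1 (fun p : fin_formula L => depth _ (projT2 (projT2 p)))) /=.
by rewrite !dF.
Qed.

Lemma ultra_complete_type (L : language) (C : structure L) (Y : set (elt C)) (X : ctx L)
    (U : set (set (valuation C X))) : UltraFilter U ->
  complete_type [set phi : pformula Y X | U (fun v => psat v phi)].
Proof.
move=> UU; split.
  move=> q /finite_In[l Hl] qp.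
  have : U [set v | forall P, List.In P [seq (fun v => psat v phi) | phi <- l] -> P v].
    by apply: ultra_In => P /List.in_map_iff[phi [<- /Hl/qp]].
  move=> /filter_ex[v Hv]; exists v => phi /Hl lphi.
  by apply: (Hv (fun v => psat v phi)); apply/List.in_map_iff; exists phi.
move=> phi; have [|h] := in_ultra_setVsetC (fun v => psat v phi) UU; first by left.
by right; apply: filterS h => v.
Qed.

Section Monster.
Variables (L : language) (C : structure L) (K : Type).
Hypothesis ffK : ~ lec K (fin_formula L).
Implicit Types (X : ctx L) (Y Z : set (elt C)).

(** [K] is a parameter: smallness is used below for the saturation cardinal and, in the part on PAC
    substructures, for kappa as well. *)
Definition small Y := ~ lec K {e | Y e}.
Definition smallx X := ~ lec K {s & X s}.

Lemma small_sub Y Z : Y `<=` Z -> small Z -> small Y.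
Proof. by move=> YZ; apply: below_mono; exact: lec_sig. Qed.

Lemma smallU Y Z : small Y -> small Z -> small (Y `|` Z).
Proof.
move=> sY sZ; apply: below_mono (sum_below (fin_formula_infinite L) ffK sY sZ).
have H (e : {e | (Y `|` Z) e}) : {z : {e | Y e} + {e | Z e} | proj1_sig e =
    match z with inl a => proj1_sig a | inr b => proj1_sig b end}.
  by apply: cid; case: e => e [Ye|Ze] /=; [exists (inl (exist _ e Ye))|exists (inr (exist _ e Ze))].
exists (fun e => proj1_sig (H e)) => a b ab; apply: sig_inj.
by rewrite (proj2_sig (H a)) ab -(proj2_sig (H b)).
Qed.

Lemma below_nat T : lec T nat -> ~ lec K T.
Proof.
move=> Tn; apply: below_mono ffK; apply: lec_trans Tn _; exact: fin_formula_infinite.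
Qed.

Lemma smallx_vars n (sg : 'I_n -> sorts L) : smallx (vars sg).
Proof.
apply: below_nat.
exists (fun z : {s & vars sg s} => match projT2 z with var_at i => val i end).
by move=> [_ [i]] [_ [j]] /= /val_inj ->.
Qed.

Lemma smallx_var1 (s : sorts L) : smallx (var1 s).
Proof.
apply: below_nat; exists (fun _ => 0).
by move=> [_ [[]]] [_ [[]]].
Qed.

Lemma smallx_sum X X' : smallx X -> smallx X' -> smallx (ctx_sum X X').
Proof.
move=> sX sX'; apply: below_mono (sum_below (fin_formula_infinite L) ffK sX sX').
exists (fun z => match z with existT s (inl x) => inl (existT X s x)
  | existT s (inr x) => inr (existT X' s x) end).
apply: (can_inj (g := fun z : {s & X s} + {s & X' s} => match z with
  | inl p => existT (ctx_sum X X') (projT1 p) (inl (projT2 p))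
  | inr p => existT (ctx_sum X X') (projT1 p) (inr (projT2 p)) end)).
by move=> [s [x|x]].
Qed.

Lemma smallx_params Y : small Y -> smallx (params Y).
Proof.
apply: below_mono.
exists (fun z => exist Y (mk_elt (proj1_sig (projT2 z))) (proj2_sig (projT2 z))).
apply: (can_inj (g := fun z : {e | Y e} => existT (params Y) (projT1 (proj1_sig z))
  (exist _ (projT2 (proj1_sig z)) (match proj1_sig z as e return Y e -> Y (mk_elt (projT2 e))
     with existT s x => id end (proj2_sig z))))).
by move=> [s [x Yx]].
Qed.

Lemma small_ran X (v : valuation C X) : smallx X -> small (ran v).
Proof.
apply: below_mono.
have -> : {e | ran v e} = {e | ((fun z : {s & X s} => mk_elt (v _ (projT2 z))) @` setT) e}.
  congr sig; apply/funext => e; apply/propext; split.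
    by move=> [s [x ->]]; exists (existT _ s x).
  by move=> [[s x] _ <-]; exists s, x.
apply: lec_trans (lec_image _ _) _; exact: (lec_setT _).1.
Qed.

Lemma small_act Y (g : aut C) : small Y -> small (act g @` Y).
Proof. by apply: below_mono; exact: lec_image. Qed.

Lemma small1 e : small [set e].
Proof. by apply: below_nat; exists (fun _ => 0) => -[x xe] [y ye] _; apply: sig_inj; rewrite /= xe. Qed.

Hypothesis Csat : saturated C K.
Hypothesis Chom : strongly_homogeneous C K.

(** Homogeneity is stated without parameters, so [Y] is adjoined to the enumerated tuple.
    Preservation in one direction suffices because it also applies to complements. *)
Lemma hom_over Y X (v w : valuation C X) : small Y -> smallx X ->
  (forall P, dfn Y P -> P v -> P w) ->
  exists g : aut C, fixes g Y /\ forall s x, g s (v s x) = w s x.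
Proof.
move=> sY sX H.
pose I := {s & (X s + params Y s)%type}.
pose sg (i : I) := projT1 i.
pose T (u : valuation C X) : Defs.tuple_of C sg :=
  fun i => val_sum u (@params_val _ C Y) (projT2 i).
pose r : ctx_map (vars sg) (ctx_sum X (params Y)) := fun s z =>
  match z in vars _ u return ctx_sum X (params Y) u with var_at i => projT2 i end.
have rE u : vcomp (val_sum u (@params_val _ C Y)) r = assign (T u).
  by apply: valE => s [].
have imp phi : sat phi (assign (T v)) -> sat phi (assign (T w)).
  rewrite -!rE -!sat_rename; apply: H (fun u => psat u (rename r phi : pformula Y X)) _.
  exact: dfn_psat.
have [||g [/automorphism_aut[h hg] gT]] := Chom (I := I) (sg := sg) (a := T v) (b := T w).
- apply/card_lt_below; apply: below_mono (lec_setT _).1 _.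
  exact: smallx_sum (smallx_params sY).
- move=> phi; split; first exact: imp.
  by move=> Tw; apply: contrapT => nTv; exact: (imp (Fnot phi) nTv Tw).
exists h; split=> [s x Yx|s x]; rewrite hg.
  exact: (gT (existT _ s (inr (exist _ x Yx)))).
exact: (gT (existT _ s (inl x))).
Qed.

Lemma realize1 Y s (U : set (set (valuation C (var1 s)))) : small Y -> UltraFilter U ->
  exists c : C s, forall P, dfn Y P -> U P -> P (assign1 c).
Proof.
move=> sY UU.
pose p : set (pformula Y (var1 s)) := [set phi | U (fun v => psat v phi)].
have [||c Hc] := Csat (A := Y) _ (p := p); first exact/card_lt_below.
  exact: ultra_complete_type.
exists c => P [phi H] UP; rewrite H; apply: Hc; apply: filterS UP => v.
by rewrite H.
Qed.


(** * Realizing types in infinitely many variables *)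

Definition dep X (J : set {s & X s}) (P : set (valuation C X)) :=
  forall v w : valuation C X,
    (forall s x, J (existT X s x) -> v s x = w s x) -> P v -> P w.

Lemma dfn_dep Y X (P : set (valuation C X)) : dfn Y P ->
  exists l : seq {s & X s}, dep [set z | List.In z l] P.
Proof.
move=> /dfn_support[n [sg [h [m [tau [b [psi [_ H]]]]]]]].
exists [seq existT X _ (h _ (var_at sg i)) | i <- enum 'I_n] => v w vw; rewrite !H.
suff -> : vcomp v h = vcomp w h by [].
apply: valE => s [i]; apply: vw; apply/List.in_map_iff; exists i; split=> //.
by apply/mem_In; rewrite mem_enum.
Qed.

Section Update.
Variables (X : ctx L) (s0 : sorts L) (x0 : X s0).

Lemma upd_ex s (x : X s) : exists y : ctx_ext X s0 s,
  forall (v : valuation C X) (z : C s0),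
    (existT X s x <> existT X s0 x0 -> val_ext v z y = v s x) /\
    (existT X s x = existT X s0 x0 ->
      existT (fun s => C s) s (val_ext v z y) = existT (fun s => C s) s0 z).
Proof.
have [e|ne] := pselect (existT X s x = existT X s0 x0); last by exists (ext_old _ x).
by move: (congr1 (@projT1 _ _) e) => /= es; subst s; exists (ext_new _ _).
Qed.

Definition upd_map : ctx_map X (ctx_ext X s0) := fun s x => projT1 (cid (upd_ex x)).

Definition upd (v : valuation C X) (z : C s0) : valuation C X :=
  vcomp (val_ext v z) upd_map.

Lemma upd_new v z : upd v z x0 = z.
Proof.
rewrite /upd /vcomp /upd_map; case: (cid _) => y /= H.
by have [_ /(_ erefl)] := H v z; exact: existT_inj.
Qed.

Lemma upd_old v z s (x : X s) : existT X s x <> existT X s0 x0 -> upd v z x = v s x.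
Proof.
move=> ne; rewrite /upd /vcomp /upd_map; case: (cid _) => y /= H.
by have [/(_ ne)] := H v z.
Qed.

Lemma upd_id v : upd v (v s0 x0) = v.
Proof.
apply: valE => s x; have [e|] := pselect (existT X s x = existT X s0 x0); last exact: upd_old.
move: (congr1 (@projT1 _ _) e) => /= es; subst s.
by rewrite (existT_inj e) upd_new.
Qed.

End Update.

(** Saturation concerns one variable at a time. Zorn's lemma is applied to partial realizations
    [(J, c)], where [c] satisfies the [Y]-definable sets of [U] that depend only on the coordinates
    in [J]. One more coordinate can always be added, since its type is over the small set formed by
    [Y] and the values of [c]. *)
Lemma realize Y X (U : set (set (valuation C X))) : small Y -> smallx X -> UltraFilter U ->
  exists c : valuation C X, forall P, dfn Y P -> U P -> P c.
Proof.
move=> sY sX UU.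
have [v0 _] : exists v : valuation C X, setT v by exact: (ultra_ex UU filterT).
pose good (p : set {s & X s} * valuation C X) :=
  forall P, dfn Y P -> dep p.1 P -> U P -> P p.2.
pose le (p q : set {s & X s} * valuation C X) :=
  p.1 `<=` q.1 /\ forall s x, p.1 (existT X s x) -> p.2 s x = q.2 s x.
pose R (p q : {p | good p}) := `[< le (proj1_sig p) (proj1_sig q) >].
have good0 : good (set0, v0).
  by move=> P dP depP /filter_ex[v]; apply: depP.
have [|||[[J c] gJ] Jmax] := ZL_preorder (exist good _ good0) (R := R).
- by move=> p; apply/asboolP; split=> // z.
- move=> p q r /asboolP[h1 h2] /asboolP[h3 h4]; apply/asboolP; split.
    exact: subset_trans h3.
  by move=> s x px; rewrite h2 ?h4 //; exact: h1.
- move=> A Atot.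
  have [[p0 Ap0]|nA] := pselect (exists p, A p); last first.
    by exists (exist good _ good0) => p Ap; case: nA; exists p.
  pose Jof (p : {p | good p}) := (proj1_sig p).1.
  pose cof (p : {p | good p}) := (proj1_sig p).2.
  pose Ju := [set z | exists p, A p /\ Jof p z].
  pose cu : valuation C X := fun s x => match pselect (Ju (existT X s x)) with
    | left h => cof (projT1 (cid h)) s x | right _ => v0 s x end.
  have cuE p s x : A p -> Jof p (existT X s x) -> cof p s x = cu s x.
    move=> Ap Jp; rewrite /cu; case: (pselect _) => [h|[]]; last by exists p.
    case: (cid h) => q /= [Aq Jq].
    by case: (Atot _ _ Ap Aq) => /asboolP[_ h']; [exact: h'|exact/esym/h'].
  have gu : good (Ju, cu).
    move=> P dP depP UP /=.
    have [l depl] := dfn_dep dP.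
    have [p [Ap lp]] : exists p, A p /\ forall z, List.In z l -> Ju z -> Jof p z.
      elim: (l) => [|z r [p [Ap IH]]]; first by exists p0; split.
      have [[q [Aq Jq]]|nz] := pselect (Ju z); last first.
        by exists p; split=> // y [<-//|/IH].
      case: (Atot _ _ Ap Aq) => /asboolP[pq _].
        by exists q; split=> // y [<-//|ry Jy]; apply: pq; exact: IH.
      by exists p; split=> // y [<- _|ry Jy]; [exact: pq|exact: IH].
    (* [P] depends only on the coordinates in [Ju], and also only on those in [l]; the hybrid [u]
       shows that it depends only on the common ones, which lie in a single [Jof p]. *)
    have depp : dep (Jof p) P.
      move=> v w vw Pv.
      pose u : valuation C X := fun s x =>
        if pselect (Ju (existT X s x)) then v s x else w s x.
      have Pu : P u.
        by apply: depP Pv => s x Jx; rewrite /u; case: pselect.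
      apply: depl Pu => s x lx; rewrite /u; case: pselect => // Jx.
      by apply: vw; apply: lp.
    apply: (depp (cof p)); first by move=> s x; exact: cuE.
    exact: (proj2_sig p).
  exists (exist good _ gu) => p Ap; apply/asboolP; split=> [z Jz|s x Jz] /=.
    by exists p.
  exact: cuE.
have JT z : J z.
  apply: contrapT; case: z => s0 x0 nJ.
  pose J1 := J `|` [set existT X s0 x0].
  pose G P := [/\ dfn Y P, dep J1 P & U P].
  pose vz (w : valuation C (var1 s0)) := w s0 (var_at (fun _ : unit => s0) tt).
  pose B := [set Q | exists P, G P /\ Q = (fun w => P (upd x0 c (vz w)))].
  have Gfip (l : seq (set (valuation C (var1 s0)))) : (forall Q, List.In Q l -> B Q) ->
      exists P, G P /\ forall w, P (upd x0 c (vz w)) -> forall Q, List.In Q l -> Q w.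
    elim: l => [|Q l IH] lB.
      by exists setT; split=> //; split=> //; [exact: dfn_top|exact: filterT].
    have [|P [[dP depP UP] HP]] := IH; first by move=> Q' lQ'; apply: lB; right.
    have [P' [[dP' depP' UP'] QE]] := lB Q (or_introl erefl).
    exists (P `&` P'); split.
      split; [exact: dfn_and|move=> v w vw [Pv Pv']|exact: filterI].
      by split; [exact: depP Pv|exact: depP' Pv'].
    move=> w [Pw Pw'] Q' [<-|lQ']; first by rewrite QE.
    exact: HP.
  have [W [WU BW]] : exists W, UltraFilter W /\ B `<=` W.
    apply: ultra_fip => l /Gfip[P [[dP depP UP] HP]].
    (* The existence of a value at [x0] is a condition on the coordinates in [J] alone, and it
       belongs to [U], so [c] already satisfies it. *)
    have dQ : dfn Y (fun v => exists z, P (upd x0 v z)).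
      exact: (dfn_ex1 (dfn_comp (upd_map x0) dP)).
    have [z Pz] : exists z, P (upd x0 c z).
      apply: (gJ _ dQ) => /=; last first.
        by apply: filterS UP => v Pv; exists (v s0 x0); rewrite upd_id.
      move=> v w vw [z Pz]; exists z; apply: depP Pz => s x [Jx|].
        have ne : existT X s x <> existT X s0 x0 by move=> e; apply: nJ; rewrite -e.
        by rewrite !upd_old // vw.
      move=> /= e; move: (congr1 (@projT1 _ _) e) => /= es; subst s.
      by rewrite (existT_inj e) !upd_new.
    by exists (assign1 z); apply: HP.
  have [z Hz] := realize1 (smallU sY (small_ran (v := c) sX)) WU.
  have g1 : good (J1, upd x0 c z).
    move=> P dP depP UP /=.
    pose Q := fun w => P (upd x0 c (vz w)).
    suff dQ : dfn (Y `|` ran c) Q by apply: (Hz Q dQ); apply: BW; exists P.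
    have rc s (x : X s) : (Y `|` ran c) (mk_elt (c s x)) by right; exists s, x.
    pose h s (x : X s) : (var1 s0 s + params (Y `|` ran c) s)%type :=
      match upd_map x0 x in ctx_ext _ _ u
          return (var1 s0 u + params (Y `|` ran c) u)%type with
      | ext_new => inl (var_at (fun _ : unit => s0) tt)
      | ext_old _ x' => inr (exist _ (c _ x') (rc _ x')) end.
    apply: dfn_ext (dfn_subst h (dfn_mono (@subsetUl _ _ _) dP)) _ => w.
    rewrite /Q; set v1 := vcomp _ _; suff -> : v1 = upd x0 c (vz w) by [].
    apply: valE => s x; rewrite /v1 /h /upd /vcomp.
    by case: (upd_map x0 x).
  have /Jmax/asboolP[/(_ (existT X s0 x0)) h _] : R (exist good _ gJ) (exist good _ g1).
    apply/asboolP; split=> /= [y Jy|s x Jx]; first by left.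
    by rewrite upd_old // => e; apply: nJ; rewrite -e.
  by apply: nJ; apply: h; right.
exists c => P dP UP; apply: (gJ P dP _ UP) => v w vw Pv.
by rewrite (_ : w = v) //; apply: valE => s x; rewrite vw.
Qed.

End Monster.

(** * Algebraic closure and codes *)

Section Definability.
Variables (L : language) (C : structure L).
Implicit Types (X : ctx L) (Y Z : set (elt C)).

Lemma dfn_fin Y X (P : set (valuation C X)) : dfn Y P ->
  exists n (tau : 'I_n -> sorts L) (b : Defs.tuple_of C tau),
    ran (assign b) `<=` Y /\ dfn (ran (assign b)) P.
Proof.
move=> /dfn_support[n [sg [h [m [tau [b [psi [bY H]]]]]]]].
exists m, tau, b; split; first by move=> _ [s [[i] ->]]; exact: bY.
have /(dfn_comp h) H' : dfn (ran (assign b))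
    (fun v : valuation C (vars sg) => sat psi (val_sum v (assign b))).
  by apply: dfn_instance => i; exists (tau i), (var_at tau i).
by apply: dfn_ext H' _ => v; rewrite H.
Qed.

Lemma dfn_tuple_eq Y n (sg : 'I_n -> sorts L) (w : valuation C (vars sg)) :
  ran w `<=` Y -> dfn Y [set w].
Proof.
move=> wY.
have yw i : Y (mk_elt (w _ (var_at sg i))) by apply: wY; exists (sg i), (var_at sg i).
have H i := dfn_eq (Y := Y) (X := vars sg) (inl (var_at sg i)) (inr (exist _ _ (yw i))).
apply: dfn_ext (dfn_ordall H) _ => v /=; split=> [h|-> //].
by apply: valE => s [i]; exact: h.
Qed.

Lemma dfn_list n (sg : 'I_n -> sorts L) (l : seq (valuation C (vars sg))) :
  dfn setT [set v | List.In v l].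
Proof.
elim: l => [|w l IH]; first exact: dfn_bot.
apply: dfn_ext (dfn_or (dfn_tuple_eq (Y := setT) (w := w) _) IH) _ => // v /=.
by split=> -[->|]; [left|right|left|right].
Qed.

Lemma finite_subset T (A : set T) (l : seq T) : (forall x, A x -> List.In x l) ->
  exists l', forall x, A x <-> List.In x l'.
Proof.
move=> Al; apply/finite_In; apply: sub_finite_set (_ : finite_set [set x | List.In x l]).
  exact: Al.
by apply/finite_In; exists l.
Qed.

Lemma dfn_finite n (sg : 'I_n -> sorts L) (A : set (valuation C (vars sg)))
    (l : seq (valuation C (vars sg))) :
  (forall v, A v -> List.In v l) -> dfn setT A.
Proof.
by move=> /finite_subset[l' Al']; apply: dfn_ext (dfn_list l') _ => v; rewrite Al'.
Qed.

Lemma var1E s (w : valuation C (var1 s)) :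
  w = assign1 (w s (var_at (fun _ : unit => s) tt)).
Proof. by apply: valE => u [[]]. Qed.

Lemma assign1_inj s (x y : C s) : assign1 x = assign1 y -> x = y.
Proof. by move=> /(congr1 (fun w => w s (var_at (fun _ : unit => s) tt))). Qed.

Definition vmapK (g : aut C) X : cancel (@vmap _ C g X) (@vmap _ C (aut_inv g) X).
Proof. by move=> v; apply: valE => s x; rewrite /vmap aut_invK. Qed.

Definition vmapKV (g : aut C) X : cancel (@vmap _ C (aut_inv g) X) (@vmap _ C g X).
Proof. by move=> v; apply: valE => s x; rewrite /vmap aut_invKV. Qed.

Lemma vmap_fixes (g : aut C) X (v : valuation C X) : fixes g (ran v) <-> vmap g v = v.
Proof.
split=> [f|e s x [u [z e']]]; first by apply: valE => s x; apply: f; exists s, x.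
move: (congr1 (@projT1 _ _) e') => /= es; subst u.
by rewrite (existT_inj e') -[RHS](congr1 (fun v => v s z) e).
Qed.

Lemma acl_dfn Y s (x : C s) : acl Y (mk_elt x) <->
  exists P : set (valuation C (var1 s)), [/\ dfn Y P, P (assign1 x) &
    exists l, forall y, P (assign1 y) -> List.In y l].
Proof.
split=> [[phi [px /finite_In[l fin]]]|[P [[phi H] Px [l Pl]]]].
  exists (fun v => psat v phi); split=> //; first exact: dfn_psat.
  by exists l => y /fin.
exists phi; split; first exact/H.
apply/finite_In; apply: (finite_subset (l := l)) => y; rewrite /= -H; exact: Pl.
Qed.

Lemma acl_mono Y Z : Y `<=` Z -> acl Y `<=` acl Z.
Proof.
move=> YZ [s x] /acl_dfn[P [dP Px Pl]]; apply/acl_dfn; exists P; split=> //.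
exact: dfn_mono dP.
Qed.

Lemma acl_orbit Y s (x : C s) : acl Y (mk_elt x) ->
  exists l, forall g : aut C, fixes g Y -> List.In (g s x) l.
Proof.
move=> /acl_dfn[P [dP Px [l Pl]]]; exists l => g f; apply: Pl.
suff -> : assign1 (g s x) = vmap g (assign1 x) by apply/(dfn_fixes _ dP f).
by apply: valE => u [].
Qed.

Lemma acl_self Y : Y `<=` acl Y.
Proof.
move=> [s x] Yx; apply/acl_dfn.
pose y := var_at (fun _ : unit => s) tt.
exists (fun w : valuation C (var1 s) => w s y = x); split=> //; last by exists [:: x] => z <-; left.
by have H := dfn_eq (X := var1 s) (inl y) (inr (exist _ x Yx : params Y s)).
Qed.

Lemma tuple_orbit Y n (sg : 'I_n -> sorts L) (v : valuation C (vars sg)) :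
  ran v `<=` acl Y ->
  exists l, forall g : aut C, fixes g Y -> List.In (vmap g v) l.
Proof.
move=> vY.
have H i : {l | forall g : aut C, fixes g Y -> List.In (g _ (v _ (var_at sg i))) l}.
  by apply: cid; apply: acl_orbit; apply: vY; exists (sg i), (var_at sg i).
pose l i := proj1_sig (H i).
pose m := (\max_(i < n) size (l i)).+1.
pose W (k : {ffun 'I_n -> 'I_m}) : valuation C (vars sg) :=
  assign (fun i => nth (v _ (var_at sg i)) (l i) (k i)).
exists [seq W k | k <- enum {ffun 'I_n -> 'I_m}] => g f.
have E i : {j : 'I_m | nth (v _ (var_at sg i)) (l i) j = g _ (v _ (var_at sg i))}.
  apply: cid; have [j e] := In_nth (proj2_sig (H i) g f).
  have jm : j < m by apply: (leq_trans (ltn_ord j)); apply: leqW; exact: (leq_bigmax i).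
  by exists (Ordinal jm) => /=; rewrite -e (tnth_nth (v _ (var_at sg i))).
apply/List.in_map_iff; exists [ffun i => proj1_sig (E i)]; split.
  by apply: valE => s [i]; rewrite /W /= ffunE (proj2_sig (E i)).
by apply/mem_In; rewrite mem_enum.
Qed.

End Definability.

Lemma sorts_le (L : language) : lec (sorts L) (fin_formula L).
Proof.
pose F s : fin_formula L := existT _ 1 (existT _ (fun _ => s) (Fbot _)).
pose g (p : fin_formula L) : option (sorts L) := match p with
  existT n (existT sg _) => match n return ('I_n -> sorts L) -> _ with
    | 0 => fun _ => None | k.+1 => fun sg => Some (sg ord0) end sg end.
by exists F => s t /(congr1 g) [].
Qed.

(** An algebraic element is recovered from a formula, its sort, the list of its parameters, where
    [None] marks the places of the variable, and its position in a list of the solutions. The list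
    is chosen as a function of the solution set alone. *)
Lemma small_acl (L : language) (C : structure L) (K : Type) (A : set (elt C)) :
  ~ lec K (fin_formula L) -> small K A -> small K (acl A).
Proof.
move=> ffK sA.
pose D := (fin_formula L * (sorts L * (seq (option {e | A e}) * nat)))%type.
have sD : ~ lec K D.
  have nF := fin_formula_infinite L.
  have snat : ~ lec K nat by apply: below_mono ffK; exact: nF.
  apply: (prod_below nF) => //; apply: (prod_below nF) => //.
    exact: below_mono (sorts_le L) ffK.
  apply: (prod_below nF) => //; apply: (seq_below nF) => //.
  apply: below_mono (sum_below nF ffK sA snat).
  exists (fun o => match o with Some a => inl a | None => inr 0 end).
  by move=> [a|] [b|] // [->].
apply: below_mono sD.
pose S (n : nat) (sg : 'I_n -> sorts L) (phi : formula (vars sg)) (s : sorts L)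
    (u : seq (option {e | A e})) : set (C s) :=
  [set y | exists v : valuation C (vars sg), sat phi v /\
    forall i : 'I_n, mk_elt (v _ (var_at sg i)) =
      match nth None u i with Some a => proj1_sig a | None => mk_elt y end].
have Hl T (B : set T) : exists l, finite_set B -> forall x, B x <-> List.In x l.
  have [/finite_In[l H]|nf] := pselect (finite_set B); first by exists l.
  by exists [::].
pose lst T (B : set T) := projT1 (cid (Hl T B)).
have lstE T (B : set T) : finite_set B -> forall x, B x <-> List.In x (lst T B).
  by rewrite /lst; case: (cid _).
pose f (d : D) : option (elt C) :=
  let: (existT n (existT sg phi), (s, (u, k))) := d in
  nth None [seq Some (mk_elt y) | y <- lst _ (S n sg phi s u)] k.
have fs (e : {e | acl A e}) : {d : D | f d = Some (proj1_sig e)}.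
  apply: cid; case: e => -[s x] /= /acl_dfn[P [[phi HP] /HP px [l0 Pl0]]].
  have finx : finite_set [set y | psat (assign1 y) phi].
    by apply/finite_In; apply: (finite_subset (l := l0)) => y /HP/Pl0.
  have [n [sg [h [phi0 H]]]] :=
    vars_support C (phi : formula (ctx_sum (var1 s) (params A))).
  pose u : seq (option {e | A e}) := [seq (match h _ (var_at sg i) with
    | inl _ => None
    | inr a => Some (exist A (mk_elt (proj1_sig a)) (proj2_sig a)) end) | i <- enum 'I_n].
  have SE : S n sg phi0 s u = [set y | psat (assign1 y) phi].
    apply/funext => y; apply/propext.
    have uE (i : 'I_n) : nth None u i = match h _ (var_at sg i) with
      | inl _ => None
      | inr a => Some (exist A (mk_elt (proj1_sig a)) (proj2_sig a)) end.
      by rewrite (nth_map i) ?size_enum_ord // nth_ord_enum.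
    rewrite /S /= /psat H; split=> [[v [sv Hv]]|sy].
      suff -> : vcomp (val_sum (assign1 y) (@params_val _ C A)) h = v by [].
      apply: valE => t [i]; rewrite /vcomp.
      move: (Hv i); rewrite uE; case: (h _ _) => [z|a] /= e; last exact/esym/(existT_inj e).
      have : mk_elt (assign1 y z) = mk_elt (v _ (var_at sg i)) by rewrite e; case: z.
      exact: existT_inj.
    exists (vcomp (val_sum (assign1 y) (@params_val _ C A)) h); split=> // i.
    by rewrite uE /vcomp; case: (h _ _) => // z /=; case: z.
  have lE := lstE _ _ finx.
  have [k kE] := In_nth ((lE x).1 px).
  exists (existT _ n (existT _ sg phi0), (s, (u, val k))); rewrite /f SE.
  move: kE; rewrite (tnth_nth x) /= => kE.
  have kl := ltn_ord k.
  rewrite (nth_map x) //; exact: (congr1 (fun y => Some (mk_elt y)) kE).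
exists (fun e => proj1_sig (fs e)) => e e' ee'; apply: sig_inj.
have [] : Some (proj1_sig e) = Some (proj1_sig e').
  by rewrite -(proj2_sig (fs e)) ee' (proj2_sig (fs e')).
by [].
Qed.

Section Closure.
Variables (L : language) (C : structure L) (K : Type).
Hypothesis ffK : ~ lec K (fin_formula L).
Hypothesis Csat : saturated C K.
Hypothesis Chom : strongly_homogeneous C K.
Implicit Types (X : ctx L) (Y Z : set (elt C)).

Lemma small_fin n (tau : 'I_n -> sorts L) (b : Defs.tuple_of C tau) :
  small K (ran (assign b)).
Proof. by apply: small_ran; exact: smallx_vars. Qed.

Lemma realize_fip Y X (B : set (set (valuation C X))) : small K Y -> smallx K X ->
  (forall P, B P -> dfn Y P) ->
  (forall l : seq (set (valuation C X)), (forall P, List.In P l -> B P) ->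
     exists v, forall P, List.In P l -> P v) ->
  exists c, forall P, B P -> P c.
Proof.
move=> sY sX dB /ultra_fip[U [UU BU]].
have [c Hc] := realize ffK Csat sY sX UU.
by exists c => P BP; apply: Hc; [exact: dB|exact: BU].
Qed.

Lemma hom_vmap Y X (v w : valuation C X) : small K Y -> smallx K X ->
  (forall P, dfn Y P -> P v -> P w) ->
  exists g : aut C, fixes g Y /\ vmap g v = w.
Proof.
move=> sY sX H; have [g [f gv]] := hom_over ffK Chom sY sX H.
by exists g; split=> //; exact: valE.
Qed.

Lemma dfn_bigU Y X (l : seq (set (valuation C X))) : (forall P, List.In P l -> dfn Y P) ->
  dfn Y (fun v => exists P, List.In P l /\ P v).
Proof.
elim: l => [|P l IH] H; first by apply: dfn_ext (dfn_bot _ _) _ => v; split=> // -[P [[]]].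
have h1 := H P (or_introl erefl).
have h2 := IH (fun Q lQ => H Q (or_intror lQ)).
apply: dfn_ext (dfn_or h1 h2) _ => v; split=> [[Pv|[Q [lQ Qv]]]|[Q [[<-|lQ] Qv]]].
- by exists P; split=> //; left.
- by exists Q; split=> //; right.
- by left.
- by right; exists Q.
Qed.

(** Compactness is used twice: invariance makes [P] a union of [Y]-definable sets, and then finitely
    many of them suffice. *)
Lemma inv_dfn Y X (P : set (valuation C X)) : small K Y -> smallx K X -> dfn setT P ->
  (forall (g : aut C) v, fixes g Y -> P v -> P (vmap g v)) -> dfn Y P.
Proof.
move=> sY sX dP Pinv.
have [n [tau [b [_ dPb]]]] := dfn_fin dP.
pose Y1 := Y `|` ran (assign b).
have sY1 : small K Y1 by exact: (smallU ffK sY (small_fin (b := b))).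
have d1 Q : dfn Y Q -> dfn Y1 Q by apply: dfn_mono; exact: subsetUl.
have dP1 : dfn Y1 P by apply: dfn_mono dPb; exact: subsetUr.
(* If no [Y]-definable set lies between [a] and [P], some [c] outside [P] has the type of [a] over
   [Y] and is therefore conjugate to [a]. *)
have step1 a : P a -> exists R, [/\ dfn Y R, R a & R `<=` P].
  move=> Pa; apply: contrapT => nR.
  have [||c Hc] := realize_fip (B := [set R | R = ~` P \/ (dfn Y R /\ R a)]) sY1 sX.
  - by move=> R [->|[/d1 //]]; exact: dfn_not.
  - move=> l lB.
    have [R [[dR Ra] Rl]] : exists R, (dfn Y R /\ R a) /\
        forall v, ~ P v -> R v -> forall Q, List.In Q l -> Q v.
      elim: l lB => [|Q l IH] lB; first by exists setT; split=> //; split=> //; exact: dfn_top.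
      have [|R [[dR Ra] HR]] := IH; first by move=> Q' lQ'; apply: lB; right.
      have [->|[dQ Qa]] := lB Q (or_introl erefl).
        by exists R; split=> // v nP Rv Q' [<-//|]; exact: HR.
      exists (R `&` Q); split; first by split=> //; exact: dfn_and.
      by move=> v nP [Rv Qv] Q' [<-//|]; exact: HR.
    have [v [Rv nPv]] : exists v, R v /\ ~ P v.
      apply: contrapT => nv; apply: nR; exists R; split=> // v Rv.
      by apply: contrapT => nP; apply: nv; exists v.
    by exists v; exact: Rl.
  have nPc : (~` P) c by apply: Hc; left.
  have [|g [f gac]] := hom_vmap sY sX (v := a) (w := c).
    by move=> Q dQ Qa; apply: Hc; right.
  by apply: nPc; rewrite -gac; exact: Pinv.
apply: contrapT => nd.
have [||c Hc] := realize_fip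
    (B := [set R | R = P \/ exists Q, [/\ dfn Y Q, Q `<=` P & R = ~` Q]]) sY1 sX.
- by move=> R [->//|[Q [/d1 dQ _ ->]]]; exact: dfn_not.
- move=> l lB; apply: contrapT => nv.
  apply: nd.
  have [l' [l'Q l'l]] : exists l' : seq (set (valuation C X)),
     (forall Q, List.In Q l' -> dfn Y Q /\ Q `<=` P) /\
     forall v, P v -> (forall Q, List.In Q l' -> ~ Q v) -> forall R, List.In R l -> R v.
    elim: (l) lB => [|R r IH] lB; first by exists [::].
    have [|l' [l'Q l'l]] := IH; first by move=> Q' lQ'; apply: lB; right.
    have [RE|[Q [dQ QP RE]]] := lB R (or_introl erefl).
      exists l'; split=> // v Pv nQ R' [<-|rR']; first by rewrite RE.
      exact: l'l rR'.
    exists (Q :: l'); split=> [Q' [<-//|/l'Q//]|v Pv nQ R' [<-|rR']].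
      by rewrite RE; apply: nQ; left.
    by apply: l'l rR' => // Q' lQ'; apply: nQ; right.
  have dU : dfn Y (fun v => exists Q, List.In Q l' /\ Q v).
    by apply: dfn_bigU => Q /l'Q[].
  apply: dfn_ext dU _ => v; split=> [[Q [/l'Q[_ QP] /QP//]]|Pv].
  apply: contrapT => nQ; apply: nv; exists v; apply: l'l => // Q lQ Qv.
  by apply: nQ; exists Q.
have Pc : P c by apply: Hc; left.
have [R [dR Rc RP]] := step1 c Pc.
by have : (~` R) c by apply: Hc; right; exists R.
Qed.

(** The orbit is finite, hence definable with parameters; being invariant over [Y] it is
    [Y]-definable. *)
Lemma orbit_acl Y s (x : C s) (l : seq (C s)) : small K Y ->
  (forall g : aut C, fixes g Y -> List.In (g s x) l) -> acl Y (mk_elt x).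
Proof.
move=> sY xl; apply/acl_dfn.
pose P : set (valuation C (var1 s)) := fun w => exists g : aut C,
  fixes g Y /\ w = assign1 (g s x).
exists P; split; last first.
- by exists l => y [g [f /assign1_inj ->]]; exact: xl.
- by exists (aut_id C).
pose y0 := var_at (fun _ : 'I_1 => s) ord0.
pose h1 : ctx_map (vars (fun _ : 'I_1 => s)) (var1 s) := fun u z =>
  match z with var_at _ => var_at (fun _ : unit => s) tt end.
have dP : dfn setT P.
  have [l' Hl'] : exists l', forall y, P (assign1 y) <-> List.In y l'.
    by apply: (finite_subset (l := l)) => y [g [f /assign1_inj ->]]; exact: xl.
  have H : dfn setT (fun w : valuation C (var1 s) => List.In (w s (var_at (fun _ : unit => s) tt)) l').
    elim: (l') => [|z r IH]; first exact: dfn_bot.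
    have H' := dfn_eq (Y := setT) (X := var1 s) (inl (var_at (fun _ : unit => s) tt))
      (inr (exist _ z I : params (@setT (elt C)) s)).
    by apply: dfn_ext (dfn_or H' IH) _ => w /=; split=> -[->|]; [left|right|left|right].
  by apply: dfn_ext H _ => w; rewrite -Hl' -var1E.
apply: inv_dfn => //; first exact: smallx_var1.
move=> g v f [g' [f' ->]]; exists (aut_comp g g'); split; first exact: fixes_comp.
by apply: valE => u [].
Qed.

(** Orbits are counted: the parameters [b] have finitely many conjugates over [Y], and the
    conjugates of [x] lying above a given one are translates of elements of the finite list [l0]. *)
Lemma acl_idem Y Z : small K Y -> Z `<=` acl Y -> acl Z `<=` acl Y.
Proof.
move=> sY ZY [s x] /acl_dfn[P [dP Px [l0 Pl]]].
have [n [tau [b [bZ dPb]]]] := dfn_fin dP.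
have [lb Hlb] : exists lb, forall g : aut C, fixes g Y -> List.In (vmap g (assign b)) lb.
  by apply: tuple_orbit; exact: subset_trans ZY.
have Hc (w : valuation C (vars tau)) : {l : seq (C s) | forall g : aut C, fixes g Y ->
    vmap g (assign b) = w -> List.In (g s x) l}.
  apply: cid; have [[h [fh hb]]|nh] := pselect (exists h : aut C, fixes h Y /\ vmap h (assign b) = w).
    exists (map (h s) l0) => g fg gb; apply/List.in_map_iff.
    exists (aut_inv h s (g s x)); split; first exact: aut_invKV.
    apply: Pl.
    have f : fixes (aut_comp (aut_inv h) g) (ran (assign b)).
      apply/vmap_fixes.
      by rewrite -[RHS](vmapK h) hb -gb.
    move/(dfn_fixes (assign1 x) dPb) : f => [_ /(_ Px)].
    by rewrite (var1E (vmap _ _)).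
  by exists [::] => g fg gb; apply: nh; exists g.
apply: (orbit_acl (l := flatten [seq proj1_sig (Hc w) | w <- lb])) => // g fg.
have := Hlb g fg; elim: (lb) => //= w r IH [e|/IH h]; apply/List.in_app_iff; last by right.
by left; exact: (proj2_sig (Hc w)).
Qed.

Lemma acl_act Y (g : aut C) e : small K Y -> acl Y e -> acl (act g @` Y) (act g e).
Proof.
case: e => s x sY /acl_orbit[l Hl].
apply: (orbit_acl (l := map (g s) l)); first exact: small_act.
move=> h fh; apply/List.in_map_iff; exists (aut_inv g s (h s (g s x))); split.
  exact: aut_invKV.
apply: (Hl (aut_comp (aut_inv g) (aut_comp h g))) => u y Yy /=.
by rewrite fh ?apK //; exists (mk_elt y).
Qed.

Lemma act_fixes_image Y (g : aut C) : fixes g Y -> act g @` Y = Y.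
Proof.
move=> f; apply/seteqP; split=> [_ [e Ye <-]|e Ye]; first by rewrite (fixes_act f Ye).
by exists e => //; rewrite (fixes_act f Ye).
Qed.

Lemma acl_fixes Y (g : aut C) e : small K Y -> fixes g Y -> acl Y e -> acl Y (act g e).
Proof. by move=> sY f /(acl_act g sY); rewrite act_fixes_image. Qed.

Lemma fixed_acl Y s (x : C s) : small K Y ->
  (forall g : aut C, fixes g Y -> g s x = x) -> acl Y (mk_elt x).
Proof.
by move=> sY H; apply: (orbit_acl (l := [:: x])) => // g /H ->; left.
Qed.

Lemma not_acl_moved Y s (x : C s) : small K Y -> ~ acl Y (mk_elt x) ->
  exists g : aut C, fixes g Y /\ g s x <> x.
Proof.
move=> sY nx; apply: contrapT => H; apply: nx; apply: fixed_acl => // g f.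
by apply: contrapT => n; apply: H; exists g.
Qed.

Variables (T : theory L).
Hypothesis CT : models T C.
Hypothesis EI : elimination_of_imaginaries T.

Lemma dfn0_formula X (P : set (valuation C X)) : dfn set0 P ->
  exists phi : formula X, forall v, P v <-> sat phi v.
Proof.
move=> [phi H].
pose k : ctx_map (ctx_sum X (params (@set0 (elt C)))) X := fun s z =>
  match z with inl x => x | inr a => match proj2_sig a with end end.
exists (rename k phi) => v; rewrite H sat_rename /psat.
suff -> : val_sum v (@params_val _ C set0) = vcomp v k by [].
by apply: valE => s [x|[a []]].
Qed.

(** The parameters [y] that define the same set as [c0] form a class of a 0-definable equivalence
    relation [E]. Elimination of imaginaries attaches a tuple [b] to this class, and the uniqueness
    of [b] turns preservation of [D] by [g] into [g] fixing [b]. *)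
Lemma code n (sg : 'I_n -> sorts L) (D : set (valuation C (vars sg))) : dfn setT D ->
  exists m (tau : 'I_m -> sorts L) (b : valuation C (vars tau)),
    forall g : aut C, (forall v, D v <-> D (vmap g v)) <-> vmap g b = b.
Proof.
move=> /dfn_support[n0 [sg0 [h0 [m0 [tau0 [c0 [psi [_ HD]]]]]]]].
pose chi (v : valuation C (vars sg)) (y : valuation C (vars tau0)) :=
  sat psi (val_sum (vcomp v h0) y).
have chig (g : aut C) v y : chi (vmap g v) (vmap g y) <-> chi v y.
  rewrite /chi -[X in _ <-> X](aut_sat g).
  set v1 := val_sum _ _; set v2 := (X in _ <-> sat psi X); suff -> : v1 = v2 by [].
  by apply: valE => s [].
pose X2 := ctx_sum (vars tau0) (vars tau0).
pose eqv (y : valuation C X2) := forall v : Defs.tuple_of C sg,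
  chi (assign v) (vcomp y (fun s z => inl z)) <-> chi (assign v) (vcomp y (fun s z => inr z)).
have [E HE] : exists E : formula X2, forall y, eqv y <-> sat E y.
  apply: dfn0_formula.
  pose X3 := ctx_sum X2 (vars sg).
  have d1 : dfn set0 (fun w : valuation C X3 => chi (vcomp w (fun s z => inr z))
      (vcomp w (fun s z => inl (inl z)))).
    pose k : ctx_map (ctx_sum (vars sg0) (vars tau0)) X3 := fun s z => match z with
      inl x => inr (h0 s x) | inr y => inl (inl y) end.
    apply: dfn_ext (dfn_psat (rename (fun s z => inl (k s z)) psi)) _ => w.
    rewrite /psat sat_rename /chi.
    set v1 := vcomp _ _; set v2 := val_sum _ _; suff -> : v1 = v2 by [].
    by apply: valE => s [].
  have d2 : dfn set0 (fun w : valuation C X3 => chi (vcomp w (fun s z => inr z))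
      (vcomp w (fun s z => inl (inr z)))).
    pose k : ctx_map (ctx_sum (vars sg0) (vars tau0)) X3 := fun s z => match z with
      inl x => inr (h0 s x) | inr y => inl (inr y) end.
    apply: dfn_ext (dfn_psat (rename (fun s z => inl (k s z)) psi)) _ => w.
    rewrite /psat sat_rename /chi.
    set v1 := vcomp _ _; set v2 := val_sum _ _; suff -> : v1 = v2 by [].
    by apply: valE => s [].
  apply: dfn_ext (dfn_all (dfn_and (dfn_imp d1 d2) (dfn_imp d2 d1))) _ => y.
  by split=> H v; case: (H v) => h1 h2; split; [exact: h1|exact: h2|exact: h1|exact: h2].
have DR (x y : Defs.tuple_of C tau0) : def_rel E x y <->
    forall v : valuation C (vars sg), chi v (assign x) <-> chi v (assign y).
  rewrite /def_rel -HE; split=> H v; last exact: (H (assign v)).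
  have := H (fun i => v _ (var_at sg i)).
  by rewrite (_ : assign _ = v) //; apply: valE => s [].
have EE : equivalence_on (@def_rel L C m0 tau0 E).
  split=> [x|x y|x y z]; rewrite !DR => //.
    by move=> H v; rewrite H.
  by move=> H1 H2 v; rewrite H1 H2.
have [m [tau [phi [b [Hb ub]]]]] := EI CT EE c0.
have vasg (g : aut C) k (rho : 'I_k -> sorts L) (x : Defs.tuple_of C rho) :
    vmap g (assign x) = assign (fun i => g _ (x i)).
  by apply: valE => s [].
have phig (g : aut C) x y : sat phi (val_sum (vmap g x) (vmap g y)) <-> sat phi (val_sum x y).
  rewrite -[X in _ <-> X](aut_sat g).
  set v1 := val_sum _ _; set v2 := (X in _ <-> sat phi X); suff -> : v1 = v2 by [].
  by apply: valE => s [].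
have DC v : D v <-> chi v (assign c0) by rewrite HD.
exists m, tau, (assign b) => g.
have -> : (forall v, D v <-> D (vmap g v)) <-> def_rel E (fun i => g _ (c0 i)) c0.
  rewrite DR -vasg; split=> H v.
    by rewrite -[v](vmapKV g) chig -!DC.
  by rewrite !DC -(chig g v) H.
split=> [Eg|gb].
  have /ub e : forall x, def_rel E x c0 <-> sat phi (val_sum (assign x) (assign (fun i => g _ (b i)))).
    move=> x; rewrite -vasg -[assign x](vmapKV g) phig vasg -Hb !DR.
    move: Eg; rewrite DR => Eg.
    split=> H v.
      rewrite -[v](vmapK g) -vasg chig H.
      by rewrite -Eg -vasg -{1}[vmap g v](vmapK (aut_inv g)) chig vmapK.
    rewrite -(chig (aut_inv g)) vasg H.
    by rewrite -(chig g) vmapKV vasg Eg.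
  by rewrite vasg -e.
have : def_rel E c0 c0 by case: EE.
by rewrite Hb -(phig g) gb vasg -Hb.
Qed.

End Closure.

(** * Invariant types in omega-stable theories *)

Section History.
Variable T : Type.

(** The newest entry comes first, to match sequences in which each term is chosen over the earlier
    ones. *)
Fixpoint hist (f : nat -> T) (n : nat) : seq T :=
  if n is n'.+1 then f n' :: hist f n' else [::].

Lemma hist_In f i n : i < n -> List.In (f i) (hist f n).
Proof.
by elim: n => //= n IH; rewrite ltnS leq_eqVlt => /orP[/eqP->|/IH]; [left|right].
Qed.

Lemma hist_eq f g n : (forall i, i < n -> f i = g i) -> hist f n = hist g n.
Proof.
elim: n => //= n IH fg; rewrite fg ?IH // => i iltn; apply: fg; exact: ltnW.
Qed.

Lemma dependent_choice_hist (good : seq T -> Prop) : good [::] ->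
  (forall l, good l -> exists x, good (x :: l)) ->
  exists f, forall n, good (hist f n).
Proof.
move=> g0 gS.
pose next (l : {l | good l}) := cid (gS _ (proj2_sig l)).
pose L := fix L n : {l | good l} := if n is n'.+1 then
   exist good (proj1_sig (next (L n')) :: proj1_sig (L n')) (proj2_sig (next (L n')))
  else exist good _ g0.
exists (fun n => proj1_sig (next (L n))) => n.
suff -> : hist (fun n => proj1_sig (next (L n))) n = proj1_sig (L n) by exact: proj2_sig.
by elim: n => //= n ->.
Qed.

End History.

Lemma cantor_nat : ~ lec (nat -> bool) nat.
Proof.
move=> [c ci].
pose g n := `[< exists f, c f = n /\ f n = false >].
have h : g (c g) = true.
  apply: contrapT => ng; apply: (ng); apply/asboolP; exists g; split=> //.
  exact/negbTE/negP.
by have /asboolP[f [/ci ->]] := h; rewrite h.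
Qed.

(** * Counting types along a binary tree *)

Section NoTree.
Variables (L : language) (T : theory L) (C : structure L).
Hypothesis CT : models T C.
Hypothesis stab : omega_stable T.
Variables (n : nat) (sg : 'I_n -> sorts L).

(** Repeated splitting gives a binary tree of nonempty definable sets, all of them definable over
    one countable set [A]. Its branches extend to pairwise distinct types over [A], against
    omega-stability. *)
Lemma no_tree (cls : set (set (valuation C (vars sg)))) :
  (forall P, cls P -> dfn setT P /\ exists v, P v) ->
  (forall P, cls P -> exists Q, [/\ dfn setT Q, cls (P `&` Q) & cls (P `&` ~` Q)]) ->
  ~ exists P, cls P.
Proof.
move=> clsd clsS [P0 clsP0].
have H (P : set (valuation C (vars sg))) :
    {Q | cls P -> [/\ dfn setT Q, cls (P `&` Q) & cls (P `&` ~` Q)]}.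
  by apply: cid; have [/clsS[Q ?]|nc] := pselect (cls P); [exists Q|exists setT].
pose sel P := proj1_sig (H P).
pose t := fix t (s : seq bool) := if s is b :: s' then
  t s' `&` (if b then sel (t s') else ~` sel (t s')) else P0.
have clst s : cls (t s).
  by elim: s => //= b s /(proj2_sig (H (t s)))[_]; case: b.
have dsel s : dfn setT (sel (t s)) by have [] := proj2_sig (H (t s)) (clst s).
have fin (P : set (valuation C (vars sg))) : dfn setT P ->
    exists Z, countable Z /\ dfn Z P.
  move=> /dfn_fin[m [tau [b [_ dP]]]]; exists (ran (assign b)); split=> //.
  apply: finite_set_countable; apply/finite_In.
  apply: (finite_subset (l := [seq mk_elt (b i) | i <- enum 'I_m])) => _ [s [[i] ->]].
  by apply/List.in_map_iff; exists i; split=> //; apply/mem_In; rewrite mem_enum.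
have [Z0 [cZ0 dZ0]] := fin _ (clsd _ clsP0).1.
pose Z s := projT1 (cid (fin _ (dsel s))).
have cZ s : countable (Z s) by rewrite /Z; case: (cid _) => ? [].
have dZ s : dfn (Z s) (sel (t s)) by rewrite /Z; case: (cid _) => ? [].
pose A := \bigcup_(o in [set: option (seq bool)]) (if o is Some s then Z s else Z0).
have cA : countable A.
  by apply: bigcup_countable => [|[s|] _]; [exact: countableP|exact: cZ|].
have dA s : dfn A (sel (t s)) by apply: dfn_mono (dZ s) => e Ze; exists (Some s).
have dtA s : dfn A (t s).
  elim: s => [|b s IH] /=; first by apply: dfn_mono dZ0 => e Ze; exists None.
  by apply: dfn_and => //; case: b => //; exact: dfn_not.
have ult (f : nat -> bool) : exists U : set (set (valuation C (vars sg))),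
    UltraFilter U /\ forall k, U (t (hist f k)).
  have [|U [UU BU]] := @ultra_fip _ [set P | exists k, P = t (hist f k)].
    move=> l lB.
    have [k Hk] : exists k, forall P, List.In P l -> t (hist f k) `<=` P.
      elim: l lB => [|P l IH] lB; first by exists 0.
      have [|k Hk] := IH; first by move=> Q lQ; apply: lB; right.
      have [m ->] := lB P (or_introl erefl).
      have mono i j : i <= j -> t (hist f j) `<=` t (hist f i).
        elim: j => [|j IHj]; first by rewrite leqn0 => /eqP->.
        rewrite leq_eqVlt ltnS => /orP[/eqP->//|/IHj h].
        by move=> v /= [/h].
      exists (maxn k m) => Q [<-|lQ]; first exact: mono (leq_maxr _ _).
      exact: subset_trans (mono _ _ (leq_maxl _ _)) (Hk Q lQ).
    have [_ [v tv]] := clsd _ (clst (hist f k)).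
    by exists v => P /Hk; apply.
  by exists U; split=> // k; apply: BU; exists k.
pose U f := projT1 (cid (ult f)).
have UU f : UltraFilter (U f) by rewrite /U; case: (cid _) => ? [].
have Ut f k : U f (t (hist f k)) by rewrite /U; have [_] := proj2_sig (cid (ult f)); exact.
pose p f : set (pformula A (vars sg)) := [set phi | U f (fun v => psat v phi)].
have pc f : complete_type (p f) by exact: ultra_complete_type.
apply: cantor_nat.
have /card_leE le := stab CT cA sg.
apply: lec_trans (lec_trans le (lec_setT _).1).
exists (fun f => exist _ (p f) (pc f)) => f g /(congr1 (@proj1_sig _ _)) /= pfg.
apply: contrapT => fg.
(* At the first level where the two branches part, the set that splits their common node belongs to
   exactly one of the two types. *)
have [k [fgk fgi]] : exists k, f k <> g k /\ forall i, i < k -> f i = g i.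
  have ex : exists k, f k != g k.
    apply: contrapT => nk; apply: fg; apply/funext => k.
    by apply/eqP; apply: contrapT => /negP fgk; apply: nk; exists k.
  exists (ex_minn ex); case: ex_minnP => k /eqP fgk kmin; split=> // i ik.
  by apply/eqP; apply: contrapT => /negP/kmin; rewrite leqNgt ik.
have hfg := hist_eq fgi; pose s := hist f k.
have [phi Hphi] := dA s.
have key (h : nat -> bool) : hist h k = s -> U h (sel (t s)) <-> h k = true.
  move=> hs; have := Ut h k.+1; rewrite /= hs; case: (h k) => /= UI.
    by split=> // _; apply: filterS UI => v [].
  split=> // Us; have : U h (~` sel (t s)) by apply: filterS UI => v [].
  by move/(ultraNE (UU h)).
have pE h : hist h k = s -> p h phi <-> h k = true.
  move=> hs; rewrite -(key _ hs) /p /=.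
  by rewrite (_ : (fun v => psat v phi) = sel (t s)) //; apply/funext => v; apply/propext; rewrite Hphi.
have : f k = true <-> g k = true by rewrite -!pE // pfg.
by case: (f k) (g k) fgk => [] [] // _ [h1 h2]; [have := h1 erefl|have := h2 erefl].
Qed.

End NoTree.

(** * Local rank, bounded orders and definability of types *)

Section Rank.
Variables (L : language) (C : structure L).
Variables (n m : nat) (sg : 'I_n -> sorts L) (tau : 'I_m -> sorts L).
Implicit Type X : ctx L.
Variable psi : formula (ctx_sum (vars sg) (vars tau)).

Definition relsat (v : valuation C (vars sg)) (w : valuation C (vars tau)) : Prop :=
  sat psi (val_sum v w).

Lemma rel_aut (g : aut C) v w : relsat (vmap g v) (vmap g w) <-> relsat v w.
Proof.
rewrite /relsat -[X in _ <-> X](aut_sat g).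
set v1 := val_sum _ _; set v2 := (X in _ <-> sat psi X); suff -> : v1 = v2 by [].
by apply: valE => s [].
Qed.

Lemma dfn_rel Y X (h : ctx_map (vars sg) X) (k : ctx_map (vars tau) X) :
  dfn Y (fun u : valuation C X => relsat (vcomp u h) (vcomp u k)).
Proof.
pose q : ctx_map (ctx_sum (vars sg) (vars tau)) (ctx_sum X (params Y)) := fun s z =>
  match z with inl x => inl (h s x) | inr y => inl (k s y) end.
apply: dfn_ext (dfn_psat (rename q psi)) _ => u.
rewrite /psat sat_rename /relsat.
set v1 := vcomp _ _; set v2 := val_sum _ _; suff -> : v1 = v2 by [].
by apply: valE => s [].
Qed.

Lemma dfn_rel_l Y w : ran w `<=` Y -> dfn Y (fun v => relsat v w).
Proof.
move=> wY.
have -> : (fun v => relsat v w) = fun v => sat psi (val_sum v (assign (fun i => w _ (var_at tau i)))).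
  apply/funext => v; rewrite /relsat.
  by congr (sat psi (val_sum v _)); apply: valE => s [].
by apply: dfn_instance => i; apply: wY; exists (tau i), (var_at tau i).
Qed.

Lemma dfn_rel_r Y v : ran v `<=` Y -> dfn Y (relsat v).
Proof.
move=> vY.
pose h s (z : ctx_sum (vars sg) (vars tau) s) : (vars tau s + params Y s)%type :=
  match z with inl x => inr (exist _ (v s x) (vY _ (ex_intro _ s (ex_intro _ x erefl))))
   | inr y => inl y end.
have := dfn_subst h (@dfn_rel Y _ (fun s z => inl z) (fun s z => inr z)).
by move=> H; apply: dfn_ext H _ => w.
Qed.

(* Shelah's 2-rank: [rk k P] says that [P] contains the branches of a complete
   binary tree of height [k] built from instances of [psi]. *)
Fixpoint rk (k : nat) (P : set (valuation C (vars sg))) : Prop :=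
  if k is k'.+1 then exists w, rk k' (P `&` relsat^~ w) /\ rk k' (P `&` ~` relsat^~ w)
  else exists v, P v.

Lemma rk_mono k P Q : P `<=` Q -> rk k P -> rk k Q.
Proof.
elim: k P Q => [|k IH] P Q PQ /=; first by move=> [v /PQ]; exists v.
by move=> [w [h1 h2]]; exists w; split; [apply: IH h1|apply: IH h2]; exact: setSI.
Qed.

Lemma dfn_rk Y X k (R : set (valuation C (ctx_sum X (vars sg)))) : dfn Y R ->
  dfn Y (fun u : valuation C X => rk k (fun v => R (val_sum u v))).
Proof.
elim: k X R => [|k IH] X R dR.
  apply: dfn_ext (dfn_ex dR) _ => u; split=> [[b Rb]|[v Rv]]; first by exists (assign b).
  exists (fun i => v _ (var_at sg i)).
  by rewrite (_ : assign _ = v) //; apply: valE => s [].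
pose X' := ctx_sum X (vars tau).
pose R1 : set (valuation C (ctx_sum X' (vars sg))) := fun u =>
  R (vcomp u (fun s z => match z with inl x => inl (inl x) | inr y => inr y end)).
pose R2 : set (valuation C (ctx_sum X' (vars sg))) := fun u =>
  relsat (vcomp u (fun s z => inr z)) (vcomp u (fun s z => inl (inr z))).
have d1 : dfn Y R1 by apply: (dfn_comp _ dR).
have d2 : dfn Y R2 by apply: dfn_rel.
have := dfn_ex (dfn_and (IH _ _ (dfn_and d1 d2)) (IH _ _ (dfn_and d1 (dfn_not d2)))).
move=> H; apply: dfn_ext H _ => u /=.
have E1 (w : valuation C (vars tau)) v : R1 (val_sum (val_sum u w) v) <-> R (val_sum u v).
  rewrite /R1; set v1 := vcomp _ _; suff -> : v1 = val_sum u v by [].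
  by apply: valE => s [].
split=> [[b [h1 h2]]|[w [h1 h2]]].
  exists (assign b); split; [apply: rk_mono h1|apply: rk_mono h2];
    by move=> v [/E1 Rv r]; split.
exists (fun i => w _ (var_at tau i)).
rewrite (_ : assign _ = w); last by apply: valE => s [].
by split; [apply: rk_mono h1|apply: rk_mono h2]; move=> v [Rv r]; split=> //; apply/E1.
Qed.

(** One instance of [psi] cuts the ordered points in the middle, and each half carries a subtree. *)
Lemma order_rk (a : nat -> valuation C (vars sg)) (b : nat -> valuation C (vars tau))
    k lo P :
  (forall i, lo <= i < lo + 2 ^ k -> P (a i)) ->
  (forall i j, lo <= i < lo + 2 ^ k -> lo <= j < lo + 2 ^ k -> relsat (a i) (b j) <-> j < i) ->
  rk k P.
Proof.
elim: k lo P => [|k IH] lo P Pa ord /=.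
  by exists (a lo); apply: Pa; rewrite leqnn /= expn0 addn1.
have k0 : 0 < 2 ^ k by rewrite expn_gt0.
rewrite expnS mul2n -addnn in Pa ord.
(* The index is one below the middle: the order being strict, this instance holds exactly on the
   upper half. *)
exists (b (lo + 2 ^ k).-1); split.
  apply: (IH (lo + 2 ^ k)) => [i ir|i i' ir ir']; last by apply: ord; lia.
  by split; [apply: Pa; lia|apply/ord; lia].
apply: (IH lo) => [i ir|i i' ir ir']; last by apply: ord; lia.
by split; [apply: Pa; lia|move=> /ord; lia].
Qed.

Section Bounded.
Variables (T : theory L) (K : Type).
Hypothesis CT : models T C.
Hypothesis stab : omega_stable T.
Hypothesis ffK : ~ lec K (fin_formula L).
Hypothesis Csat : saturated C K.

Lemma rk_S k P : rk k.+1 P -> rk k P.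
Proof. by move=> [w [h _]]; apply: rk_mono h => v []. Qed.

(** Otherwise the definable sets of unbounded rank form a class closed under splitting: compactness
    merges the splitting instances found for each [k] into a single one. *)
Lemma rk_bounded : exists k, ~ rk k setT.
Proof.
apply: contrapT => nb.
have all k : rk k setT by apply: contrapT => nk; apply: nb; exists k.
apply: (no_tree CT stab (cls := [set P | dfn setT P /\ forall k, rk k P])).
- by move=> P [dP rP]; split=> //; exact: (rP 0).
- move=> P [dP rP].
  have [m0 [rho [c [_ dPc]]]] := dfn_fin dP.
  pose Y := ran (assign c).
  pose G k := [set w | rk k (P `&` relsat^~ w) /\ rk k (P `&` ~` relsat^~ w)].
  have [||||w Hw] := realize_fip ffK Csat (Y := Y) (X := vars tau) (B := [set Q | exists k, Q = G k]).
  + exact: small_fin.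
  + exact: smallx_vars.
  + move=> _ [k ->].
    have dP' : dfn Y (fun u : valuation C (ctx_sum (vars tau) (vars sg)) =>
      P (vcomp u (fun s z => inr z))).
      exact: dfn_comp.
    have dr : dfn Y (fun u : valuation C (ctx_sum (vars tau) (vars sg)) =>
       relsat (vcomp u (fun s z => inr z)) (vcomp u (fun s z => inl z))) by exact: dfn_rel.
    apply: dfn_ext (dfn_and (dfn_rk k (dfn_and dP' dr)) (dfn_rk k (dfn_and dP' (dfn_not dr)))) _.
    by move=> w.
  + move=> l lB.
    have [k Hk] : exists k, forall Q, List.In Q l -> G k `<=` Q.
      elim: l lB => [|Q l IH] lB; first by exists 0.
      have [|k Hk] := IH; first by move=> R lR; apply: lB; right.
      have [k' ->] := lB Q (or_introl erefl).
      have mono i j : i <= j -> G j `<=` G i.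
        elim: j => [|j IHj]; first by rewrite leqn0 => /eqP->.
        rewrite leq_eqVlt ltnS => /orP[/eqP->//|/IHj h] v [/rk_S h1 /rk_S h2].
        by apply: h.
      exists (maxn k k') => R [<-|lR]; first exact: mono (leq_maxr _ _).
      exact: subset_trans (mono _ _ (leq_maxl _ _)) (Hk R lR).
    have [w Gw] := rP k.+1.
    by exists w => Q /Hk; apply.
  exists (relsat^~ w).
  have dw : dfn setT (relsat^~ w) by exact: dfn_rel_l.
  have r k := Hw (G k) (ex_intro _ k erefl).
  split=> //; split=> [|k]; [exact: (dfn_and dP dw)|exact: (r k).1| |exact: (r k).2].
  exact: (dfn_and dP (dfn_not dw)).
- by exists setT; split=> //; exact: dfn_top.
Qed.

Lemma no_order : exists N,
  forall (a : nat -> valuation C (vars sg)) (b : nat -> valuation C (vars tau)),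
  ~ (forall i j, i < N -> j < N -> relsat (a i) (b j) <-> j < i).
Proof.
have [k nk] := rk_bounded; exists (2 ^ k) => a b ord; apply: nk.
by apply: (order_rk (a := a) (b := b) (lo := 0)) => // i j; rewrite !add0n; exact: ord.
Qed.

(** Let [P] in [U] have the least rank [k]. Every definable set in [U] has rank at least [k], so an
    instance whose trace on [P] has rank [k] must be in [U]: otherwise the rest of [P] would be in
    [U], of rank [k] too, and [P] would have larger rank. Having rank [k] is a definable condition
    on the parameter. *)
Lemma dfn_type (U : set (set (valuation C (vars sg)))) : UltraFilter U ->
  dfn setT (fun w => U (relsat^~ w)).
Proof.
move=> UU.
have ex : exists k, `[< exists P, [/\ dfn setT P, U P & ~ rk k P] >].
  have [k nk] := rk_bounded; exists k; apply/asboolP; exists setT; split=> //.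
    exact: dfn_top.
  exact: filterT.
case: (ex_minnP ex) => -[|k] /asboolP[P [dP UP nP]] kmin.
  by exfalso; apply: nP; exact: (ultra_ex UU UP).
have all Q : dfn setT Q -> U Q -> rk k Q.
  move=> dQ UQ; apply: contrapT => nQ.
  have /kmin : `[< exists P, [/\ dfn setT P, U P & ~ rk k P] >] by apply/asboolP; exists Q.
  by rewrite ltnn.
have dw w : dfn setT (relsat^~ w) by exact: dfn_rel_l.
have dP' : dfn setT (fun u : valuation C (ctx_sum (vars tau) (vars sg)) =>
      P (vcomp u (fun s z => inr z))).
  exact: dfn_comp.
have dr : dfn setT (fun u : valuation C (ctx_sum (vars tau) (vars sg)) =>
   relsat (vcomp u (fun s z => inr z)) (vcomp u (fun s z => inl z))) by exact: dfn_rel.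
apply: dfn_ext (dfn_rk k (dfn_and dP' dr)) _ => w.
split=> [rw|Uw]; last by apply: (all (P `&` relsat^~ w)); [exact: dfn_and|exact: filterI].
apply: contrapT => /(ultraNE UU) nU; apply: nP; exists w; split; first exact: rw.
by apply: all; [apply: dfn_and => //; exact: dfn_not|exact: filterI].
Qed.

End Bounded.
End Rank.

(** * Invariant extensions over algebraically closed sets *)

Section InvariantTypes.
Variables (L : language) (T : theory L) (C : structure L) (K : Type).
Hypothesis CT : models T C.
Hypothesis EI : elimination_of_imaginaries T.
Hypothesis stab : omega_stable T.
Hypothesis ffK : ~ lec K (fin_formula L).
Hypothesis Csat : saturated C K.
Hypothesis Chom : strongly_homogeneous C K.
Implicit Types (X : ctx L) (Y Z : set (elt C)).

Definition invariant_type Y X (U : set (set (valuation C X))) : Prop :=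
  forall (g : aut C) P, fixes g Y -> dfn setT P -> U P -> U (fun v => P (vmap g v)).

(* Global types are represented by ultrafilters on the set of all valuations,
   of which only the restriction to the definable sets matters. *)
Definition inv_ext Y X (a : valuation C X) (U : set (set (valuation C X))) : Prop :=
  [/\ UltraFilter U, invariant_type Y U & forall P, dfn Y P -> P a -> U P].

Lemma inv_extE Y X (a : valuation C X) U P : inv_ext Y a U -> dfn Y P -> U P <-> P a.
Proof.
move=> [UU _ Ua] dP; split; last exact: Ua.
move=> UP; apply: contrapT => nPa.
by have /(ultraNE UU) := Ua _ (dfn_not dP) nPa.
Qed.

Lemma inv_ext_comp Y X X' (h : ctx_map X' X) (a : valuation C X) U :
  inv_ext Y a U -> inv_ext Y (vcomp a h) [set P | U (fun v => P (vcomp v h))].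
Proof.
move=> [UU Uinv Ua]; split.
- exact: (@ultra_pushforward _ _ (fun v : valuation C X => vcomp v h)).
- by move=> g P fg dP /(Uinv _ _ fg (dfn_comp h dP)).
- by move=> P dP Pa; apply: (Ua _ (dfn_comp h dP)).
Qed.

Lemma dfn_formula Y X (P : set (valuation C X)) : dfn Y P ->
  exists m (tau : 'I_m -> sorts L) (c : valuation C (vars tau))
    (psi : formula (ctx_sum X (vars tau))),
    ran c `<=` Y /\ forall v, P v <-> sat psi (val_sum v c).
Proof.
move=> /dfn_support[n [sg [h [m [tau [b [psi [bY H]]]]]]]].
pose k : ctx_map (ctx_sum (vars sg) (vars tau)) (ctx_sum X (vars tau)) := fun s z =>
  match z with inl x => inl (h s x) | inr y => inr y end.
exists m, tau, (assign b), (rename k psi); split; first by move=> _ [s [[i] ->]]; exact: bY.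
move=> v; rewrite H sat_rename.
set v1 := val_sum _ _; set v2 := vcomp _ _; suff -> : v1 = v2 by [].
by apply: valE => s [].
Qed.

Lemma ultra_list V (U : set (set V)) (A : Type) (F : A -> set V) (l : seq A) :
  UltraFilter U -> U [set v | exists a, List.In a l /\ F a v] ->
  exists a, List.In a l /\ U (F a).
Proof.
move=> UU UF; apply: contrapT => nU.
have : U [set v | forall P, List.In P [seq ~` F a | a <- l] -> P v].
  apply: ultra_In => P /List.in_map_iff[a [<- la]]; apply/(ultraNE UU) => UFa.
  by apply: nU; exists a.
move=> /(filterI UF)/(ultra_ex UU)[v [[a [la Fa]] /(_ (~` F a))]]; apply=> //.
by apply/List.in_map_iff; exists a.
Qed.

Section FiniteExistence.
Variables (Y : set (elt C)) (sY : small K Y) (aclY : acl Y `<=` Y).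
Variables (n : nat) (sg : 'I_n -> sorts L) (a : valuation C (vars sg)).
Let V := valuation C (vars sg).

Definition ideal (I : set (set V)) : Prop :=
  [/\ forall P Q, I P -> Q `<=` P -> I Q,
      forall P Q, I P -> I Q -> I (P `|` Q),
      forall (g : aut C) P, fixes g Y -> I P -> I (fun v => P (vmap g v)) &
      forall P, I P -> dfn Y P -> ~ P a].

Lemma maximal_ideal : exists I, ideal I /\ forall J, I `<` J -> ~ ideal J.
Proof.
apply: Zorn_bigcup => F FI Ftot; split.
- by move=> P Q [I FIi IP] QP; exists I => //; have [h _ _ _] := FI _ FIi; exact: h IP QP.
- move=> P Q [I FIi IP] [J FJ JQ].
  case: (Ftot _ _ FIi FJ) => [/(_ _ IP) JP|/(_ _ JQ) IQ].
    by exists J => //; have [_ h _ _] := FI _ FJ; exact: h.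
  by exists I => //; have [_ h _ _] := FI _ FIi; exact: h.
- by move=> g P fg [I FIi IP]; exists I => //; have [_ _ h _] := FI _ FIi; exact: h.
- by move=> P [I FIi IP] dP; have [_ _ _ h] := FI _ FIi; exact: h.
Qed.

(* [theta] is covered, modulo a maximal invariant ideal [I0], by finitely many
   conjugates of a set [phi] that no definable set splits modulo [I0]. *)
Lemma finite_cover : exists (I0 : set (set V)) (phi theta : set V) (l : seq (aut C)),
  [/\ [/\ forall P Q, I0 P -> I0 Q -> I0 (P `|` Q),
      forall (g : aut C) P, fixes g Y -> I0 P -> I0 (fun v => P (vmap g v)),
      forall P Q, I0 P -> Q `<=` P -> I0 Q & forall P, I0 P -> dfn Y P -> ~ P a],
      I0 set0,
      [/\ dfn Y theta, theta a, forall g, List.In g l -> fixes g Y &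
        exists i, I0 i /\ theta `<=` i `|` [set v | exists g, List.In g l /\ phi (vmap g v)]] &
      forall Q, dfn setT Q -> I0 (phi `&` Q) \/ I0 (phi `&` ~` Q)].
Proof.
have [I [[I1 I2 I3 I4] Imax]] := maximal_ideal.
(* The empty set is adjoined because the empty family, the union of the empty chain, also counts as
   an [ideal]. *)
pose I0 : set (set V) := [set P | I P \/ P `<=` set0].
have I01 P Q : I0 P -> Q `<=` P -> I0 Q.
  move=> [IP|P0] QP; [left; exact: I1 QP|right; exact: subset_trans P0].
have I02 P Q : I0 P -> I0 Q -> I0 (P `|` Q).
  move=> [IP|P0] [IQ|Q0]; [left; exact: I2|left|left|right].
  - by apply: (I1 _ _ IP) => v [//|/Q0].
  - by apply: (I1 _ _ IQ) => v [/P0|//].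
  - by move=> v [/P0|/Q0].
have I03 (g : aut C) P : fixes g Y -> I0 P -> I0 (fun v => P (vmap g v)).
  by move=> fg [IP|P0]; [left; exact: I3|right => v /P0].
have I04 P : I0 P -> dfn Y P -> ~ P a by move=> [IP|P0] dP; [exact: I4|move=> /P0].
(* Without an unsplit [phi], the nonempty definable sets outside the ideal would form a splitting
   tree. *)
have [phi [dphi phine nIphi phimin]] : exists phi : set V, [/\ dfn setT phi, exists v, phi v, ~ I phi &
    forall Q, dfn setT Q -> I0 (phi `&` Q) \/ I0 (phi `&` ~` Q)].
  apply: contrapT => nphi.
  apply: (no_tree CT stab (cls := [set P : set V | [/\ dfn setT P, exists v, P v & ~ I P]])).
  - by move=> P [].
  - move=> P [dP Pne nIP]; apply: contrapT => nQ; apply: nphi; exists P; split=> // Q dQ.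
    apply: contrapT => /not_orP[n1 n2]; apply: nQ; exists Q; split=> //.
      split; [exact: dfn_and| |by move=> IPQ; apply: n1; left].
      by apply: contrapT => nv; apply: n1; right => v PQv; apply: nv; exists v.
    split; [apply: dfn_and => //; exact: dfn_not| |by move=> IPQ; apply: n2; left].
    by apply: contrapT => nv; apply: n2; right => v PQv; apply: nv; exists v.
  - exists setT; split; [exact: dfn_top|by exists a|].
    by move=> /I4; apply=> //; exact: dfn_top.
pose cov (l : seq (aut C)) : set V := [set v | exists g, List.In g l /\ phi (vmap g v)].
(* [I'] adds the conjugates of [phi] over [Y] to the ideal. It is strictly larger, hence not an
   [ideal], and only the clause on [a] can fail: this yields [theta]. *)
pose I' : set (set V) := [set P | exists i l, [/\ I0 i, forall g, List.In g l -> fixes g Y &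
   P `<=` i `|` cov l]].
have : exists theta, [/\ I' theta, dfn Y theta & theta a].
  apply: contrapT => nth.
  apply: (Imax I').
    split.
      move=> P IP; exists P, [::]; split=> [|g []|v]; by left.
    move=> /(_ phi) h; apply: nIphi; apply: h.
    exists set0, [:: aut_id C]; split; first by right.
      by move=> g [<-|[]].
    by move=> v phiv; right; exists (aut_id C); split=> //; left.
  split.
  - by move=> P Q [i [l [I0i fl Pil]]] QP; exists i, l; split=> //; exact: subset_trans Pil.
  - move=> P Q [i [l [I0i fl Pil]]] [j [k [I0j fk Qjk]]].
    exists (i `|` j), (l ++ k); split; first exact: I02.
      by move=> g /List.in_app_iff[/fl|/fk].
    move=> v [/Pil[iv|[g [lg pg]]]|/Qjk[jv|[g [lg pg]]]].
    + by left; left.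
    + by right; exists g; split=> //; apply/List.in_app_iff; left.
    + by left; right.
    + by right; exists g; split=> //; apply/List.in_app_iff; right.
  - move=> g P fg [i [l [I0i fl Pil]]].
    exists (fun v => i (vmap g v)), [seq aut_comp h g | h <- l]; split; first exact: I03.
      by move=> h /List.in_map_iff[h' [<- /fl fh]]; exact: fixes_comp.
    move=> v /Pil[iv|[h [lh ph]]]; first by left.
    by right; exists (aut_comp h g); split=> //; apply/List.in_map_iff; exists h.
  - by move=> P I'P dP Pa; apply: nth; exists P.
move=> [theta [[i [l [I0i fl th]]] dth tha]].
exists I0, phi, theta, l; split=> //; first by right.
by split=> //; exists i.
Qed.

(* The type given by [finite_cover] has finitely many conjugates over [Y], so the
   codes of its definitions are algebraic over [Y], hence lie in [Y]. *)
Lemma exists_inv_ext_fin : exists U, inv_ext Y a U.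
Proof.
have [I0 [phi [theta [l [[I02 I03 I01 I04] I00 [dth tha fl [i [I0i thc]]] phimin]]]]] := finite_cover.
have [|U [UU BU]] := @ultra_fip V [set P | (dfn Y P /\ P a) \/ I0 (~` P)].
  move=> lB HB.
  have [P [j [dP Pa I0j Hl]]] : exists P j, [/\ dfn Y P, P a, I0 j &
      forall v, P v -> ~ j v -> forall Q, List.In Q lB -> Q v].
    elim: lB HB => [|Q r IH] HB.
      by exists setT, set0; split=> //; exact: dfn_top.
    have [|P [j [dP Pa I0j Hr]]] := IH; first by move=> R rR; apply: HB; right.
    have [[dQ Qa]|I0Q] := HB Q (or_introl erefl).
      exists (P `&` Q), j; split=> //; first exact: dfn_and.
      by move=> v [Pv Qv] jv R [<-//|]; exact: Hr.
    exists P, (j `|` ~` Q); split=> //; first exact: I02.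
    move=> v Pv /not_orP[jv /contrapT Qv] R [<-//|]; exact: Hr.
  apply: contrapT => nv; apply: (I04 P) => //; apply: (I01 _ _ I0j) => v Pv.
  by apply: contrapT => jv; apply: nv; exists v; exact: Hl.
have UI P : I0 P -> U (~` P) by move=> I0P; apply: BU; right; rewrite setCK.
pose ok (W : set (set V)) := [/\ UltraFilter W, forall P, I0 P -> W (~` P) & W theta].
have okU : ok U by split=> //; apply: BU; left.
have okg W : ok W -> exists g, List.In g l /\ W (fun v => phi (vmap g v)).
  move=> [WU WI Wth]; apply: (@ultra_list V W _ (fun (g : aut C) v => phi (vmap g v)) l WU).
  by apply: filterS (filterI Wth (WI _ I0i)) => v [/thc[//|h] _].
(* A type containing a conjugate of [phi] is determined by it modulo [I0], as no definable set
   splits that conjugate. *)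
have okE W g Q : ok W -> fixes g Y -> W (fun v => phi (vmap g v)) -> dfn setT Q ->
    W Q <-> I0 ((fun v => phi (vmap g v)) `&` ~` Q).
  move=> [WU WI Wth] fg Wg dQ; split=> [WQ|IQ].
    have dQ' : dfn setT (fun v => Q (vmap (aut_inv g) v)) by exact: dfn_vmap dQ _ _.
    have [h|h] := phimin _ dQ'; last first.
      by apply: (I01 _ _ (I03 _ _ fg h)) => v [pv nQ]; split=> //=; rewrite /setC /= vmapK.
    have /WI/(filterI (filterI Wg WQ))/(ultra_ex WU)[v [[pv Qv]]] := I03 _ _ fg h.
    by case; split=> //=; rewrite vmapK.
  apply: filterS (filterI Wg (WI _ IQ)) => v [pv nv]; apply: contrapT => nQ.
  exact: nv.
pose Uk (k : aut C) : set (set V) := [set P | U (fun v => P (vmap k v))].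
have okk k : fixes k Y -> ok (Uk k).
  move=> fk; split.
  - exact: (@ultra_pushforward _ _ (@vmap _ C k (vars sg))).
  - by move=> P I0P; have := UI _ (I03 _ _ fk I0P).
  - have [_ _ Uth] := okU.
    by apply: (@filterS _ U _ _ _ _ Uth) => v thv; apply/(dfn_fixes v dth fk).
exists U; split=> //; last by move=> P dP Pa; apply: BU; left.
move=> g P fg dP UP.
have [m [tau [c [psi [_ HP]]]]] := dfn_formula dP.
pose D w := U ((relsat psi)^~ w).
have dD : dfn setT D by apply: (dfn_type psi CT stab ffK Csat).
have DUk k w : D (vmap (aut_inv k) w) <-> Uk k ((relsat psi)^~ w).
  rewrite /D; suff -> : (relsat psi)^~ (vmap (aut_inv k) w) = fun v => relsat psi (vmap k v) w by [].
  by apply/funext => v; apply/propext; rewrite -(rel_aut psi k) vmapKV.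
have [m' [rho [b Hb]]] := code CT EI dD.
have bY : ran b `<=` Y.
  (* The image [vmap k b] depends only on an [h] in [l] whose conjugate of [phi] belongs to the type
     [Uk k]; so [l] bounds the number of images. *)
  have Hc (h : aut C) : {w | List.In h l -> forall k, fixes k Y ->
      Uk k (fun v => phi (vmap h v)) -> vmap k b = w}.
    apply: cid; have [[k0 [f0 U0]]|nk] :=
        pselect (exists k, fixes k Y /\ Uk k (fun v => phi (vmap h v))).
      exists (vmap k0 b) => lh k fk Ukh.
      rewrite -[LHS](vmapKV k0); congr (vmap k0 _).
      apply/(Hb (aut_comp (aut_inv k0) k)) => w.
      have -> : vmap (aut_comp (aut_inv k0) k) w = vmap (aut_inv k0) (vmap k w) by [].
      rewrite -[w in X in X <-> _](vmapK k) !DUk.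
      have dr : dfn setT ((relsat psi)^~ (vmap k w)) by exact: dfn_rel_l.
      by rewrite (okE _ _ _ (okk _ fk) (fl _ lh) Ukh dr) (okE _ _ _ (okk _ f0) (fl _ lh) U0 dr).
    by exists b => lh k fk Uk'; case: nk; exists k.
  have Hl k : fixes k Y -> List.In (vmap k b) [seq proj1_sig (Hc h) | h <- l].
    move=> fk; have [h [lh Uh]] := okg _ (okk k fk).
    apply/List.in_map_iff; exists h; split=> //.
    exact/esym/(proj2_sig (Hc h)).
  move=> _ [s [x ->]]; apply: aclY.
  apply: (orbit_acl ffK Csat Chom (l := [seq w s x | w <- [seq proj1_sig (Hc h) | h <- l]])) => // k fk.
  by apply/List.in_map_iff; exists (vmap k b); split=> //; exact: Hl.
have Dinv : D c <-> D (vmap (aut_inv g) c).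
  have bg : vmap (aut_inv g) b = b.
    by apply/vmap_fixes; apply: fixes_sub bY _; exact: fixes_inv.
  exact: (Hb (aut_inv g)).2 bg c.
have PE : P = (relsat psi)^~ c by apply/funext => v; apply/propext; exact: HP.
by rewrite PE; apply: (DUk g c).1; apply/Dinv; rewrite /D -PE.
Qed.

End FiniteExistence.

Lemma inv_ext_transport Y X (a a' : valuation C X) U : inv_ext Y a U ->
  (forall P, dfn Y P -> P a -> P a') -> inv_ext Y a' U.
Proof.
move=> [UU Ui Ua] aa'; split=> // P dP Pa'; apply: Ua => //.
by apply: contrapT => nPa; exact: (aa' _ (dfn_not dP) nPa).
Qed.

Section Symmetry.
Variables (n m : nat) (sg : 'I_n -> sorts L) (tau : 'I_m -> sorts L).
Variable psi : formula (ctx_sum (vars sg) (vars tau)).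

Lemma inv_rel_conj Y U (g : aut C) w : UltraFilter U -> invariant_type Y U -> fixes g Y ->
  U ((relsat psi)^~ w) -> U ((relsat psi)^~ (vmap g w)).
Proof.
move=> UU Ui fg Uw.
have dw : dfn setT ((relsat psi)^~ w) by exact: dfn_rel_l.
apply: filterS (Ui _ _ (fixes_inv fg) dw Uw) => v h.
by rewrite -[v](vmapKV g); apply/rel_aut.
Qed.

Lemma inv_rel_conjr Y (R : set (set (valuation C (vars tau)))) (g : aut C) v :
  UltraFilter R -> invariant_type Y R -> fixes g Y ->
  R (~` relsat psi v) -> R (~` relsat psi (vmap g v)).
Proof.
move=> RR Ri fg Rv.
have dv : dfn setT (~` relsat psi v) by apply: dfn_not; exact: dfn_rel_r.
apply: filterS (Ri _ _ (fixes_inv fg) dv Rv) => w nr; apply: contra_not nr => h.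
by apply/(rel_aut psi g); rewrite vmapKV.
Qed.

(* If the conclusion failed, alternately realizing [U] and [R] would produce an
   infinite sequence ordered by [psi]. *)
Lemma harrington Y (a : valuation C (vars sg)) (b : valuation C (vars tau)) U R :
  small K Y -> inv_ext Y a U -> inv_ext Y b R ->
  U ((relsat psi)^~ b) -> R (relsat psi a).
Proof.
move=> sY nU nR Ub; apply: contrapT => nRa.
have [UU Ui Ua] := nU; have [RR Ri Rb] := nR.
have Ra : R (~` relsat psi a) by apply/(ultraNE RR).
have svg : smallx K (vars sg) by exact: smallx_vars.
have svt : smallx K (vars tau) by exact: smallx_vars.
pose VW := (valuation C (vars sg) * valuation C (vars tau))%type.
pose fix prm (l : seq VW) : set (elt C) :=
  if l is (v, w) :: l' then prm l' `|` (ran v `|` ran w) else Y.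
(* [w] realizes [R] over the earlier points and also over its partner [v]; this asymmetry makes the
   resulting order strict. *)
pose fix good (l : seq VW) : Prop := if l is (v, w) :: l' then
   [/\ good l', forall P, dfn (prm l') P -> U P -> P v &
       forall Q, dfn (prm l' `|` ran v) Q -> R Q -> Q w] else True.
have sprm l : small K (prm l).
  elim: l => //= -[v w] l IH.
  by apply: (smallU ffK) => //; apply: (smallU ffK); exact: small_ran.
have [|f Hf] := @dependent_choice_hist VW good I.
  move=> l gl.
  have [v Hv] := realize ffK Csat (sprm l) svg UU.
  have [w Hw] := realize ffK Csat (smallU ffK (sprm l) (small_ran (v := v) svg)) svt RR.
  by exists (v, w).
have Yprm l : Y `<=` prm l by elim: l => //= -[v w] l IH e Ye; left; exact: IH.
have prmS j i : j < i -> ran (f j).1 `|` ran (f j).2 `<=` prm (hist f i).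
  elim: i => //= i IH; rewrite ltnS leq_eqVlt; case E : (f i) => [v w].
  move=> /orP[/eqP ->|/IH h]; first by rewrite E => e h; right.
  by move=> e /h h'; left.
have gf i : [/\ forall P, dfn (prm (hist f i)) P -> U P -> P (f i).1 &
    forall Q, dfn (prm (hist f i) `|` ran (f i).1) Q -> R Q -> Q (f i).2].
  by have := Hf i.+1; rewrite /=; case: (f i) => v w [].
have ac i : exists g : aut C, fixes g Y /\ vmap g a = (f i).1.
  apply: (hom_vmap ffK Chom) => // P dP Pa; have [h _] := gf i; apply: h; last exact: Ua.
  exact: dfn_mono dP.
have bc i : exists g : aut C, fixes g Y /\ vmap g b = (f i).2.
  apply: (hom_vmap ffK Chom) => // P dP Pb; have [_ h] := gf i; apply: h; last exact: Rb.
  by apply: dfn_mono dP => e Ye; left; exact: Yprm.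
have [N noN] := no_order psi CT stab ffK Csat.
apply: (noN (fun i => (f i).1) (fun i => (f i).2)) => i j _ _.
split=> [rij|ji].
  rewrite ltnNge; apply/negP => ij.
  have [_ h] := gf j.
  have [g [fg ga]] := ac i.
  have Rai : R (~` relsat psi (f i).1) by rewrite -ga; exact: (inv_rel_conjr RR Ri fg Ra).
  have : (~` relsat psi (f i).1) (f j).2; last by [].
  apply: h => //; apply: dfn_not; apply: dfn_rel_r.
  move: ij; rewrite leq_eqVlt => /orP[/eqP<-|/prmS ij] e re; first by right.
  by left; apply: ij; left.
have [h _] := gf i.
have [g [fg gb]] := bc j.
apply: (h ((relsat psi)^~ (f j).2)); last by rewrite -gb; exact: (inv_rel_conj UU Ui fg Ub).
by apply: dfn_rel_l => e re; apply: (prmS j i ji); right.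
Qed.

End Symmetry.

Definition swap n m (sg : 'I_n -> sorts L) (tau : 'I_m -> sorts L)
    (psi : formula (ctx_sum (vars sg) (vars tau))) : formula (ctx_sum (vars tau) (vars sg)) :=
  rename (fun s z => match z with inl x => inr x | inr y => inl y end) psi.

Lemma rel_swap n m (sg : 'I_n -> sorts L) (tau : 'I_m -> sorts L)
    (psi : formula (ctx_sum (vars sg) (vars tau))) (v : valuation C (vars sg)) w :
  relsat (swap psi) w v <-> relsat psi v w.
Proof.
rewrite /relsat /swap sat_rename.
set v1 := vcomp _ _; set v2 := val_sum _ _; suff -> : v1 = v2 by [].
by apply: valE => s [].
Qed.

(** The converse is the same implication with the roles of the two tuples exchanged. *)
Lemma harrington_iff n m (sg : 'I_n -> sorts L) (tau : 'I_m -> sorts L)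
    (psi : formula (ctx_sum (vars sg) (vars tau))) Y a b
    (U : set (set (valuation C (vars sg)))) (R : set (set (valuation C (vars tau)))) :
  small K Y -> inv_ext Y a U -> inv_ext Y b R ->
  U ((relsat psi)^~ b) <-> R (relsat psi a).
Proof.
move=> sY nU nR; split=> [|Ra]; first exact: (harrington sY nU nR).
have E1 : relsat psi a = (relsat (swap psi))^~ a.
  by apply/funext => w; apply/propext; rewrite rel_swap.
have E2 : (relsat psi)^~ b = relsat (swap psi) b.
  by apply/funext => w; apply/propext; rewrite rel_swap.
by rewrite E2; apply: (harrington sY nR nU); rewrite -E1.
Qed.

Section Uniqueness.
Variables (Y : set (elt C)) (sY : small K Y) (aclY : acl Y `<=` Y).

(** By symmetry, whether [psi(x, b)] belongs to an extension of the type of [a] is read off from one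
    fixed extension [R] of the type of [b], which depends neither on [U] nor on [U']. *)
Lemma inv_ext_unique X (a : valuation C X) U U' P :
  inv_ext Y a U -> inv_ext Y a U' -> dfn setT P -> U P -> U' P.
Proof.
move=> nU nU' dP.
have [n [sg [h [m [tau [b [psi [_ HP]]]]]]]] := dfn_support dP.
have E : P = fun v => relsat psi (vcomp v h) (assign b).
  by apply/funext => v; apply/propext; exact: HP.
have [R nR] := exists_inv_ext_fin sY aclY (assign b).
have := harrington_iff psi sY (inv_ext_comp h nU) nR.
have := harrington_iff psi sY (inv_ext_comp h nU') nR.
by rewrite E => -[_ h2] [h1 _] /h1/h2.
Qed.

Lemma exists_inv_ext_covered X (a : valuation C X) (l : seq {s & X s}) :
  (forall s (x : X s), List.In (existT X s x) l) -> exists U, inv_ext Y a U.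
Proof.
move=> lX; have [n [sg [h hl]]] := list_vars l.
have r s (x : X s) : {z | h s z = x} by apply: cid; apply: hl.
have [U nU] := exists_inv_ext_fin sY aclY (vcomp a h).
exists [set P | U (fun v => P (vcomp v (fun s x => proj1_sig (r s x))))].
have := inv_ext_comp (fun s x => proj1_sig (r s x)) nU.
by rewrite (_ : vcomp _ _ = a) //; apply: valE => s x; rewrite /vcomp (proj2_sig (r s x)).
Qed.

Lemma exists_inv_ext_subc X (l : seq {s & X s}) (a : valuation C (subc l)) :
  exists U, inv_ext Y a U.
Proof.
have H i : List.In (existT X (projT1 (tnth (in_tuple l) i)) (projT2 (tnth (in_tuple l) i))) l.
  by have := tnth_In i; case: (tnth _ _).
pose e i : {s & subc l s} := existT (subc l) _
  (exist (fun x => List.In (existT X _ x) l) _ (H i)).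
apply: (@exists_inv_ext_covered (subc l) a [seq e i | i <- enum 'I_(size l)]) => s [x lx].
have [i ei] := In_nth lx.
apply/List.in_map_iff; exists i; split; last by apply/mem_In; rewrite mem_enum.
rewrite /e; move: (H i); rewrite ei /= => lx'; congr existT; exact: sig_inj.
Qed.

(** The restriction exists for every list containing [l], so that finitely many definable sets can
    be restricted to a common one. *)
Lemma dfn_restrict Z X (P : set (valuation C X)) : dfn Z P ->
  exists l : seq {s & X s}, forall l', (forall z, List.In z l -> List.In z l') ->
    exists P', dfn Z P' /\ forall v, P v <-> P' (vcomp v (@subc_val _ X l')).
Proof.
move=> /dfn_support[n [sg [h [m [tau [b [psi [bZ H]]]]]]]].
exists [seq existT X _ (h _ (var_at sg i)) | i <- enum 'I_n] => l' ll'.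
have hl s (z : vars sg s) : List.In (existT X s (h s z)) l'.
  apply: ll'; case: z => i; apply/List.in_map_iff; exists i; split=> //.
  by apply/mem_In; rewrite mem_enum.
exists (fun u => sat psi (val_sum (vcomp u (fun s z => exist _ (h s z) (hl s z))) (assign b))).
split=> //.
have d := @dfn_instance _ _ (vars sg) _ _ b psi Z bZ.
exact: (dfn_comp (fun s z => exist _ (h s z) (hl s z) : subc l' s) d).
Qed.

(* [B] consists of the definable sets that belong to the invariant extensions of
   all sufficiently large finite parts of [a]; uniqueness for finite tuples makes
   it contain every definable set or its complement. *)
Lemma exists_inv_ext X (a : valuation C X) : exists U, inv_ext Y a U.
Proof.
pose ar (l : seq {s & X s}) := vcomp a (@subc_val _ X l).
pose B := [set P : set (valuation C X) | dfn setT P /\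
  exists l : seq {s & X s}, forall l', (forall z, List.In z l -> List.In z l') ->
    exists P', [/\ dfn setT P', forall v, P v <-> P' (vcomp v (@subc_val _ X l')) &
      forall U, inv_ext Y (ar l') U -> U P']].
have [|U [UU BU]] := @ultra_fip _ B.
  move=> lB HB.
  have [l Hl] : exists l : seq {s & X s}, forall P, List.In P lB ->
    exists P', [/\ dfn setT P', forall v, P v <-> P' (vcomp v (@subc_val _ X l)) &
      forall U, inv_ext Y (ar l) U -> U P'].
    suff [l Hl] : exists l : seq {s & X s}, forall l', (forall z, List.In z l -> List.In z l') ->
      forall P, List.In P lB ->
      exists P', [/\ dfn setT P', forall v, P v <-> P' (vcomp v (@subc_val _ X l')) &
      forall U, inv_ext Y (ar l') U -> U P'] by exists l => P; exact: Hl.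
    elim: lB HB => [|Q r IH] HB; first by exists [::].
    have [|l Hl] := IH; first by move=> R rR; apply: HB; right.
    have [_ [k Hk]] := HB Q (or_introl erefl).
    exists (l ++ k) => l' ll' R [<-|].
      by apply: Hk => z kz; apply: ll'; apply/List.in_app_iff; right.
    by apply: Hl => z kz; apply: ll'; apply/List.in_app_iff; left.
  have [U nU] := exists_inv_ext_subc (ar l); have [UU _ _] := nU.
  pose e (u : valuation C (subc l)) : valuation C X := fun s x =>
    match pselect (List.In (existT X s x) l) with
    | left p => u s (exist _ x p) | right _ => a s x end.
  have eE u : vcomp (e u) (@subc_val _ X l) = u.
    apply: valE => s [x lx]; rewrite /vcomp /e /=; case: pselect => // p.
    by congr (u s _); exact: sig_inj.
  have : U [set u | forall Q, List.In Q [seq [set u | P (e u)] | P <- lB] -> Q u].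
    apply: ultra_In => Q /List.in_map_iff[P [<- lP]].
    have [P' [_ HP' /(_ _ nU) UP']] := Hl P lP.
    by apply: filterS UP' => u P'u; apply/HP'; rewrite eE.
  move=> /(ultra_ex UU)[u Hu]; exists (e u) => P lP; apply: (Hu [set u | P (e u)]).
  by apply/List.in_map_iff; exists P.
(* By uniqueness one finite part decides membership: an extension for a larger part restricts to the
   extension for the smaller one. *)
have Bl (P : set (valuation C X)) l (P' : set (valuation C (subc l))) U0 :
    dfn setT P -> dfn setT P' -> (forall v, P v <-> P' (vcomp v (@subc_val _ X l))) ->
    inv_ext Y (ar l) U0 -> U0 P' -> B P.
  move=> dP dP' HP' nU0 U0P'; split=> //; exists l => l' ll'.
  exists (fun u => P' (vcomp u (subc_incl ll'))); split.
  - exact: dfn_comp.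
  - by move=> v; rewrite HP'.
  - move=> U1 /(inv_ext_comp (subc_incl ll')) nU1.
    exact: (inv_ext_unique nU0 nU1 dP' U0P').
have Bdich P : dfn setT P -> B P \/ B (~` P).
  move=> dP; have [l /(_ l (fun z => id)) [P' [dP' HP']]] := dfn_restrict dP.
  have [U0 nU0] := exists_inv_ext_subc (ar l); have [UU0 _ _] := nU0.
  have [U0P'|nU0P'] := pselect (U0 P'); first by left; exact: Bl nU0 U0P'.
  right; apply: (Bl _ l (~` P') U0); [exact: dfn_not|exact: dfn_not| |by []|exact/(ultraNE UU0)].
  by move=> v; split=> n; apply: contra_not n; apply HP'.
exists U; split=> //.
  move=> g P fg dP UP.
  have [[_ [l Hl]]|/BU/(ultraNE UU)//] := Bdich P dP.
  apply: BU; split; first exact: dfn_vmap dP _ _.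
  exists l => l' /Hl[P' [dP' HP' UP']].
  exists (fun u => P' (vmap g u)); split.
  - exact: dfn_vmap dP' _ _.
  - by move=> v; rewrite HP'.
  - by move=> U0 nU0; have [_ Ui _] := nU0; apply: Ui => //; exact: UP'.
move=> P dP Pa; apply: BU; split; first exact: dfn_mono dP.
have [l Hl] := dfn_restrict dP; exists l => l' /Hl[P' [dP' HP']].
exists P'; split=> //; first exact: dfn_mono dP'.
by move=> U0 nU0; apply/(inv_extE nU0 dP'); apply/HP'.
Qed.

End Uniqueness.
End InvariantTypes.

(** * Stationary types *)

(** The enumeration decreases because Morley sequences are listed with the newest entry first. *)
Lemma decreasing_enum (S : set nat) k : S #= `I_k ->
  exists s : seq nat, [/\ sorted gtn s, size s = k & forall i, i \in s -> S i].
Proof.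
rewrite card_eq_le => /andP[_ /card_leE[g gi]].
pose t := [seq proj1_sig (g (exist (fun x => `I_k x) (val i) (ltn_ord i))) | i : 'I_k <- enum 'I_k].
exists (sort geq t); split.
- rewrite gtn_sorted_uniq_geq sort_uniq sort_sorted ?andbT; last by move=> x y; exact: leq_total.
  rewrite map_inj_uniq ?enum_uniq // => i j /sig_inj/gi [] ij; exact: val_inj.
- by rewrite size_sort size_map size_enum_ord.
- by move=> i; rewrite mem_sort => /mapP[j _ ->]; exact: proj2_sig.
Qed.

Section Stationarity.
Variables (L : language) (T : theory L) (C : structure L) (K : Type).
Hypothesis CT : models T C.
Hypothesis EI : elimination_of_imaginaries T.
Hypothesis stab : omega_stable T.
Hypothesis ffK : ~ lec K (fin_formula L).
Hypothesis Csat : saturated C K.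
Hypothesis Chom : strongly_homogeneous C K.
Implicit Types (X : ctx L) (Y Z : set (elt C)).

(** * Dividing along Morley sequences *)

Section Dividing.
Variables (n m : nat) (sg : 'I_n -> sorts L) (tau : 'I_m -> sorts L).
Variable psi : formula (ctx_sum (vars sg) (vars tau)).
Variables (N Y : set (elt C)) (NY : N `<=` Y) (sY : small K Y).
Variables (d : valuation C (vars sg)) (b : valuation C (vars tau)).
Variable R : set (set (valuation C (vars tau))).
Hypothesis nR : inv_ext Y b R.
(** In terms of types: the type of [d] over [N] implies its type over [Y], which will be [acl N]. *)
Hypothesis dN : forall a, (forall P, dfn N P -> P d -> P a) ->
  exists g : aut C, fixes g Y /\ vmap g d = a.
Hypothesis Rd : ~ R (relsat psi d).

Fixpoint prm (l : seq (valuation C (vars tau))) : set (elt C) :=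
  if l is w :: l' then prm l' `|` ran w else Y.

Fixpoint morley (l : seq (valuation C (vars tau))) : Prop :=
  if l is w :: l' then morley l' /\ forall Q, dfn (prm l') Q -> R Q -> Q w else True.

Lemma small_prm l : small K (prm l).
Proof.
elim: l => //= w l IH; apply: (smallU ffK) => //; apply: small_ran; exact: smallx_vars.
Qed.

Lemma prm_Y l : Y `<=` prm l.
Proof. by elim: l => //= w l IH e /IH; left. Qed.

Lemma prm_In l w : List.In w l -> ran w `<=` prm l.
Proof. by elim: l => //= w' l IH [->|/IH h] e we; [right|left; exact: h]. Qed.

Lemma prm_sub l Z : Y `<=` Z -> (forall w, List.In w l -> ran w `<=` Z) -> prm l `<=` Z.
Proof.
move=> YZ; elim: l => //= w l IH H e [|we]; last by apply: (H w) => //; left.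
by apply: IH => w' lw'; apply: H; right.
Qed.

Lemma act_prm (g : aut C) l e : fixes g Y -> prm l e -> prm (map (@vmap _ C g _) l) (act g e).
Proof.
move=> fg; elim: l => /= [Ye|w l IH [/IH|[s [x ->]]]]; first by rewrite (fixes_act fg).
  by left.
by right; exists s, x.
Qed.

(** All Morley sequences of an invariant type with the same length have the same type over [Y]: once
    [g] has matched the tails, invariance makes both heads realize [R] over the common tail. *)
Lemma morley_conj l l' : morley l -> morley l' -> size l = size l' ->
  exists g : aut C, fixes g Y /\ map (@vmap _ C g _) l = l'.
Proof.
have [RR Ri _] := nR.
elim: l l' => [|w l IH] [|w' l'] //=; first by exists (aut_id C).
move=> [ml Hw] [ml' Hw'] [] /(IH _ ml ml')[g [fg gl]].
have gw Q : dfn (prm l') Q -> R Q -> Q (vmap g w).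
  move=> dQ RQ; apply: (Hw (fun v => Q (vmap g v))).
    apply: (dfn_vmap dQ) => e pe; first by rewrite -gl; exact: act_prm.
    have := act_prm (fixes_inv fg) pe; rewrite -gl -map_comp.
    rewrite (eq_map (g := id)) ?map_id // => v; exact: vmapK.
  by apply: Ri => //; apply: dfn_mono dQ.
have [|||h [fh hw]] := hom_vmap ffK Chom (Y := prm l') (v := vmap g w) (w := w') _ _ _.
- exact: small_prm.
- exact: smallx_vars.
- move=> Q dQ Qgw; apply: Hw' => //; apply: contrapT => /(ultraNE RR) nRQ.
  exact: (gw _ (dfn_not dQ) nRQ).
exists (aut_comp h g); split; first by apply: fixes_comp => //; apply: fixes_sub fh; exact: prm_Y.
rewrite -hw; congr cons; rewrite -[RHS]gl.
have : forall v, List.In v l -> vmap h (vmap g v) = vmap g v.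
  move=> v lv; apply/vmap_fixes; apply: fixes_sub fh; apply: prm_In.
  by rewrite -gl; apply/List.in_map_iff; exists v.
by elim: (l) => //= v r IHr H; rewrite -[in RHS](H v (or_introl erefl)) IHr // => u ru; apply: H; right.
Qed.

Lemma realize_over Z : small K Z -> exists w, forall Q, dfn Z Q -> R Q -> Q w.
Proof.
move=> sZ; have [RR _ _] := nR.
by apply: (realize ffK Csat sZ) => //; exact: smallx_vars.
Qed.

Lemma morley_sequence : exists f, forall k, morley (hist f k).
Proof.
apply: (@dependent_choice_hist _ morley) => // l ml.
have [w Hw] := realize_over (small_prm (l := l)).
by exists w.
Qed.

Lemma morley_subseq f s : (forall k, morley (hist f k)) -> sorted gtn s -> morley (map f s).
Proof.
move=> mf; elim: s => //= i s IH; rewrite path_sortedE; last first.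
  by move=> x y z /= h1 h2; exact: ltn_trans h2 h1.
move=> /andP[/allP lti /IH ms]; split=> // Q dQ.
have [_ H] := mf i.+1; apply: H; apply: dfn_mono dQ; apply: prm_sub; first exact: prm_Y.
move=> w /List.in_map_iff[j [<- /mem_In/lti ji]]; apply: prm_In; exact: hist_In.
Qed.

(* A formula [psi x b] that is not in the invariant extension of the type of [d]
   divides over [N] together with a formula [P] of that type: if it were
   consistent along a Morley sequence in the type of [b], that sequence could be
   interleaved with realizations of the type of [d] so as to be ordered by [psi]. *)
Lemma dividing_family : exists (k : nat) (P : set (valuation C (vars sg))) (g : nat -> aut C),
  [/\ dfn N P, P d, forall i, fixes (g i) Y &
      forall S : set nat, S #= `I_k ->
        ~ exists u, forall i, S i -> P u /\ relsat psi u (vmap (g i) b)].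
Proof.
have [RR Ri Rb] := nR.
have [k nok] := no_order psi CT stab ffK Csat.
have [f mf] := morley_sequence.
have fb i : {g : aut C | fixes g Y /\ vmap g b = f i}.
  apply: cid; apply: (hom_vmap ffK Chom) => //; first exact: smallx_vars.
  move=> P dP Pb; have [_ H] := mf i.+1; apply: H; last exact: Rb.
  by apply: dfn_mono dP; exact: prm_Y.
apply: contrapT => nex.
(* If nothing divides, some [k] terms of the sequence [f] have a common [u]; a Morley list of length
   at most [k] is conjugate over [Y] to a part of these terms. *)
have stepA l P : morley l -> size l <= k -> dfn N P -> P d ->
    exists u, P u /\ forall w, List.In w l -> relsat psi u w.
  move=> ml lk dP Pd.
  have [S [Sk [u Hu]]] : exists S : set nat, S #= `I_k /\
      exists u, forall i, S i -> P u /\ relsat psi u (f i).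
    apply: contrapT => nS; apply: nex.
    exists k, P, (fun i => proj1_sig (fb i)); split=> // [i|S Sk [u Hu]].
      by have [] := proj2_sig (fb i).
    apply: nS; exists S; split=> //; exists u => i /Hu.
    by have [_ ->] := proj2_sig (fb i).
  have [s [ss sk sS]] := decreasing_enum Sk.
  (* For [k = 0] the set [S] is empty and says nothing about [u], so [d] itself is taken. *)
  have [k0|k_gt0] := posnP k.
    exists d; split=> // w; have : size l = 0 by lia.
    by move/size0nil => ->.
  have Pu : P u.
    case: s sk sS {ss} => [|i s _ sS]; first by move=> /=; lia.
    by have [] := Hu i (sS i (mem_head _ _)).
  pose s' := drop (k - size l) s.
  have ss' : sorted gtn s' by exact: drop_sorted.
  have [|g [fg gl]] := morley_conj (morley_subseq mf ss') ml.
    by rewrite size_map size_drop sk; lia.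
  exists (vmap g u); split.
    by apply/(dfn_fixes _ dP) => //; exact: fixes_sub fg.
  move=> w; rewrite -gl => /List.in_map_iff[v [<- /List.in_map_iff[i [<- /mem_In is']]]].
  apply/rel_aut; have [] // := Hu i (sS i _).
  exact: mem_drop is'.
(* Compactness replaces the single set [P] by the whole type of [d] over [N]. *)
have stepB l : morley l -> size l <= k ->
    exists a, (forall P, dfn N P -> P d -> P a) /\ forall w, List.In w l -> relsat psi a w.
  move=> ml lk.
  have [||||a Ha] := realize_fip ffK Csat (Y := prm l)
    (B := [set P : set (valuation C (vars sg)) |
      (dfn N P /\ P d) \/ exists w, List.In w l /\ P = (relsat psi)^~ w]).
  - exact: small_prm.
  - exact: smallx_vars.
  - move=> P [[dP _]|[w [lw ->]]]; first by apply: dfn_mono dP; apply: subset_trans NY _; exact: prm_Y.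
    by apply: dfn_rel_l; exact: prm_In.
  - move=> lB HB.
    have [P [dP Pd HP]] : exists P, [/\ dfn N P, P d &
        forall u, P u -> (forall w, List.In w l -> relsat psi u w) ->
        forall Q, List.In Q lB -> Q u].
      elim: lB HB => [|Q r IH] HB; first by exists setT; split=> //; exact: dfn_top.
      have [|P [dP Pd HP]] := IH; first by move=> Q' rQ'; apply: HB; right.
      have [[dQ Qd]|[w [lw ->]]] := HB Q (or_introl erefl).
        exists (P `&` Q); split=> //; first exact: dfn_and.
        by move=> u [Pu Qu] Hu Q' [<-//|]; exact: HP.
      by exists P; split=> // u Pu Hu Q' [<-|]; [exact: Hu|exact: HP].
    have [u [Pu Hu]] := stepA l P ml lk dP Pd.
    by exists u; exact: HP.
  exists a; split=> [P dP Pd|w lw]; first by apply: Ha; left.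
  by apply: (Ha ((relsat psi)^~ w)); right; exists w.
pose VW := (valuation C (vars sg) * valuation C (vars tau))%type.
pose fix prm2 (l : seq VW) : set (elt C) :=
  if l is (v, w) :: l' then prm2 l' `|` (ran v `|` ran w) else Y.
(* The relation to the earlier entries is required up to length [k] only: this is as far as [stepB]
   reaches, and enough to contradict [nok]. *)
pose fix good (l : seq VW) : Prop := if l is (v, w) :: l' then
   [/\ good l', forall P, dfn N P -> P d -> P v,
       size l' <= k -> forall w', List.In w' (map snd l') -> relsat psi v w' &
       forall Q, dfn (prm2 l' `|` ran v) Q -> R Q -> Q w] else True.
have sprm2 l : small K (prm2 l).
  elim: l => //= -[v w] l IH.
  by apply: (smallU ffK) => //; apply: (smallU ffK); apply: small_ran; exact: smallx_vars.
have prm2prm l : prm (map snd l) `<=` prm2 l.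
  by elim: l => //= -[v w] l IH e [/IH|we]; [left|right; right].
have gm l : good l -> morley (map snd l).
  elim: l => //= -[v w] l IH [gl _ _ Hw]; split; first exact: IH.
  by move=> Q dQ; apply: Hw; apply: dfn_mono dQ => e /prm2prm; left.
have [|h Hh] := @dependent_choice_hist VW good I.
  move=> l gl.
  have [v [Hv1 Hv2]] : exists v, (forall P, dfn N P -> P d -> P v) /\
      (size l <= k -> forall w', List.In w' (map snd l) -> relsat psi v w').
    have [lk|nlk] := leqP (size l) k; last by exists d.
    by have [|v [H1 H2]] := stepB _ (gm _ gl); [rewrite size_map|exists v].
  have [w Hw] := realize_over (smallU ffK (sprm2 l) (small_ran (v := v) (smallx_vars ffK (sg := sg)))).
  by exists (v, w).
have size_hist i : size (hist h i) = i by elim: i => //= i ->.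
have prmS j i : j < i -> ran (h j).1 `<=` prm2 (hist h i).
  elim: i => //= i IH; rewrite ltnS leq_eqVlt; case E : (h i) => [v w].
  move=> /orP[/eqP ->|/IH H]; first by rewrite E => e He; right; left.
  by move=> e /H H'; left.
apply: (nok (fun i => (h i).1) (fun i => (h i).2)) => i j ik jk.
split=> [rij|ji].
  rewrite ltnNge; apply/negP => ij.
  have := Hh j.+1; rewrite /=; case E : (h j) => [v w] [_ _ _ H].
  (* The first components realize the type of [d] over [N], so they are conjugate to [d] over [Y],
     and [R] rejects their instances of [psi] as it rejects that of [d]. *)
  have [|g [fg ga]] := dN (a := (h i).1).
    by have := Hh i.+1; rewrite /=; case: (h i) => v' w' [].
  have Rhi : R (~` relsat psi (h i).1).
    by rewrite -ga; apply: (inv_rel_conjr RR Ri fg); apply/(ultraNE RR).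
  have : (~` relsat psi (h i).1) (h j).2; last by [].
  rewrite E; apply: H => //; apply: dfn_not; apply: dfn_rel_r.
  move: ij; rewrite leq_eqVlt => /orP[/eqP ->|/prmS ij] e re; last by left; exact: ij.
  by right; rewrite E in re.
have := Hh i.+1; rewrite /=; case: (h i) => v w [_ _ H _]; apply: H.
  by rewrite size_hist ltnW.
by apply/List.in_map_iff; exists (h j); split=> //; exact: hist_In.
Qed.

End Dividing.

Definition tp Y X (d : valuation C X) : set (pformula Y X) := [set phi | psat d phi].

Lemma tp_complete Y X (d : valuation C X) : complete_type (@tp Y X d).
Proof.
split=> [q _ qt|phi]; first by exists d.
by have [h|h] := pselect (psat d phi); [left|right].
Qed.

Lemma psat_incl Y Z (YZ : Y `<=` Z) X (phi : pformula Y X) (v : valuation C X) :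
  psat v (rename (params_incl YZ (X := X)) phi) <-> psat v phi.
Proof.
rewrite /psat sat_rename.
suff -> : vcomp (val_sum v (@params_val _ C Z)) (params_incl YZ (X := X))
  = val_sum v (@params_val _ C Y) by [].
by apply: valE => s [].
Qed.

(** The hypothesis amounts to the type of [d] over [N] implying its type over [acl N]. The invariant
    extension over [acl N] is then invariant over [N], so no instance in it divides over [N],
    whereas an extension containing any other formula forks by [dividing_family]. *)
Lemma tp_stationary N X (d : valuation C X) : small K N -> smallx K X ->
  (forall g : aut C, fixes g N -> exists h : aut C, fixes h (acl N) /\ vmap h d = vmap g d) ->
  stationary (@tp N X d).
Proof.
move=> sN sX Hd.
pose Y := acl N.
have sY : small K Y by exact: small_acl.
have NY : N `<=` Y by exact: acl_self.
have aclY : acl Y `<=` Y by exact: (acl_idem ffK Csat Chom).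
have [U nU] := exists_inv_ext CT EI stab ffK Csat Chom sY aclY d.
have [UU Ui Ud] := nU.
(* The transform of [U] by [g] is an invariant extension of the type of [vmap g d] over [acl N],
   which is also the type of [d]; uniqueness identifies it with [U]. *)
have UN (g : aut C) P : fixes g N -> dfn setT P -> U P -> U (fun v => P (vmap g v)).
  move=> fg dP UP.
  have gY e : Y e -> Y (act g e) by exact: (acl_fixes ffK Csat Chom sN fg).
  have gY' e : Y e -> Y (act (aut_inv g) e) by exact: (acl_fixes ffK Csat Chom sN (fixes_inv fg)).
  have nUg : inv_ext Y (vmap g d) [set P | U (fun v => P (vmap g v))].
    split.
    - exact: (@ultra_pushforward _ _ (@vmap _ C g X)).
    - move=> h Q fh dQ UQ.
      have dQg : dfn setT (fun v => Q (vmap g v)) by exact: dfn_vmap dQ _ _.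
      have fh' : fixes (aut_comp (aut_inv g) (aut_comp h g)) Y.
        by move=> s x Yx /=; rewrite (fh s (g s x) (gY _ Yx)) apK.
      apply: (@filterS _ U _ _ _ _ (Ui _ _ fh' dQg UQ)) => v Hv.
      have E : vmap g (vmap (aut_comp (aut_inv g) (aut_comp h g)) v) = vmap h (vmap g v).
        by apply: valE => s x; rewrite /vmap /= aiK.
      by change (Q (vmap h (vmap g v))); rewrite -E.
    - move=> Q dQ Qd; apply: (Ud (fun v => Q (vmap g v))) => //.
      exact: dfn_vmap dQ _ _.
  have [h [fh hd]] := Hd g fg.
  have nUg' : inv_ext Y d [set P | U (fun v => P (vmap g v))].
    apply: (inv_ext_transport nUg) => Q dQ; rewrite -hd.
    by move/(dfn_fixes _ dQ fh).
  exact: (inv_ext_unique CT EI stab ffK Csat Chom sY aclY nU nUg' dP UP).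
have svars n (sg : 'I_n -> sorts L) : smallx K (vars sg) by exact: smallx_vars.
have vasg (g : aut C) k (rho : 'I_k -> sorts L) (x : Defs.tuple_of C rho) :
    vmap g (assign x) = assign (fun i => g _ (x i)).
  by apply: valE => s [].
move=> B NB.
exists [set phi : pformula B X | U (fun v => psat v phi)]; split.
  split; first exact: ultra_complete_type.
  - move=> phi; rewrite /tp /= => dphi.
    rewrite (_ : (fun v => _) = fun v => psat v phi); last first.
      by apply/funext => v; apply/propext; exact: psat_incl.
    by apply: Ud => //; apply: dfn_mono NY _; exact: dfn_psat.
  - move=> [q0 [k [th [fq0 q0q divl impl]]]].
    have Uq0 : U [set v | forall phi, q0 phi -> psat v phi].
      move/finite_In: fq0 => [l Hl].
      have : U [set v | forall P, List.In P [seq (fun v => psat v phi) | phi <- l] -> P v].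
        by apply: ultra_In => P /List.in_map_iff[phi [<- /Hl/q0q]].
      apply: filterS => v Hv phi /Hl lphi; apply: (Hv (fun v => psat v phi)).
      by apply/List.in_map_iff; exists phi.
    have : U [set v | exists l, inst_sat (@inst_param _ _ _ (th l)) v].
      by apply: filterS Uq0 => v /impl.
    move=> /(ultra_ord UU)[l Ul].
    have [j [b [bt bS]]] := divl l.
    have Ub i : U (inst_sat (b i)).
      have [|g [fg gb]] := hom_vmap ffK Chom (Y := N)
        (v := assign (@inst_param _ _ _ (th l))) (w := assign (b i)) sN (svars _ _).
        by move=> P [phi H]; rewrite !H => /(bt i).
      have dU : dfn setT (inst_sat (@inst_param _ _ _ (th l))).
        exact: dfn_instance.
      apply: filterS (UN _ _ (fixes_inv fg) dU Ul) => v.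
      rewrite /inst_sat -gb -[X in X -> _](aut_sat g).
      set v1 := (X in sat _ X -> _); set v2 := val_sum _ _; suff -> : v1 = v2 by [].
      by apply: valE => s [x|y] //=; rewrite /v1 /vmap /= aiK.
    apply: (bS `I_j); first by rewrite card_eqxx.
    have : U [set v | forall P, List.In P [seq inst_sat (b i) | i <- iota 0 j] -> P v].
      by apply: ultra_In => P /List.in_map_iff[i [<- _]].
    move=> /(ultra_ex UU)[v Hv]; exists v => i ij; apply: Hv.
    by apply/List.in_map_iff; exists i; split=> //; apply/mem_In; rewrite mem_iota.
move=> q [[_ qc] qext nfq].
suff sub phi : q phi -> U (fun v => psat v phi).
  apply/seteqP; split=> phi; last exact: sub.
  move=> Uphi; have [//|/sub] := qc phi.
  by move=> /(filterI Uphi)/(ultra_ex UU)[v [pv npv]]; exfalso; exact: (npv pv).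
move=> qphi; apply: contrapT => nUphi; apply: nfq.
have [n [sg [h [m [tau [b [psi [bB Hphi]]]]]]]] := dfn_support (dfn_psat phi).
have [R nR] := exists_inv_ext CT EI stab ffK Csat Chom sY aclY (assign b).
have E : (fun v => psat v phi) = fun v => relsat psi (vcomp v h) (assign b).
  by apply/funext => v; apply/propext; exact: Hphi.
have nRd : ~ R (relsat psi (vcomp d h)).
  have H := harrington_iff CT stab ffK Csat Chom psi sY (inv_ext_comp h nU) nR.
  by move/H => /=; rewrite -E.
have dN a : (forall P, dfn N P -> P (vcomp d h) -> P a) ->
    exists g : aut C, fixes g Y /\ vmap g (vcomp d h) = a.
  move=> /(hom_vmap ffK Chom sN (svars _ _))[g [fg <-]].
  have [g' [fg' gd]] := Hd g fg; exists g'; split=> //.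
  by rewrite -[LHS]/(vcomp (vmap g' d) h) gd.
have [k [P [g [dP Pd fg HS]]]] := dividing_family NY sY nR dN nRd.
have [chi Hchi] := dfn_comp h dP.
pose chiB := rename (params_incl NB (X := X)) chi.
have HchiB v : psat v chiB <-> P (vcomp v h) by rewrite psat_incl Hchi.
have qchi : q chiB by apply: qext; rewrite /tp /= -Hchi.
(* Division was obtained for [phi] together with the formula [chi] of the type of [d], so their
   conjunction is taken as the single instance that witnesses forking. *)
have [m' [rho [c [theta [cB Htheta]]]]] := dfn_formula (dfn_and (dfn_psat chiB) (dfn_psat phi)).
pose th := Instance theta (fun i => c _ (var_at rho i)).
have cE : assign (fun i => c _ (var_at rho i)) = c by apply: valE => s [].
exists [set phi' | List.In phi' [:: chiB; phi]], 1, (fun _ => th); split.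
- by apply/finite_In; exists [:: chiB; phi].
- by move=> phi' [<-|[<-|[]]].
- move=> _; exists k, (fun i j => g i _ (c _ (var_at rho j))).
  have gc i : assign (fun j => g i _ (c _ (var_at rho j))) = vmap (g i) c.
    by rewrite -vasg cE.
  split=> [i phi'|S Sk [v Hv]].
    rewrite gc /= cE; have fN := fixes_sub NY (fg i).
    by have := dfn_fixes c (dfn_psat phi') fN.
  apply: (HS S Sk); exists (vcomp v h) => i /Hv; rewrite /inst_sat /= gc.
  rewrite -[v in val_sum v](vmapKV (g i)).
  have -> : val_sum (vmap (g i) (vmap (aut_inv (g i)) v)) (vmap (g i) c) =
     (fun s x => g i s (val_sum (vmap (aut_inv (g i)) v) c x)) by apply: valE => s [].
  move=> /(aut_sat (g i))/Htheta[/HchiB Pv]; rewrite [psat _ _]Hphi.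
  split; last first.
    have : relsat psi (vcomp (vmap (aut_inv (g i)) v) h) (assign b) by [].
    move/(rel_aut psi (g i)).
    by rewrite -[vmap (g i) (vcomp _ h)]/(vcomp (vmap (g i) (vmap (aut_inv (g i)) v)) h) vmapKV.
  have fN := fixes_sub NY (fixes_inv (fg i)).
  by move/(dfn_fixes (vcomp v h) dP fN) : Pv.
- move=> v Hv; exists ord0; rewrite /inst_sat /= cE; apply/Htheta.
  by split; apply: Hv; [left|right; left].
Qed.

End Stationarity.

(** * PAC substructures *)

Section PAC.
Variables (L : language) (T : theory L) (C : structure L) (Kbar K : Type).
Hypothesis CT : models T C.
Hypothesis EI : elimination_of_imaginaries T.
Hypothesis stab : omega_stable T.
Hypothesis ffKbar : ~ lec Kbar (fin_formula L).
Hypothesis ffK : ~ lec K (fin_formula L).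
Hypothesis Csat : saturated C Kbar.
Hypothesis Chom : strongly_homogeneous C Kbar.
Variable F : substructure C.
Let FS := sub_set F.
Hypothesis F_small : small Kbar FS.
Hypothesis F_PAC : kappa_PAC K F.
Implicit Types (X : ctx L) (Y Z N A D : set (elt C)) (g h : aut C).

Lemma mk_elt_inj s : injective (@mk_elt L C s).
Proof. by move=> x y e; exact: (existT_inj e). Qed.

Lemma act_mkE g s (x y : C s) : act g (mk_elt x) = mk_elt y -> g s x = y.
Proof. by move=> e; exact: (mk_elt_inj e). Qed.

(** The PAC property is applied to the type over [N] of a tuple enumerating all of [D]. A
    realization in [F] is the image of [D] under an automorphism over [N], which the hypothesis
    replaces by one over [acl N]. *)
Lemma pac_set N D : N `<=` FS -> small K N -> small K D -> small Kbar D ->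
  (forall g, fixes g N -> exists h, fixes h (acl N) /\ forall e, D e -> act h e = act g e) ->
  exists h, fixes h (acl N) /\ forall e, D e -> FS (act h e).
Proof.
move=> NF sN sD sD' HD.
pose I := {e | D e}.
pose sg (i : I) := projT1 (proj1_sig i).
pose d : valuation C (vars sg) := assign (fun i => projT2 (proj1_sig i)).
have sN' : small Kbar N by exact: small_sub NF F_small.
have sX : smallx Kbar (vars sg).
  apply: below_mono sD'.
  exists (fun z : {s & vars sg s} => match projT2 z with var_at i => i end).
  by move=> [_ [i]] [_ [j]] /= ->.
have st : stationary (@tp _ C N (vars sg) d).
  apply: (tp_stationary CT EI stab ffKbar Csat Chom sN' sX) => g /HD[h [fh hg]].
  exists h; split=> //; apply: valE => s [i].
  exact: (existT_inj (hg _ (proj2_sig i))).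
have [|c [cF Hc]] := F_PAC NF ((card_lt_below _ _).2 sN) _ (tp_complete N d) st.
  by apply/card_lt_below; apply: below_mono (lec_setT _).1 _.
have [|g [fg gd]] := hom_vmap ffKbar Chom (v := d) (w := assign c) sN' sX.
  by move=> P [phi H]; rewrite !H => dphi; exact: Hc.
have [h [fh hg]] := HD g fg; exists h; split=> // e De.
rewrite hg //; have := cF (exist _ e De).
have := congr1 (fun v : valuation C (vars sg) => v _ (var_at sg (exist _ e De))) gd.
by rewrite /vmap /= => <-.
Qed.

(** Such a point is definable over [F], hence over a finite tuple [b] of [F]. It is the only
    realization of its type over [b], which is stationary, so the PAC property puts it in [F]. *)
Lemma fixed_in_F e : (forall g, fixes g FS -> act g e = e) -> FS e.
Proof.
case: e => s x Hx.
pose y := var_at (fun _ : unit => s) tt.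
pose P : set (valuation C (var1 s)) := fun w => w s y = x.
have dP : dfn FS P.
  apply: (inv_dfn ffKbar Csat Chom F_small (smallx_var1 ffKbar (s := s))).
    exact: (dfn_eq (X := var1 s) (inl y) (inr (exist _ x I : params (@setT (elt C)) s))).
  move=> g w fg; rewrite /P /vmap => ->.
  exact: act_mkE (Hx g fg).
have [n [tau [b [bF dPb]]]] := dfn_fin dP.
have gx g : fixes g (ran (assign b)) -> g s x = x.
  move=> fg; have : P (vmap g (assign1 x)) by apply/(dfn_fixes _ dPb fg).
  by [].
have sb : small K (ran (assign b)) by exact: small_fin.
have [|||h [fh FSh]] := pac_set (N := ran (assign b)) (D := [set mk_elt x]) bF sb.
- exact: small1.
- exact: small1.
- move=> g fg; exists (aut_id C); split=> // e ->.
  by rewrite /act /= gx.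
have hx : h s x = x by apply: gx; apply: fixes_sub fh; exact: acl_self.
by have := FSh _ erefl; rewrite /act /= hx.
Qed.

Definition good (t : aut C) A :=
  forall g, fixes g FS -> forall e, acl A e -> act t (act g e) = act g (act t e).

Lemma good_id A : good (aut_id C) A.
Proof. by move=> g fg [s x] _. Qed.

Lemma good_FS t A e : good t A -> A `<=` FS -> A e -> FS (act t e).
Proof.
move=> gt AF Ae; apply: fixed_in_F => g fg.
rewrite -gt //; last exact: acl_self.
by rewrite (fixes_act fg (AF _ Ae)).
Qed.

Lemma acl_act_inv g A e : small Kbar A -> acl (act g @` A) e -> acl A (act (aut_inv g) e).
Proof.
move=> sA /(@acl_act _ _ _ ffKbar Csat Chom _ (aut_inv g) _ (small_act (g := g) sA)).
suff -> : act (aut_inv g) @` (act g @` A) = A by [].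
apply/seteqP; split=> [_ [_ [a Aa <-] <-]|a Aa]; first by rewrite actK.
by exists (act g a); [exists a|rewrite actK].
Qed.

Lemma good_inv t A : small Kbar A -> good t A -> good (aut_inv t) (act t @` A).
Proof.
move=> sA gt g fg e /(acl_act_inv sA) Ae.
by rewrite -[e in LHS](actKV t) -gt // actK.
Qed.

Lemma act_comp g h e : act (aut_comp g h) e = act g (act h e).
Proof. by []. Qed.

Lemma acl_stab N g e : small Kbar N -> fixes g N -> acl N e -> acl N (act g e).
Proof. exact: (acl_fixes ffKbar Csat Chom). Qed.

Section OrbitMatch.
Variables (Z : set (elt C)) (ZF : Z `<=` FS).
Let F0 := acl Z.
Let N := FS `&` F0.

Lemma small_F0 : small Kbar F0.
Proof. by apply: small_acl => //; exact: small_sub F_small. Qed.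

Lemma acl_F0 : acl F0 `<=` F0.
Proof. by apply: (acl_idem ffKbar Csat Chom) => //; exact: small_sub F_small. Qed.

Lemma acl_N : acl N = F0.
Proof.
apply/seteqP; split.
  by move=> e; move/(acl_mono (@subIsetr _ FS F0)); exact: acl_F0.
by apply: acl_mono => e Ze; split; [exact: ZF|exact: acl_self].
Qed.

(* The orbit of a tuple algebraic over [N] under the automorphisms over [FS] is
   coded in [N], hence preserved by all automorphisms over [N]. *)
Lemma orbit_match n (sg : 'I_n -> sorts L) (e : valuation C (vars sg)) r :
  ran e `<=` F0 -> fixes r N -> exists g, fixes g FS /\ vmap g e = vmap r e.
Proof.
move=> eF0 fr.
pose O := [set v | exists g, fixes g FS /\ v = vmap g e].
have [l Hl] : exists l, forall g, fixes g N -> List.In (vmap g e) l.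
  by apply: tuple_orbit; rewrite acl_N.
have dO : dfn setT O.
  apply: (dfn_finite (l := l)) => _ [g [fg ->]]; apply: Hl.
  by apply: fixes_sub fg; exact: subIsetl.
have [m [tau [b Hb]]] := code CT EI dO.
(* [b] is in [F] because the orbit [O] is invariant over [F], and in [F0] because [O] consists of
   tuples from [F0]. *)
have bN : ran b `<=` N.
  move=> _ [s [x ->]]; split.
    apply: fixed_in_F => g fg.
    have : vmap g b = b.
      apply/Hb => v; split=> [[h [fh ->]]|[h [fh gv]]].
        by exists (aut_comp g h); split=> //; exact: fixes_comp.
      exists (aut_comp (aut_inv g) h); split; first by apply: fixes_comp => //; exact: fixes_inv.
      by rewrite -[v](vmapK g) gv.
    by move/vmap_fixes => fb; rewrite /act /= fb //; exists s, x.
  apply: acl_F0; apply: (fixed_acl ffKbar Csat Chom small_F0) => g fg.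
  have fO v : O v -> vmap g v = v.
    move=> [h [fh ->]]; apply/vmap_fixes; apply: fixes_sub fg => _ [u [z ->]].
    apply: (acl_stab (N := Z) (g := h) (e := mk_elt (e u z))); [exact: small_sub F_small|exact: fixes_sub fh|].
    by apply: eF0; exists u, z.
  have : vmap g b = b.
    apply/Hb => v; split=> [Ov|Ov]; first by rewrite fO.
    suff <- : vmap g v = v by [].
    exact: (can_inj (@vmapK _ _ g _)) (fO _ Ov).
  by move/vmap_fixes; apply; exists s, x.
have /Hb H : vmap r b = b by apply/vmap_fixes; exact: fixes_sub bN fr.
have [|g [fg gr]] := (H e).1; first by exists (aut_id C).
by exists g.
Qed.

End OrbitMatch.

Lemma extend t A c Z : A `<=` FS -> small K A -> good t A -> FS c ->
  Z `<=` FS -> small K Z ->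
  exists t', [/\ forall e, acl A e -> act t' e = act t e,
    good t' (A `|` [set c]) & ~ acl A c -> ~ acl Z (act t' c)].
Proof.
move=> AF sA gt cF ZF sZ.
have sub_small Y : Y `<=` FS -> small Kbar Y by move=> YF; exact: small_sub F_small.
pose M := act t @` A.
have MF : M `<=` FS by move=> _ [e Ae <-]; exact: good_FS gt AF Ae.
pose Ac := A `|` [set c].
have AcF : Ac `<=` FS by move=> e [/AF//|->].
(* [F0] has to contain the old domain with the new point, the old image, and the points to be
   avoided. *)
pose Z1 := (Ac `|` M) `|` Z.
have Z1F : Z1 `<=` FS by move=> e [[/AcF|/MF]|/ZF].
have sAc : small K Ac by apply: (smallU ffK) => //; exact: small1.
have sZ1 : small K Z1.
  by apply: (smallU ffK) => //; apply: (smallU ffK) => //; exact: small_act.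
pose F0 := acl Z1; pose N := FS `&` F0.
have NE : acl N = F0 by exact: acl_N.
have sF0 : small Kbar F0 by exact: small_F0.
have sF0' : small K F0 by exact: small_acl.
pose X0 := acl A; pose E := acl Ac; pose Y := acl M.
have sE : small Kbar E by apply: small_acl => //; exact: sub_small.
have sY : small Kbar Y by apply: small_acl => //; exact: sub_small.
have aclY : acl Y `<=` Y by apply: (acl_idem ffKbar Csat Chom) => //; exact: sub_small.
have EF0 : E `<=` F0 by apply: acl_mono => e Ae; left; left.
have YF0 : Y `<=` F0 by apply: acl_mono => e Ae; left; right.
have X0E : X0 `<=` E by apply: acl_mono; exact: subsetUl.
have tX0 e : X0 e -> Y (act t e) by exact: (acl_act ffKbar Csat Chom t (sub_small _ AF)).
have Yt e : Y e -> X0 (act (aut_inv t) e) by apply: acl_act_inv; exact: sub_small.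
have sXE : smallx Kbar (params E) by exact: smallx_params.
pose ve : valuation C (params E) := @params_val _ C E.
have [U nU] := exists_inv_ext CT EI stab ffKbar Csat Chom sY aclY (vmap t ve).
have [UU Ui Ut] := nU.
have [v1 Hv1] := realize ffKbar Csat sF0 sXE UU.
have [|r [fr rt]] := hom_vmap ffKbar Chom (v := vmap t ve) (w := v1) sY sXE.
  by move=> P dP /(Ut _ dP); apply: Hv1; exact: dfn_mono dP.
pose t1 := aut_comp r t.
have v1E : v1 = vmap t1 ve by rewrite -rt.
have Hv1' P : dfn F0 P -> P v1 -> U P.
  move=> dP Pv; apply: contrapT => /(ultraNE UU) nU'.
  exact: (Hv1 _ (dfn_not dP) nU').
have t1X e : X0 e -> act t1 e = act t e.
  by move=> Xe; rewrite act_comp (fixes_act fr) //; exact: tX0.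
have fixA g : fixes g FS -> fixes g A by exact: fixes_sub.
have stabE g e : fixes g FS -> E e -> E (act g e).
  by move=> fg; apply: acl_stab; [exact: sub_small|exact: fixes_sub fg].
have stabX g e : fixes g FS -> X0 e -> X0 (act g e).
  by move=> fg; apply: acl_stab; [exact: sub_small|exact: fixes_sub fg].
have stabY g e : fixes g FS -> Y e -> Y (act g e).
  by move=> fg; apply: acl_stab; [exact: sub_small|exact: fixes_sub fg].
have stabF g e : fixes g FS -> F0 e -> F0 (act g e).
  by move=> fg; apply: acl_stab; [exact: sub_small|exact: fixes_sub fg].
have lift g : fixes g FS -> exists k, (forall e, F0 e -> act k e = act g e) /\
    forall e, E e -> act k (act t1 e) = act t1 (act g e).
  move=> fg; have fg' := fixes_inv fg.
  pose p : ctx_map (params E) (params E) := fun s x =>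
    exist _ (g s (proj1_sig x)) (stabE g _ fg (proj2_sig x)).
  (* [Th] is the twist by [g]: it turns the enumeration of [t1 e] into that of [g^-1 (t1 (g e))]. By
     uniqueness the invariant type is preserved by this twist. *)
  pose Th (v : valuation C (params E)) := vmap (aut_inv g) (vcomp v p).
  have dTh Y1 P : (forall e, Y1 e -> Y1 (act g e)) -> (forall e, Y1 e -> Y1 (act (aut_inv g) e)) ->
      dfn Y1 P -> dfn Y1 (fun v => P (Th v)).
    move=> h1 h2 dP; apply: (dfn_comp p (P := fun v => P (vmap (aut_inv g) v))).
    by apply: (dfn_vmap dP) => // e /h1; rewrite (_ : aut_inv (aut_inv g) = g) //; case: (g).
  have dThT P : dfn setT P -> dfn setT (fun v => P (Th v)) by exact: dTh.
  have nU' : inv_ext Y (vmap t ve) [set P | U (fun v => P (Th v))].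
    split.
    - exact: (@ultra_pushforward _ _ Th).
    - move=> h P fh dP UP.
      have fh' : fixes (aut_comp g (aut_comp h (aut_inv g))) Y.
        move=> s x Yx /=; rewrite (fh s (ai g x)) ?aiK //.
        exact: (stabY (aut_inv g) (mk_elt x) fg' Yx).
      apply: (@filterS _ U _ _ _ _ (Ui _ _ fh' (dThT _ dP) UP)) => v Hv.
      change (P (vmap h (Th v))).
      suff -> : vmap h (Th v) = Th (vmap (aut_comp g (aut_comp h (aut_inv g))) v) by [].
      by apply: valE => s x; rewrite /Th /vmap /vcomp /= apK.
    - move=> P dP Pt; apply: (Ut (fun v => P (Th v))).
        by apply: dTh => // e; exact: stabY.
      (* This commutator of [t] and [g] fixes [Y], because [t] commutes with [g] on [acl A]. *)
      pose a := aut_comp (aut_inv g) (aut_comp t (aut_comp g (aut_inv t))).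
      have fa : fixes a Y.
        move=> s y Yy; suff : act a (mk_elt y) = mk_elt y by exact: act_mkE.
        rewrite /a !act_comp (gt _ fg _ (Yt _ Yy)) actK.
        by rewrite actKV.
      have -> : Th (vmap t ve) = vmap a (vmap t ve).
        by apply: valE => s x; rewrite /Th /vmap /vcomp /= apK.
      by apply/(dfn_fixes _ dP fa).
  have [|k [fk kv]] := hom_vmap ffKbar Chom (Y := F0) (v := v1) (w := Th v1) sF0 sXE.
    move=> P dP /(Hv1' _ dP) UP; apply: (Hv1 (fun v => P (Th v))).
      by apply: dTh => // e; exact: stabF.
    apply: (inv_ext_unique CT EI stab ffKbar Csat Chom sY aclY nU nU' _ UP).
    exact: dfn_mono dP.
  (* [k] fixes [F0] and takes [t1] to its twist, so following it by [g] gives both required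
     actions. *)
  exists (aut_comp g k); split=> [e Fe|[s x] Ee]; first by rewrite act_comp (fixes_act fk Fe).
  have := congr1 (fun v : valuation C (params E) => v s (exist _ x Ee)) kv.
  rewrite v1E /Th /vmap /vcomp /= => e1.
  by rewrite /act /= e1 aiK.
pose H k := exists g, [/\ fixes g FS, forall e, F0 e -> act k e = act g e &
    forall e, E e -> act k (act t1 e) = act t1 (act g e)].
have Hinv k : H k -> H (aut_inv k).
  move=> [g [fg k1 k2]]; have fg' := fixes_inv fg; exists (aut_inv g); split=> // e He.
    by rewrite -{1}[e](actKV g) -k1 ?actK //; exact: stabF.
  by rewrite -{1}[e](actKV g) -k2 ?actK //; exact: stabE.
pose D := [set d | forall k, H k -> act k d = d].
have sEF : small Kbar (F0 `|` (act t1 @` E)) by apply: (smallU ffKbar) => //; exact: small_act.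
have DF : D `<=` acl (F0 `|` (act t1 @` E)).
  move=> [s x] Dx; apply: (fixed_acl ffKbar Csat Chom sEF) => g fg.
  apply: act_mkE; apply: Dx; exists (aut_id C); split=> // e He.
    by rewrite (fixes_act fg) //; [case: e {He}|left].
  by rewrite (fixes_act fg); [case: e {He}|right; exists e].
have sD' : small Kbar D by apply: small_sub DF _; exact: small_acl.
have sD : small K D.
  apply: small_sub DF _; apply: small_acl => //; apply: (smallU ffK) => //.
  by apply: small_act; exact: small_acl.
(* The finite set of pairs [(t1 y, y)], with [y] conjugate to [x] over [F], has its code in [D]. It
   is the graph of a function of [y], so an automorphism that fixes [D] and [x] also fixes
   [t1 x]. *)
have claim1 g e : fixes g D -> fixes g F0 -> E e -> act g (act t1 e) = act t1 e.
  case: e => s x fD fF Ee.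
  pose pr (u w : C s) : valuation C (vars (fun _ : 'I_2 => s)) :=
    assign (fun i => if i == ord0 then u else w).
  have pr_inj u w u' w' : pr u w = pr u' w' -> u = u' /\ w = w'.
    move=> e; split.
      exact: (congr1 (fun v : valuation C (vars (fun _ : 'I_2 => s)) => v s (var_at _ ord0)) e).
    exact: (congr1 (fun v : valuation C (vars (fun _ : 'I_2 => s)) => v s (var_at _ ord_max)) e).
  have prg (k : aut C) u w : vmap k (pr u w) = pr (k s u) (k s w).
    by apply: valE => _ [i]; rewrite /vmap /=; case: ifP.
  pose O := [set v | exists k, fixes k FS /\ v = pr (t1 s (k s x)) (k s x)].
  have [l Hl] := acl_orbit Ee.
  have dO : dfn setT O.
    apply: (dfn_finite (l := [seq pr (t1 s y) y | y <- l])) => _ [k [fk ->]].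
    by apply/List.in_map_iff; exists (k s x); split=> //; apply: Hl; exact: fixes_sub fk.
  have [m [tau [b Hb]]] := code CT EI dO.
  have OH k v : H k -> O v -> O (vmap k v).
    move=> [k' [fk' k1 k2]] [j [fj ->]].
    exists (aut_comp k' j); split; first exact: fixes_comp.
    have Ej := stabE _ _ fj Ee.
    have e1 := mk_elt_inj (k1 _ (EF0 _ Ej)).
    have e2 := mk_elt_inj (k2 _ Ej).
    by rewrite prg e1 e2.
  have bD : ran b `<=` D.
    move=> _ [u [z ->]] k Hk.
    have : vmap k b = b.
      apply/Hb => v; split; first exact: OH.
      by move/(OH _ _ (Hinv _ Hk)); rewrite vmapK.
    by move/vmap_fixes => fb; rewrite /act /= fb //; exists u, z.
  have /Hb HO : vmap g b = b by apply/vmap_fixes; exact: fixes_sub bD fD.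
  have [|k [fk]] := (HO (pr (t1 s x) x)).1; first by exists (aut_id C).
  rewrite prg => /pr_inj[e1 e2].
  have gx : g s x = x by apply: fF; exact: EF0.
  by rewrite /act; congr existT; rewrite [LHS]e1 -e2 gx.
(* On the parameters [e2] the automorphism [g] agrees with some [k] over [F], and [k] has a lift [j]
   that fixes [D]. Replacing [g] by [j] shows that [D] and its image by [g] have the same type over
   [F0]. *)
have claim2 g : fixes g N -> exists h, fixes h (acl N) /\ forall e, D e -> act h e = act g e.
  move=> fg; rewrite NE.
  pose vd : valuation C (params D) := @params_val _ C D.
  have [|h [fh hv]] := hom_vmap ffKbar Chom (Y := F0) (v := vd) (w := vmap g vd) sF0 (smallx_params sD').
    move=> P /dfn_formula[m [tau [e [psi [eF HP]]]]]; rewrite !HP => Pd.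
    pose e2 := vmap (aut_inv g) e.
    have e2F : ran e2 `<=` F0.
      move=> _ [s [x ->]]; rewrite -NE.
      apply: (acl_stab (N := N) (g := aut_inv g) (e := mk_elt (e s x))).
      + by apply: sub_small; exact: subIsetl.
      + exact: fixes_inv.
      + by rewrite NE; apply: eF; exists s, x.
    have [k [fk kg]] := orbit_match Z1F e2F fg.
    have gE : vmap g e2 = e by exact: vmapKV.
    have [j [j1 j2]] := lift k fk.
    have je : vmap j e2 = e.
      rewrite -gE -kg; apply: valE => s x.
      by apply: mk_elt_inj; apply: (j1 (mk_elt (e2 s x))); apply: e2F; exists s, x.
    have jd : vmap j vd = vd.
      apply: valE => s [x Dx]; rewrite /vmap /vd /=.
      by apply: act_mkE; apply: Dx; exists k.
    have aut_psi (q : aut C) v w : sat psi (val_sum (vmap q v) (vmap q w)) <-> sat psi (val_sum v w).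
      rewrite -[X in _ <-> X](aut_sat q).
      set w1 := val_sum _ _; set w2 := (X in _ <-> sat psi X); suff -> : w1 = w2 by [].
      by apply: valE => s [].
    by rewrite -gE aut_psi -(aut_psi j) je jd.
  exists h; split=> // -[s x] Dx.
  have := congr1 (fun v : valuation C (params D) => v s (exist _ x Dx)) hv.
  by rewrite /vmap /= => e1; rewrite /act /= e1.
have sN : small K N by apply: small_sub sF0'; exact: subIsetr.
have [h [fh hD]] := pac_set (@subIsetl _ FS F0) sN sD sD' claim2.
rewrite NE in fh.
exists (aut_comp h t1); split.
- move=> e Xe; rewrite act_comp t1X // (fixes_act fh) //; apply: YF0; exact: tX0.
- move=> g fg e Ee; have [k [k1 k2]] := lift g fg.
  have Hk : H k by exists g.
  (* On [D], [g] fixes the points of [h D], which lie in [F], and [k] fixes [D]. On [F0], [h] is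
     trivial and [k] undoes [g]. Hence [q] fixes [D] and [F0], and by [claim1] also [t1 E]: this is
     the required commutation. *)
  pose q := aut_comp (aut_inv k) (aut_comp (aut_inv h) (aut_comp g h)).
  have qD : fixes q D.
    move=> s x Dx; suff : act q (mk_elt x) = mk_elt x by exact: act_mkE.
    rewrite /q !act_comp (fixes_act fg (hD _ Dx)) actK.
    exact: Dx (Hinv _ Hk).
  have qF : fixes q F0.
    move=> s x Fx; suff : act q (mk_elt x) = mk_elt x by exact: act_mkE.
    rewrite /q !act_comp (fixes_act fh Fx) (fixes_act (fixes_inv fh)); last exact: stabF.
    by rewrite -k1 // actK.
  have qE : act q (act t1 e) =
    act (aut_inv k) (act (aut_inv h) (act g (act h (act t1 e)))) by [].
  have := claim1 q e qD qF Ee; rewrite qE => /(congr1 (act k)).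
  by rewrite actKV k2 // => /(congr1 (act h)); rewrite actKV => /esym.
- move=> nc Zc.
  have Fc : F0 (act t1 c).
    have : F0 (act (aut_comp h t1) c) by apply: acl_mono Zc => e Ze; right.
    move=> Fhc; have := fixes_act (fixes_inv fh) Fhc.
    by rewrite act_comp actK => ->.
  have Ec : E c by apply: acl_self; right.
  have nY : ~ Y (act t1 c).
    move=> Yc; apply: nc.
    have e1 : act t c = act t1 c.
      by rewrite -[LHS](actK r); exact: (fixes_act (fixes_inv fr) Yc).
    rewrite -e1 in Yc.
    by have := Yt _ Yc; rewrite actK.
  have [g [fg]] : exists g, fixes g Y /\ act g (act t1 c) <> act t1 c.
    case E1 : (act t1 c) nY => [s f] nY.
    have [|g [fg gf]] := not_acl_moved ffKbar Csat Chom (Y := Y) (x := f) sY.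
      by move/aclY.
    by exists g; split=> // /act_mkE.
  apply.
  pose z : params E (projT1 c) := exist _ (projT2 c)
    (match c as e return E e -> E (mk_elt (projT2 e)) with existT s x => id end Ec).
  have v1c : act t1 c = mk_elt (v1 _ z) by rewrite v1E.
  (* With [t1 c] in [F0], the type [U] prescribes the value at [c]. Being invariant over [Y], it
     prescribes the conjugate of this value by [g] too, so the two coincide. *)
  pose P : set (valuation C (params E)) := fun v => v _ z = v1 _ z.
  have dP : dfn F0 P.
    have Fv : F0 (mk_elt (v1 _ z)) by rewrite -v1c.
    pose a : params F0 (projT1 c) := exist _ (v1 _ z) Fv.
    have H1 := dfn_eq (X := params E) (Y := F0) (inl z) (inr a).
    exact: H1.
  have UP : U P by exact: Hv1'.
  have dPT : dfn setT P by exact: dfn_mono dP.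
  have UP' := Ui _ _ (fixes_inv fg) dPT UP.
  have [v [Pv Pv']] := ultra_ex UU (filterI UP UP').
  rewrite v1c; congr mk_elt; move: Pv'; rewrite /P /vmap => e1.
  by rewrite -[in LHS]e1 aiK.
Qed.

(** * Formulas and algebraic closure in the structure [F] *)

Definition proj X (v : valuation (induced F) X) : valuation C X :=
  fun s x => proj1_sig (v s x).

Lemma eval_induced X (v : valuation (induced F) X) s (t : term X s) :
  proj1_sig (eval v t) = eval (proj v) t.
Proof.
elim: t => //= f ts IH; congr fint; exact: functional_extensionality_dep.
Qed.

Lemma sat_induced X (phi : formula X) (v : valuation (induced F) X) :
  quantifier_free phi -> sat phi v <-> sat phi (proj v).
Proof.
elim: phi v => {X}[X|X s t u|X r ts|X a IHa b IHb|X s a IH] v //=.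
- by move=> _; rewrite -!eval_induced; split=> [->//|/sig_inj].
- move=> _.
  suff -> : (fun i => proj1_sig (eval v (ts i))) = fun i => eval (proj v) (ts i) by [].
  by apply: functional_extensionality_dep => i; rewrite eval_induced.
- by move=> [qa qb]; rewrite IHa // IHb.
Qed.

(** Atomic formulas of [F] are preserved by any automorphism of [C]. A quantifier is crossed by
    extending [t] to one more point of [F] or, for the other direction, by extending its inverse on
    the image of [A]. *)
Lemma sat_good X (phi : formula X) (v w : valuation (induced F) X) t A :
  A `<=` FS -> small K A -> good t A ->
  (forall s x, A (mk_elt (proj v x : C s))) ->
  (forall s x, proj w x = t s (proj v x)) ->
  sat phi v <-> sat phi w.
Proof.
have smallS A' c : small K A' -> small K (A' `|` [set c]).
  by move=> sA'; apply: (smallU ffK) => //; exact: small1.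
have small_bar A' : A' `<=` FS -> small Kbar A' by move=> A'F; exact: small_sub F_small.
have atom X' (psi : formula X') (v' w' : valuation (induced F) X') (t' : aut C) :
    quantifier_free psi -> (forall s x, proj w' x = t' s (proj v' x)) ->
    sat psi v' <-> sat psi w' => [qf pw|].
  rewrite !sat_induced // -(aut_sat t').
  by rewrite (_ : proj w' = vmap t' (proj v')) //; exact: valE.
elim: phi v w t A => {X}[X|X s t0 u|X r ts|X a IHa b IHb|X s a IH] v w t A AF sA gt Av wv.
- by [].
- exact: (atom _ (Feq t0 u)) wv.
- exact: (atom _ (Frel ts)) wv.
- by rewrite /= (IHa v w t A) // (IHb v w t A).
split=> /= H d.
  have gi := good_inv (small_bar _ AF) gt.
  have tAF : act t @` A `<=` FS by move=> _ [e Ae <-]; exact: good_FS gt AF Ae.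
  have stA : small K (act t @` A) by exact: small_act.
  have dF : FS (mk_elt (proj1_sig d)) by exact: (proj2_sig d).
  have [t2 [t2E gt2 _]] := extend tAF stA gi dF tAF stA.
  pose B := act t @` A `|` [set mk_elt (proj1_sig d)].
  have BF : B `<=` FS by move=> e [/tAF|->].
  have cF : FS (act t2 (mk_elt (proj1_sig d))) by apply: good_FS gt2 BF _; right.
  pose c : induced F s := exist _ (t2 s (proj1_sig d)) cF.
  have t2t s' (x : C s') : A (mk_elt x) -> t2 s' (t s' x) = x.
    move=> Ax; apply: act_mkE.
    have tx : (act t @` A) (mk_elt (t s' x)) by exists (mk_elt x).
    by rewrite (t2E _ (acl_self tx)) /act /= apK.
  apply/(IH (val_ext v c) (val_ext w d) (aut_inv t2) (act t2 @` B)) => //.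
  - by move=> _ [e Be <-]; exact: good_FS gt2 BF Be.
  - by apply: small_act; exact: smallS.
  - exact: good_inv (small_bar _ BF) gt2.
  - move=> s' [|s'' x]; first by exists (mk_elt (proj1_sig d)) => //; right.
    exists (mk_elt (t s'' (proj v x))); first by left; exists (mk_elt (proj v x)).
    by rewrite /act /= t2t.
  - move=> s' [|s'' x]; first by rewrite /proj /= apK.
    by rewrite [LHS]wv -[LHS](aut_invK t2) (t2t _ _ (Av _ x)).
have dF : FS (mk_elt (proj1_sig d)) by exact: (proj2_sig d).
have [t2 [t2E gt2 _]] := extend AF sA gt dF AF sA.
pose B := A `|` [set mk_elt (proj1_sig d)].
have BF : B `<=` FS by move=> e [/AF|->].
have cF : FS (act t2 (mk_elt (proj1_sig d))) by apply: good_FS gt2 BF _; right.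
pose c : induced F s := exist _ (t2 s (proj1_sig d)) cF.
apply/(IH (val_ext v d) (val_ext w c) t2 B) => //.
- exact: smallS.
- by move=> s' [|s'' x]; [right|left; exact: Av].
- move=> s' [|s'' x] //; rewrite [LHS]wv; apply/esym; apply: act_mkE.
  by rewrite t2E //; apply: acl_self; exact: Av.
Qed.

Lemma acl_induced_sub A c : A `<=` FS -> small K A ->
  acl (sub_incl (F := F) @^-1` A) c -> acl A (sub_incl c).
Proof.
case: c => s x AF sA [phi /= [px /finite_In[l finx]]]; apply: contrapT => nx.
set A' := sub_incl (F := F) @^-1` A in phi px finx.
(* [Z] is the set of solutions of [phi] in [F]. Extending the identity so that [x] is sent outside
   [acl Z] produces a further solution, a contradiction. *)
pose Z := [set e : elt C | List.In e [seq mk_elt (proj1_sig y) | y <- l]].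
have ZF : Z `<=` FS by move=> e /List.in_map_iff[y [<- _]]; exact: (proj2_sig y).
have sZ : small K Z.
  apply: (below_nat ffK).
  have H (e : {e | Z e}) : {i : nat |
      nth (proj1_sig e) [seq mk_elt (proj1_sig y) | y <- l] i = proj1_sig e /\ i < size l}.
    apply: cid; have [i ei] := In_nth (proj2_sig e).
    exists i; rewrite -[X in _ < X](size_map (fun y => mk_elt (proj1_sig y))) ltn_ord; split=> //.
    by rewrite -[RHS]ei (tnth_nth (proj1_sig e)).
  exists (fun e => proj1_sig (H e)) => e e' ee'; apply: sig_inj.
  have [h1 h2] := proj2_sig (H e); have [h3 h4] := proj2_sig (H e').
  by rewrite -h1 -h3 ee'; apply: set_nth_default; rewrite size_map.
have xF : FS (mk_elt (proj1_sig x)) by exact: (proj2_sig x).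
have [t [tE gt nZ]] := extend AF sA (@good_id A) xF ZF sZ.
pose B := A `|` [set mk_elt (proj1_sig x)].
have BF : B `<=` FS by move=> e [/AF|->].
have sB : small K B by apply: (smallU ffK) => //; exact: small1.
have yF : FS (act t (mk_elt (proj1_sig x))) by apply: good_FS gt BF _; right.
pose y : induced F s := exist _ (t s (proj1_sig x)) yF.
have ly : List.In y l.
  suff st : psat (assign1 x) phi <-> psat (assign1 y) phi by apply/finx/st.
  apply: (@sat_good _ _ _ _ t B) => //.
    by move=> s' [[i]|[a A'a]]; [right|left].
  move=> s' [[i]|[a A'a]] //; apply/esym; apply: act_mkE.
  by rewrite tE //; apply: acl_self.
apply: (nZ nx); apply: acl_self.
by apply/List.in_map_iff; exists y.
Qed.

Hypothesis QE : quantifier_elimination T.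

Lemma acl_sub_induced A c : A `<=` FS ->
  acl A (sub_incl c) -> acl (sub_incl (F := F) @^-1` A) c.
Proof.
case: c => s x AF /acl_dfn[P [[phi HP] Px [l Pl]]].
have [n [sg [h [phi0 H0]]]] := vars_support C (phi : formula (ctx_sum (var1 s) (params A))).
have [psi [qf Hpsi]] := QE phi0.
pose A' := sub_incl (F := F) @^-1` A.
pose k0 s' (z : (var1 s s' + params A s')%type) : (var1 s s' + @params _ (induced F) A' s')%type :=
  match z with
  | inl y => inl y
  | inr a => inr (exist (fun b : induced F s' => A' (mk_elt b))
                   (exist _ (proj1_sig a) (AF _ (proj2_sig a))) (proj2_sig a)) end.
pose k : ctx_map (vars sg) (ctx_sum (var1 s) (params A')) := fun s' z => k0 s' (h s' z).
have E (d : induced F s) : psat (assign1 d) (rename k psi : pformula A' (var1 s)) <->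
    P (assign1 (proj1_sig d)).
  rewrite /psat sat_rename sat_induced // HP /psat H0 (Hpsi C CT).
  set v1 := proj _; set v2 := vcomp _ _; suff -> : v1 = v2 by [].
  apply: valE => s' z; rewrite /v1 /v2 /proj /vcomp /k.
  by case: (h s' z) => // -[i].
exists (rename k psi : pformula A' (var1 s)); split; first exact/E.
apply/finite_In.
have [r Hr] : exists r : seq (induced F s), forall d, List.In (proj1_sig d) l -> List.In d r.
  elim: (l) => [|y l' [r Hr]]; first by exists [::].
  have [yF|nyF] := pselect (FS (mk_elt y)); last first.
    exists r => d [yd|/Hr//]; exfalso; apply: nyF; rewrite yd; exact: (proj2_sig d).
  exists (exist _ y yF :: r) => d [yd|/Hr]; [left|by right].
  exact: sig_inj.
by apply: (finite_subset (l := r)) => d /E/Pl/Hr.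
Qed.

End PAC.

Unset Implicit Arguments.

Theorem proposition7p4 (L : language) (T : theory L)
  (T_complete : complete_theory T)
  (T_QE : quantifier_elimination T)
  (T_EI : elimination_of_imaginaries T)
  (Kbar : Type) (C : structure L) (C_monster : monster T Kbar C)
  (T_stable : omega_stable T)
  (K : Type) (K_large : card_lt [set: fin_formula L] [set: K])
  (F : substructure C) (F_small : card_lt (sub_set F) [set: Kbar])
  (F_PAC : kappa_PAC K F)
  (A : set (elt C)) (A_sub : A `<=` sub_set F)
  (A_card : card_lt A [set: K]) :
  sub_incl (F := F) @` acl (sub_incl (F := F) @^-1` A)
    = acl A `&` sub_set F.
Proof.
have [CT ffKbar Csat Chom] := C_monster.
have below U : card_lt [set: fin_formula L] [set: U] -> ~ lec U (fin_formula L).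
  by move=> /card_lt_below; apply: below_mono; exact: (lec_setT _).2.
move: ffKbar K_large F_small A_card.
move=> /below ffKbar /below ffK /card_lt_below sF /card_lt_below sA.
apply/seteqP; split=> [_ [c Ac <-]|e [Ae Fe]].
  split; last exact: (proj2_sig (projT2 c)).
  exact: (acl_induced_sub CT T_EI T_stable ffKbar ffK Csat Chom sF F_PAC A_sub sA).
case: e Ae Fe => s x Ax Fx.
exists (existT _ s (exist _ x Fx)) => //.
exact: (acl_sub_induced CT T_QE A_sub).
Qed.
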